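(* For given $n\in(0,3)\setminus\{3-\frac1m:m\in\mathbb N\}$ and $\theta>0$ there exists a unique solution $H\in C^1([0,1])\cap C^3((0,1))$ of the problem $$H^{n-1}\frac{d^3H}{dx^3}=-1+x\ \text{ for } x\in(0,1),\qquad \Big(H,\frac{dH}{dx}\Big)=(0,\theta)\ \text{ at } x=0,\qquad \frac{dH}{dx}=0\ \text{ at } x=1,$$ with the asymptotic $$H=\theta x\Big(1+v\big(x,x^{\beta}\big)\Big)\qquad\text{for } 0\le x\ll1,$$ where $\beta=3-n$ and $v=v(x_1,x_2)$ is an analytic function in a neighborhood of $(x_1,x_2)=(0,0)$, $v(0,0)=0$ but $v\not\equiv0$, with an in general non-trivial dependence on both $x_1$ and $x_2$.
   Context: $\mathbb N=\{1,2,3,\dots\}$. The unknown $H$ is the height of a film and the differential equation is understood on the set where $H>0$; thus a solution is positive on $(0,1)$. ''For $0\le x\ll1$'' means: there is a constant $c>0$ such that the assertion holds for all $0\le x\le c$. *)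

(* Defs.v *)
From HB Require Import structures.
From mathcomp Require Import all_boot all_order all_algebra.
From mathcomp Require Import all_classical all_reals all_analysis.

Set Implicit Arguments.
Unset Strict Implicit.
Unset Printing Implicit Defensive.

Import Order.TTheory GRing.Theory Num.Theory.
Import numFieldNormedType.Exports.

Local Open Scope classical_set_scope.
Local Open Scope ring_scope.

(* The difference quotient only uses points of [A], so this is the one-sided
   derivative at an endpoint of an interval [A], and the usual derivative at an
   interior point. *)
Definition is_derive_on (R : realType) (A : set R) (f : R -> R) (x l : R) :=
  (f y - f x) / (y - x) @[y --> within A x^'] --> l.

Definition C1_on (R : realType) (A : set R) (f : R -> R) :=
  exists g : R -> R,
    (forall x, A x -> is_derive_on A f x (g x)) /\ {within A, continuous g}.

(* Intended for open [A] only: the iterated derivatives are the two-sided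
   ones. *)
Definition Ck_on_open (R : realType) (k : nat) (A : set R) (f : R -> R) :=
  (forall i x, (i < k)%N -> A x -> derivable (f^`(i))%classic x 1) /\
  {within A, continuous (f^`(k))%classic}.

(* Near [p], [v] is the sum of an absolutely convergent double power series in
   the increments [h]; absolute convergence makes the order of summation
   irrelevant, so the sum is taken along square partial sums. *)
Definition analytic2_at (R : realType) (v : R * R -> R) (p : R * R) :=
  exists a : nat * nat -> R, \forall h \near ((0, 0) : R * R),
    summable [set: nat * nat] (fun i => (a i * h.1 ^+ i.1 * h.2 ^+ i.2)%:E) /\
    \sum_(j < N) \sum_(k < N) a (nat_of_ord j, nat_of_ord k) * h.1 ^+ j * h.2 ^+ k
      @[N --> \oo] --> v (p.1 + h.1, p.2 + h.2).

(* Values of [H] outside [0, 1] are irrelevant. *)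
Definition is_solution (R : realType) (n theta : R) (H : R -> R) :=
  [/\ C1_on `[0, 1] H /\ Ck_on_open 3 `]0, 1[ H,
      forall x : R, x \in `]0, 1[ -> 0 < H x,
      forall x : R, x \in `]0, 1[ -> H x `^ (n - 1) * (H^`(3))%classic x = - 1 + x,
      H 0 = 0 /\ is_derive_on `[0, 1] H 0 theta
    & is_derive_on `[0, 1] H 1 0].

(* Equalities between functions of two variables are equalities of germs at
   the origin: [v] is not identically zero near the origin, and it is there
   neither a function of the second variable alone nor of the first variable
   alone. *)
Definition nonzero_germ (R : realType) (v : R * R -> R) :=
  ~ \forall p \near ((0, 0) : R * R), v p = 0.

Definition depends_on_fst (R : realType) (v : R * R -> R) :=
  ~ exists w : R -> R, \forall p \near ((0, 0) : R * R), v p = w p.2.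

Definition depends_on_snd (R : realType) (v : R * R -> R) :=
  ~ exists w : R -> R, \forall p \near ((0, 0) : R * R), v p = w p.1.

(* Main.v *)
Require Import Defs.
From HB Require Import structures.
From mathcomp Require Import all_boot all_order all_algebra.
From mathcomp Require Import all_classical all_reals all_analysis.
From mathcomp Require Import ring lra.

Import Order.TTheory GRing.Theory Num.Theory.
Import numFieldNormedType.Exports.

Set Implicit Arguments.
Unset Strict Implicit.
Unset Printing Implicit Defensive.

Local Open Scope classical_set_scope.
Local Open Scope ring_scope.

(** With beta = 3 - n, x = X e^t, D = d/dt and H = theta x (1 + phi), the equation
    becomes (D^3 - D) phi = - theta^(-n) x^beta (1 - x) (1 + phi)^(1 - n).  Since
    j + beta k <> 1 for k >= 1, it is solved by a power series in (x, x^beta) in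
    which the coefficient a of x is free; the series of (1 + phi)^(1 - n) is
    obtained along with it from (1 + phi) D g = (1 - n) g D phi, and the l^1 norms
    of the homogeneous parts show that both converge, uniformly in a.

    These local solutions are continued to x = 1 by Picard iteration, after
    cutting the nonlinearity off below H = theta x / 2.  H'(1) depends
    continuously on a and changes sign, so it vanishes for some a; then H' is
    concave, H >= theta x / 2, and the cutoff is inactive.

    Uniqueness follows for n <= 1 from the sublinearity of h^(1 - n), and for
    n >= 1 from its monotonicity, through an energy identity.  The dependence of
    the expansion on both variables is read off the coefficients of x, x^beta
    and x^(1 + beta). *)

(** * Geometrically dominated series *)

(** The equation is singular at x = 0, so initial value theory starts only at s = X/2, with data
    taken from the series. The scale X carries the smallness: in the variables x/(64 X) and
    x^beta/(64 X^beta) the forcing has a coefficient [kappa] proportional to X^beta, and the factor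
    1/64 leaves the geometric room that differentiating and multiplying series costs. The range |a|
    <= eps of the free coefficient does not shrink with X, whereas its contribution to H''(s) is
    theta a/(32 X). Hence for small X the ends a = -eps and a = eps give H''(s) as negative and as
    large as wanted, while H and H' at s stay between 0 and 2 theta; this makes H'(1) negative at
    one end and nonnegative at the other. Treating (1 + phi)^(1 - n) as an unknown of a linear
    equation means that only products of series occur, never a composition. The bound that removes
    the cutoff needs only H''' <= 0, which the cut-off equation has by its sign, so the argument is
    not circular. Uniqueness is among all solutions, not only those with an expansion; near 0 it
    uses only bounds from concavity, continuity of H' and integrability of x^(2 - n). *)

Section DominatedSeries.
Context {R : realType}.
Implicit Types (c d : nat -> R) (C : R).

(** The ratio 1/2 is fixed once and for all: wherever a series occurs below, the variables are
    scaled until this ratio is reached. Sums and tails then have explicit bounds that depend on C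
    alone. *)
Definition dom c C := forall N : nat, `|c N| <= C / 2 ^+ N.

Definition ssum c : R := limn (series c).

Lemma dom_ge0 c C : dom c C -> 0 <= C.
Proof. by move=> /(_ 0%N); rewrite expr0 divr1; apply: le_trans. Qed.

Lemma domD c d C C' : dom c C -> dom d C' -> dom (fun N => c N + d N) (C + C').
Proof.
by move=> hc hd N; rewrite mulrDl; apply: (le_trans (ler_normD _ _)); apply: lerD.
Qed.

Lemma domZ (k : R) c C : dom c C -> dom (fun N => k * c N) (`|k| * C).
Proof. by move=> hc N; rewrite normrM -mulrA; apply: ler_wpM2l. Qed.

Lemma domS c C : dom c C -> dom (fun N => c N.+1) C.
Proof.
move=> hc N; apply: (le_trans (hc _)); apply: ler_wpM2l; first exact: dom_ge0 hc.
by rewrite lef_pV2 ?posrE ?exprn_gt0// ler_eXn2l ?ltr1n.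
Qed.

(** The bound is a difference so that the induction closes: the new term costs C/2^n = 2C/2^n -
    2C/2^(n+1). *)
Lemma dom_partial c C K n : dom c C -> (K <= n)%N ->
  `|series c n - series c K| <= 2 * C / 2 ^+ K - 2 * C / 2 ^+ n.
Proof.
move=> hc; elim: n => [|n IH]; first by rewrite leqn0 => /eqP ->; rewrite !subrr normr0.
rewrite leq_eqVlt => /orP[/eqP <-|]; first by rewrite !subrr normr0.
rewrite ltnS => /IH {}IH; rewrite seriesSr addrAC.
apply: (le_trans (ler_normD _ _)); apply: (le_trans (lerD IH (hc n))).
rewrite exprS invfM; set w := (2 ^+ n)^-1; set w' := (2 ^+ K)^-1; lra.
Qed.

Lemma ssum_cvg c C : dom c C -> series c @ \oo --> ssum c.
Proof.
move=> hc; apply: normed_cvg.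
apply: (@series_le_cvg _ _ (geometric C 2^-1)) => [n|n|n|] /=.
- exact: normr_ge0.
- by rewrite mulr_ge0 ?exprn_ge0 ?invr_ge0// (dom_ge0 hc).
- by rewrite exprVn; exact: hc.
- by apply: is_cvg_geometric_series; rewrite ger0_norm ?invr_ge0// invf_lt1// ltr1n.
Qed.

Lemma ssum_unique c (l : R) : series c @ \oo --> l -> ssum c = l.
Proof. exact: cvg_lim. Qed.

Lemma ssum_tail c C K : dom c C -> `|ssum c - series c K| <= 2 * C / 2 ^+ K.
Proof.
move=> hc.
have h : (fun n => `|series c n - series c K|) @ \oo --> `|ssum c - series c K|.
  by apply: cvg_norm; apply: cvgB; [exact: ssum_cvg hc|exact: cvg_cst].
apply: (ler_cvg_to h (cvg_cst (2 * C / 2 ^+ K))); exists K => // n /= Kn.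
apply: (le_trans (dom_partial hc Kn)).
by rewrite gerBl divr_ge0 ?exprn_ge0// mulr_ge0 ?(dom_ge0 hc).
Qed.

Lemma ssum_le c C : dom c C -> `|ssum c| <= 2 * C.
Proof.
by move=> /(@ssum_tail _ _ 0); rewrite expr0 divr1 /series /= big_mkord big_ord0 subr0.
Qed.

Lemma ssumD c d C C' : dom c C -> dom d C' ->
  ssum (fun N => c N + d N) = ssum c + ssum d.
Proof.
move=> hc hd; apply: ssum_unique.
have -> : series (fun N => c N + d N) = series c + series d.
  by rewrite -seriesD.
by apply: cvgD; [exact: ssum_cvg hc|exact: ssum_cvg hd].
Qed.

Lemma ssumZ (k : R) c C : dom c C -> ssum (fun N => k * c N) = k * ssum c.
Proof.
move=> hc; apply: ssum_unique.
have -> : series (fun N => k * c N) = (fun n => k * series c n).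
  by apply/funext => n; rewrite /series /= mulr_sumr.
by apply: cvgMr; exact: ssum_cvg hc.
Qed.

Lemma ssum_split c C K : dom c C ->
  ssum c = \sum_(i < K) c i + ssum (fun N => c (K + N)%N).
Proof.
elim: K => [|K IH] hc; first by rewrite big_ord0 add0r.
rewrite IH // big_ord_recr /= -addrA; congr (_ + _).
have hd : dom (fun N => c (K + N)%N) C.
  elim: (K) => [//|k] /domS hk N; move: (hk N).
  by rewrite addnS addSn.
apply: ssum_unique; rewrite -cvg_shiftS.
rewrite [X in X @ _](_ : _ =
    (fun n => c K + series (fun N => c (K.+1 + N)%N) n)); last first.
  apply/funext => n /=; rewrite !seriesEord /= big_ord_recl addn0; congr (_ + _).
  by apply: eq_bigr => i _; rewrite addSnnS.
apply: cvgD; first exact: cvg_cst.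
apply: (@ssum_cvg _ C) => N; move: (domS hd N).
by rewrite addSnnS.
Qed.

Lemma ssum_finite c K : (forall N, (K <= N)%N -> c N = 0) ->
  ssum c = \sum_(i < K) c i.
Proof.
move=> h; apply: ssum_unique; apply: cvg_near_cst; exists K => // n /= Kn.
rewrite seriesEord /= (big_ord_widen n c Kn) [RHS]big_mkcond /=.
by apply: eq_bigr => i _; case: ltnP => // /h.
Qed.

(** Cutting row j at N loses at most (2C/2^N)/2^j, so the square sums differ from the partial sums
    of the row sums by at most 4C/2^N. Applied to the transposed array, the same argument shows that
    both iterated sums are limits of the same squares, whence the interchange of summation. *)
Lemma ssum_square (d : nat -> nat -> R) C :
  (forall j k, `|d j k| <= C / 2 ^+ j / 2 ^+ k) ->
  [/\ dom (fun j => ssum (d j)) (2 * C),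
      \sum_(j < N) \sum_(k < N) d j k @[N --> \oo] --> ssum (fun j => ssum (d j))
    & \sum_(j < N) \sum_(k < N) d j k @[N --> \oo] -->
        ssum (fun k => ssum (fun j => d j k))].
Proof.
move=> hd.
have C0 : 0 <= C by apply: le_trans (normr_ge0 (d 0%N 0%N)) _;
  apply: le_trans (hd _ _) _; rewrite !expr0 !divr1.
have dd j : dom (d j) (C / 2 ^+ j) by move=> k; exact: hd.
have key (e : nat -> nat -> R) : (forall j k, `|e j k| <= C / 2 ^+ j / 2 ^+ k) ->
   dom (fun j => ssum (e j)) (2 * C) /\
   \sum_(j < N) \sum_(k < N) e j k @[N --> \oo] --> ssum (fun j => ssum (e j)).
  move=> he.
  have ee j : dom (e j) (C / 2 ^+ j) by move=> k; exact: he.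
  have de : dom (fun j => ssum (e j)) (2 * C).
    by move=> j /=; apply: (le_trans (ssum_le (ee j))); rewrite mulrA.
  split=> //; apply: cvg_sub0 (ssum_cvg de).
  apply/cvgr0Pnorm_le => /= eps eps0.
  have : geometric (4 * C) 2^-1 @ \oo --> (0 : R).
    by apply: cvg_geometric; rewrite ger0_norm ?invr_ge0// invf_lt1// ltr1n.
  move=> /cvgr0Pnorm_le /(_ _ eps0); apply: filterS => N /=.
  rewrite /geometric /= ger0_norm ?mulr_ge0 ?exprn_ge0 ?invr_ge0//; apply: le_trans.
  rewrite exprVn [X in `|X|](_ : _ = \sum_(j < N) (\sum_(k < N) e j k - ssum (e j))).
  2: transitivity (\sum_(j < N) \sum_(k < N) e j k - series (fun j => ssum (e j)) N) => //.
  2: by rewrite seriesEord sumrB.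
  apply: (le_trans (ler_norm_sum _ _ _)).
  apply: (@le_trans _ _ (\sum_(j < N) (2 * C / 2 ^+ N) / 2 ^+ j)).
    apply: ler_sum => j _; rewrite distrC.
    have := ssum_tail N (ee j); rewrite seriesEord /=.
    by rewrite (mulrA 2 C) (mulrAC (2 * C)).
  rewrite -mulr_sumr (_ : 4 * C / 2 ^+ N = (2 * C / 2 ^+ N) * 2); last by lra.
  apply: ler_wpM2l; first by rewrite !mulr_ge0 ?invr_ge0 ?exprn_ge0.
  suff -> : \sum_(j < N) (2 ^+ j)^-1 = 2 - 2 / 2 ^+ N :> R.
    by rewrite gerBl divr_ge0 ?exprn_ge0.
  elim: (N) => [|m IH]; first by rewrite big_ord0 expr0; lra.
  by rewrite big_ord_recr /= IH exprS invfM; set w := (2 ^+ m)^-1; lra.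
have [h1 h2] := key d hd; split => //.
have [|_ h3] := key (fun k j => d j k); first by move=> k j; rewrite mulrAC.
apply: cvg_trans h3; apply: near_eq_cvg; near=> N.
by rewrite exchange_big.
Unshelve. all: by end_near. Qed.

Lemma ssum_swap (d : nat -> nat -> R) C :
  (forall j k, `|d j k| <= C / 2 ^+ j / 2 ^+ k) ->
  ssum (fun j => ssum (d j)) = ssum (fun k => ssum (fun j => d j k)).
Proof.
move=> /ssum_square [_ h1 h2]; apply: (cvg_unique _ h1 h2); exact: Rhausdorff.
Qed.

(** The array indexed by (N, j), extended by 0 for j > N, is dominated by a product because 4^(-N)
    <= 2^(-N) 2^(-j) for j <= N. This is why the ratio 1/4 is asked for here and in the Cauchy
    product. *)
Lemma ssum_diag (f : nat -> nat -> R) C :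
  (forall j k, `|f j k| <= C / 4 ^+ (j + k)) ->
  ssum (fun N => \sum_(j < N.+1) f j (N - j)%N) = ssum (fun j => ssum (f j)).
Proof.
move=> hf.
have C0 : 0 <= C by apply: le_trans (normr_ge0 (f 0%N 0%N)) _;
  apply: le_trans (hf _ _) _; rewrite !expr0 !divr1.
pose d N j := if (j <= N)%N then f j (N - j)%N else 0.
have e4 m : 4 ^+ m = 2 ^+ m * 2 ^+ m :> R by rewrite -exprMn -natrM.
have hd N j : `|d N j| <= C / 2 ^+ N / 2 ^+ j.
  rewrite /d; case: leqP => jN; last first.
    by rewrite normr0 !mulr_ge0 ?invr_ge0 ?exprn_ge0.
  apply: (le_trans (hf _ _)); rewrite subnKC // e4 invfM mulrA.
  apply: ler_wpM2l; first by rewrite mulr_ge0 ?invr_ge0 ?exprn_ge0.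
  by rewrite lef_pV2 ?posrE ?exprn_gt0// ler_eXn2l ?ltr1n.
transitivity (ssum (fun N => ssum (d N))).
  congr ssum; apply/funext => N; rewrite (@ssum_finite _ N.+1).
    by apply: eq_bigr => j _; rewrite /d -ltnS ltn_ord.
  by move=> j; rewrite /d ltnNge => /negbTE ->.
rewrite (ssum_swap hd); congr ssum; apply/funext => j.
rewrite (@ssum_split (d ^~ j) (C / 2 ^+ j) j); last first.
  by move=> N; rewrite mulrAC; exact: hd.
rewrite big1 ?add0r => [|i _]; last by rewrite /d leqNgt ltn_ord.
by congr ssum; apply/funext => k; rewrite /d leq_addr addKn.
Qed.

Lemma dom_pow4 c C : (forall N, `|c N| <= C / 4 ^+ N) -> dom c C.
Proof.
move=> he N; have C0 : 0 <= C.
  by move: (he 0%N); rewrite expr0 divr1; apply: le_trans.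
apply: (le_trans (he N)); apply: ler_wpM2l => //.
by rewrite lef_pV2 ?posrE ?exprn_gt0// lerXn2r ?nnegrE// ler_nat.
Qed.

Lemma ssum_cauchy c d C C' :
  (forall N, `|c N| <= C / 4 ^+ N) -> (forall N, `|d N| <= C' / 4 ^+ N) ->
  ssum (fun N => \sum_(j < N.+1) c j * d (N - j)%N) = ssum c * ssum d.
Proof.
move=> hc hd.
rewrite (@ssum_diag (fun j k => c j * d k) (C * C')); last first.
  move=> j k; rewrite normrM exprD invfM mulrACA; apply: ler_pM => //.
rewrite -[RHS]mulrC -(ssumZ _ (dom_pow4 hc)); congr ssum; apply/funext => j.
by rewrite (ssumZ _ (dom_pow4 hd)) mulrC.
Qed.

Lemma is_derive_quadratic (f : R -> R) (t l C e : R) : 0 < e ->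
  (forall h, `|h| < e -> `|f (t + h) - f t - h * l| <= C * h ^+ 2) ->
  is_derive t 1 f l.
Proof.
move=> e0 H.
have lim : h^-1 *: (f (h *: 1 + t) - f t) @[h --> 0^'] --> l.
  apply/cvgrPdist_le => /= eps eps0.
  have C1 : 0 < `|C| + 1 by rewrite ltr_pwDr.
  near=> h.
  have h0 : h != 0 by near: h; exact: nbhs_dnbhs_neq.
  have he : `|h| < Num.min e (eps / (`|C| + 1)).
    near: h; apply: dnbhs0_lt; rewrite lt_min e0 divr_gt0//.
  move: he; rewrite lt_min => /andP[he hE].
  have := H h he => Hh; rewrite /= (_ : h *: 1 + t = t + h); last by rewrite [_ *: _]mulr1 addrC.
  have -> : h^-1 *: (f (t + h) - f t) = l + h^-1 * (f (t + h) - f t - h * l).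
    by rewrite [h^-1 *: _]/(h^-1 * _) [in RHS]mulrBr mulKf // addrCA subrr addr0.
  rewrite opprD addrA subrr sub0r normrN normrM normfV.
  rewrite ler_pdivrMl ?normr_gt0// ; apply: (le_trans Hh).
  rewrite -real_normK ?num_real// expr2 mulrCA; apply: ler_wpM2l => //.
  apply: (@le_trans _ _ ((`|C| + 1) * `|h|)).
    by apply: ler_wpM2r => //; rewrite (le_trans (ler_norm C))// lerDl.
  by rewrite mulrC -ler_pdivlMr// ltW.
apply: DeriveDef; first by apply/cvg_ex; exists l.
exact: cvg_lim.
Unshelve. all: by end_near. Qed.

(** A quadratic remainder that is summable in N, uniformly for small h, takes the place of uniform
    convergence of the differentiated series. *)
Lemma is_derive_ssum (c c1 : nat -> R -> R) (t C C1 C2 e : R) : 0 < e ->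
  (forall h, `|h| < e -> dom (fun N => c N (t + h)) C) ->
  dom (fun N => c1 N t) C1 ->
  (forall N h, `|h| < e ->
     `|c N (t + h) - c N t - h * c1 N t| <= C2 * h ^+ 2 / 2 ^+ N) ->
  is_derive t 1 (fun s => ssum (fun N => c N s)) (ssum (fun N => c1 N t)).
Proof.
move=> e0 h0 h1 h2; apply: (@is_derive_quadratic _ _ _ (2 * C2) e) => // h he.
have d0 := h0 _ he; have d00 : dom (fun N => c N t) C.
  by have := h0 0; rewrite normr0 addr0; apply.
have E : ssum (fun N => c N (t + h)) - ssum (fun N => c N t) -
    h * ssum (fun N => c1 N t) =
    ssum (fun N => c N (t + h) + (- 1 * c N t + - h * c1 N t)).
  rewrite (ssumD d0 (domD (domZ (-1) d00) (domZ (- h) h1))).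
  by rewrite (ssumD (domZ (-1) d00) (domZ (- h) h1)) (ssumZ _ d00) (ssumZ _ h1); ring.
rewrite E -mulrA; apply: ssum_le => N.
have := h2 N h he; congr (`|_| <= _); ring.
Qed.

Lemma continuous_ssum (T : topologicalType) (c : nat -> T -> R) (C : R) :
  (forall x, dom (fun N => c N x) C) -> (forall N, continuous (c N)) ->
  continuous (fun x => ssum (fun N => c N x)).
Proof.
move=> hd hc x; apply/cvgrPdist_lt => /= eps eps0.
have e4 : 0 < eps / 4 by rewrite divr_gt0.
have [K _ /(_ K (leqnn K))] : \forall K \near \oo, `|2 * C / 2 ^+ K| <= eps / 4.
  have : geometric (2 * C) 2^-1 @ \oo --> (0 : R).
    by apply: cvg_geometric; rewrite ger0_norm ?invr_ge0// invf_lt1// ltr1n.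
  by move=> /cvgr0Pnorm_le /(_ _ e4); apply: filterS => N /=; rewrite exprVn.
move=> /(le_trans (ler_norm _)) hK.
have : (fun y => series (fun N => c N y) K) y @[y --> x] --> series (fun N => c N x) K.
  rewrite (_ : (fun y => _) = (fun y => \sum_(i < K) c i y)); last first.
    by apply/funext => y; rewrite seriesEord.
  rewrite seriesEord /=; apply: cvg_big => [|i _]; [exact: add_continuous|exact: hc].
move=> /cvgrPdist_lt /(_ _ e4); apply: filterS => y hy.
have h1 := le_trans (ssum_tail K (hd x)) hK.
have h2 := le_trans (ssum_tail K (hd y)) hK.
rewrite (_ : _ - _ = (ssum (fun N => c N x) - series (fun N => c N x) K) +
  (series (fun N => c N x) K - series (fun N => c N y) K)
  - (ssum (fun N => c N y) - series (fun N => c N y) K)); last by ring.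
apply: le_lt_trans (ler_normB _ _) _.
apply: (@le_lt_trans _ _ (`|ssum (fun N => c N x) - series (fun N => c N x) K| +
  `|series (fun N => c N x) K - series (fun N => c N y) K| + eps / 4)).
  by apply: lerD => //; exact: ler_normD.
by lra.
Qed.

Lemma dom_shift c C : dom c C ->
  dom (fun N => if N is N'.+1 then c N' else 0) (2 * C) /\
  ssum (fun N => if N is N'.+1 then c N' else 0) = ssum c.
Proof.
move=> hc; have hs : dom (fun N => if N is N'.+1 then c N' else 0) (2 * C).
  case=> [|N]; first by rewrite normr0 divr_ge0 ?exprn_ge0// mulr_ge0// (dom_ge0 hc).
  by apply: (le_trans (hc N)); rewrite exprS invfM mulrACA divff// mul1r.
by split => //; rewrite (ssum_split 1 hs) big_ord1 add0r.
Qed.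

End DominatedSeries.

(** * Calculus on the line *)

Section Calculus.
Context {R : realType}.
Implicit Types (f g : R -> R) (x a b : R).

Lemma der_cst (c x : R) : is_derive x 1 (fun _ : R => c) 0.
Proof. exact: is_derive_cst. Qed.

Lemma der_id (x : R) : is_derive x 1 (fun y : R => y) 1.
Proof. exact: is_derive_id. Qed.

Lemma der_add f g x a b : is_derive x 1 f a -> is_derive x 1 g b ->
  is_derive x 1 (fun y => f y + g y) (a + b).
Proof. by move=> hf hg; exact: is_deriveD. Qed.

Lemma der_opp f x a : is_derive x 1 f a -> is_derive x 1 (fun y => - f y) (- a).
Proof. by move=> hf; exact: is_deriveN. Qed.

Lemma der_mul f g x a b : is_derive x 1 f a -> is_derive x 1 g b ->
  is_derive x 1 (fun y => f y * g y) (a * g x + f x * b).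
Proof.
move=> hf hg; apply: (is_derive_eq (is_deriveM hf hg)).
by rewrite addrC [g x *: a]mulrC.
Qed.

Lemma der_scale f (c x a : R) : is_derive x 1 f a -> is_derive x 1 (fun y => c * f y) (c * a).
Proof.
by move=> hf; apply: (is_derive_eq (der_mul (der_cst c x) hf)); rewrite mul0r add0r.
Qed.

Lemma der_comp f g x a b : is_derive (g x) 1 f a -> is_derive x 1 g b ->
  is_derive x 1 (fun y => f (g y)) (a * b).
Proof. by move=> hf hg; exact: (is_derive1_comp hf hg). Qed.

Lemma der_expR g x b : is_derive x 1 g b ->
  is_derive x 1 (fun y => expR (g y)) (expR (g x) * b).
Proof. by move=> hg; exact: der_comp (is_derive_expR _) hg. Qed.

Lemma der_powR g (p x b : R) : 0 < g x -> is_derive x 1 g b ->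
  is_derive x 1 (fun y => g y `^ p) (p * g x `^ (p - 1) * b).
Proof. by move=> g0 hg; exact: der_comp (is_derive1_powR _ g0) hg. Qed.

Lemma powR_le_neg (e p q : R) : e <= 0 -> 0 < p -> p <= q -> q `^ e <= p `^ e.
Proof.
move=> e0 p0 pq.
have E (y : R) : y `^ e = (y `^ (- e))^-1 by rewrite powRN invrK.
rewrite !E lef_pV2 ?posrE ?powR_gt0//.
  by apply: ge0_ler_powR; rewrite ?nnegrE ?oppr_ge0 ?(ltW p0)// (le_trans (ltW p0)).
exact: lt_le_trans pq.
Qed.

Lemma derive_unique f x a b : is_derive x 1 f a -> is_derive x 1 f b -> a = b.
Proof. by move=> [_ <-] [_ <-]. Qed.

Lemma derive_cont f x a : is_derive x 1 f a -> {for x, continuous f}.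
Proof. by move=> [h _]; apply: differentiable_continuous; apply/derivable1_diffP. Qed.

Lemma near_itvoo_eq f g a b x : a < x < b -> (forall y, a < y < b -> f y = g y) ->
  \forall y \near x, f y = g y.
Proof.
move=> xab h; have : x \in `]a, b[ by rewrite in_itv.
move=> /near_in_itvoo; apply: filterS => y; rewrite in_itv /=; exact: h.
Qed.

Lemma ge0_derive_le f (f' : R -> R) a b : a <= b ->
  {within `[a, b], continuous f} ->
  (forall x, a < x < b -> is_derive x 1 f (f' x)) ->
  (forall x, a < x < b -> 0 <= f' x) -> f a <= f b.
Proof.
move=> ab fc fd f0; apply: (ger0_derive1_le_cc (a := a) (b := b)) => //.
- by move=> x; rewrite in_itv /= => /fd[].
- by move=> x; rewrite in_itv /= => xab; rewrite derive1E; have [_ ->] := fd _ xab; exact: f0.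
- by rewrite in_itv /= lexx.
- by rewrite in_itv /= lexx ab.
Qed.

Lemma le0_derive_ge f (f' : R -> R) a b : a <= b ->
  {within `[a, b], continuous f} ->
  (forall x, a < x < b -> is_derive x 1 f (f' x)) ->
  (forall x, a < x < b -> f' x <= 0) -> f b <= f a.
Proof.
move=> ab fc fd f0; rewrite -lerN2.
apply: (@ge0_derive_le (fun x => - f x) (fun x => - f' x)) => //.
- by move=> x; apply: cvgN; exact: fc.
- by move=> x /fd; exact: der_opp.
- by move=> x /f0; rewrite oppr_ge0.
Qed.

Lemma within_cont f (f' : R -> R) a b :
  (forall x, a <= x <= b -> is_derive x 1 f (f' x)) -> {within `[a, b], continuous f}.
Proof.
by move=> h; apply: derivable_within_continuous => x; rewrite in_itv /= => /h[].
Qed.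

Lemma ge0_derive_le_cc f (f' : R -> R) a b : a <= b ->
  (forall x, a <= x <= b -> is_derive x 1 f (f' x)) ->
  (forall x, a <= x <= b -> 0 <= f' x) -> f a <= f b.
Proof.
move=> ab fd f0; apply: (@ge0_derive_le f f') => //; first exact: within_cont fd.
- by move=> x /andP[/ltW ? /ltW ?]; apply: fd; apply/andP.
- by move=> x /andP[/ltW ? /ltW ?]; apply: f0; apply/andP.
Qed.

Lemma le0_derive_ge_cc f (f' : R -> R) a b : a <= b ->
  (forall x, a <= x <= b -> is_derive x 1 f (f' x)) ->
  (forall x, a <= x <= b -> f' x <= 0) -> f b <= f a.
Proof.
move=> ab fd f0; apply: (@le0_derive_ge f f') => //; first exact: within_cont fd.
- by move=> x /andP[/ltW ? /ltW ?]; apply: fd; apply/andP.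
- by move=> x /andP[/ltW ? /ltW ?]; apply: f0; apply/andP.
Qed.

(** The mean value theorem on either side of x. Derivatives are asked for in the open interval only,
    since f will be H', whose derivative may blow up at 0. *)
Lemma concave_chord f (f1 f2 : R -> R) a b x : a < b -> a <= x <= b ->
  {within `[a, b], continuous f} ->
  (forall x, a < x < b -> is_derive x 1 f (f1 x)) ->
  (forall x, a < x < b -> is_derive x 1 f1 (f2 x)) ->
  (forall x, a < x < b -> f2 x <= 0) ->
  (b - x) * f a + (x - a) * f b <= (b - a) * f x.
Proof.
move=> ab /andP[ax xb] fc fd fd1 f20.
move: ax; rewrite le_eqVlt => /predU1P[<-|ax]; first by rewrite subrr mul0r addr0.
move: xb; rewrite le_eqVlt => /predU1P[->|xb]; first by rewrite subrr mul0r add0r.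
have cs u v : a <= u -> v <= b -> {within `[u, v], continuous f}.
  move=> au vb; apply: continuous_subspaceW fc => y /=.
  by rewrite !in_itv /= => /andP[uy yv]; rewrite (le_trans au uy) (le_trans yv vb).
have [c] : exists2 c, c \in `]a, x[ & f x - f a = f1 c * (x - a).
  apply: (MVT ax) => [y|/=].
  - rewrite in_itv /= => /andP[ay yx]; apply: fd; rewrite ay /=; exact: lt_trans xb.
  - by apply: cs => //; exact: ltW.
rewrite in_itv /= => /andP[ac cx] Ec.
have [d] : exists2 d, d \in `]x, b[ & f b - f x = f1 d * (b - x).
  apply: (MVT xb) => [y|/=].
  - rewrite in_itv /= => /andP[xy yb]; apply: fd; rewrite yb andbT; exact: lt_trans xy.
  - by apply: cs => //; exact: ltW.
rewrite in_itv /= => /andP[xd db] Ed.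
have : f1 d <= f1 c.
  apply: (@le0_derive_ge_cc f1 f2); first exact: ltW (lt_trans cx xd).
  - move=> y /andP[cy yd]; apply: fd1.
    by rewrite (lt_le_trans ac cy) (le_lt_trans yd db).
  - move=> y /andP[cy yd]; apply: f20.
    by rewrite (lt_le_trans ac cy) (le_lt_trans yd db).
move=> dc.
have h : (x - a) * (b - x) * f1 d <= (x - a) * (b - x) * f1 c.
  by apply: ler_wpM2l => //; apply: mulr_ge0; rewrite subr_ge0 ltW.
have e1 : f x = f a + f1 c * (x - a) by rewrite -Ec addrC subrK.
have e2 : f b = f x + f1 d * (b - x) by rewrite -Ed addrC subrK.
rewrite e2 e1 -subr_ge0; move: h; rewrite -subr_ge0 => h.
by move: h; congr (_ <= _); ring.
Qed.

Definition clamp (lo hi x : R) := Num.min (Num.max x lo) hi.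

Lemma clamp_id lo hi x : lo <= x <= hi -> clamp lo hi x = x.
Proof. by move=> /andP[h1 h2]; rewrite /clamp max_l// min_l. Qed.

Lemma clamp_itv lo hi x : lo <= hi -> lo <= clamp lo hi x <= hi.
Proof.
by move=> h; rewrite /clamp le_min ge_min le_max lexx h orbT /= lexx orbT.
Qed.

Lemma clamp_clamp lo hi x : lo <= hi -> clamp lo hi (clamp lo hi x) = clamp lo hi x.
Proof. by move=> h; rewrite clamp_id// clamp_itv. Qed.

Lemma continuous_maxr (a : R) : continuous (fun x : R => Num.max x a).
Proof.
move=> x.
have E y : Num.max y a = 2^-1 * (y + a + `|y - a|) by rewrite maxr_absE mulrC.
rewrite (_ : (fun y => _) = (fun y => 2^-1 * (y + a + `|y - a|))); last by apply/funext.
apply: cvgMr; apply: cvgD; first by apply: cvgD; [exact: cvg_id|exact: cvg_cst].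
by apply: cvg_norm; apply: cvgB; [exact: cvg_id|exact: cvg_cst].
Qed.

Lemma continuous_minr (a : R) : continuous (fun x : R => Num.min x a).
Proof.
move=> x.
have E y : Num.min y a = 2^-1 * (y + a - `|y - a|) by rewrite minr_absE mulrC.
rewrite (_ : (fun y => _) = (fun y => 2^-1 * (y + a - `|y - a|))); last by apply/funext.
apply: cvgMr; apply: cvgB; first by apply: cvgD; [exact: cvg_id|exact: cvg_cst].
by apply: cvg_norm; apply: cvgB; [exact: cvg_id|exact: cvg_cst].
Qed.

Lemma continuous_clamp lo hi : continuous (clamp lo hi).
Proof.
move=> x; apply: (@continuous_comp _ _ _ (fun x => Num.max x lo) (fun y => Num.min y hi)).
  exact: continuous_maxr.
exact: continuous_minr.
Qed.

(** The integral starts at lo - 1, so that the fundamental theorem is also available at lo. Making F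
    constant outside [lo, hi] turns bounds on this interval into bounds on the whole line, as
    [continuous_ssum] needs. *)
Lemma antiderivative lo hi s f : lo < s < hi -> continuous f ->
  exists F, [/\ continuous F, F s = 0, (forall x, lo < x < hi -> is_derive x 1 F (f x))
    & forall x, F (clamp lo hi x) = F x].
Proof.
move=> /andP[los shi] fc; have lohi := lt_trans los shi.
pose G x := \int[lebesgue_measure]_(t in `[lo - 1, x]) f t.
have Gd x : lo - 1 < x -> is_derive x 1 G (f x).
  move=> lox; have [] := @continuous_FTC1_closed R f (lo - 1) x (x + 1).
  - by rewrite ltrDl.
  - apply: continuous_compact_integrable; first exact: segment_compact.
    exact: continuous_subspaceT.
  - exact: lox.
  - exact: fc.
  by move=> dd e; apply: DeriveDef; [exact: dd|rewrite -derive1E e].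
have cl := clamp_itv _ (ltW lohi).
exists (fun x => G (clamp lo hi x) - G s); split.
- move=> x; apply: cvgB; last exact: cvg_cst.
  apply: (@continuous_comp _ _ _ (clamp lo hi) G); first exact: continuous_clamp.
  apply: (derive_cont (Gd _ _)); have /andP[h _] := cl x.
  by apply: lt_le_trans h; rewrite ltrBlDr ltrDl.
- by rewrite clamp_id ?subrr// (ltW los) (ltW shi).
- move=> x xlh; apply: (@near_eq_is_derive _ _ _ (fun x => G x - G s)).
    apply: near_itvoo_eq xlh _ => y /andP[y1 y2].
    by rewrite clamp_id// (ltW y1) (ltW y2).
  have lx : lo - 1 < x by case/andP: xlh => h _; apply: lt_trans h; rewrite ltrBlDr ltrDl.
  by apply: (is_derive_eq (der_add (Gd _ lx) (der_cst _ _))); rewrite addr0.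
- by move=> x; rewrite clamp_clamp// ltW.
Qed.

(** Comparison with M/lam e^(lam |x - s|), whose slope away from s is the bound on d. In the norm
    weighted by this exponential, each integration gains a factor 1/lam. *)
Lemma weighted_antiderivative lo hi s (M lam : R) (D d : R -> R) x : 0 <= M -> 0 < lam ->
  lo < s < hi -> continuous D -> D s = 0 ->
  (forall x, lo < x < hi -> is_derive x 1 D (d x)) ->
  (forall x, lo < x < hi -> `|d x| <= M * expR (lam * `|x - s|)) ->
  lo <= x <= hi -> `|D x| <= M / lam * expR (lam * `|x - s|).
Proof.
move=> M0 l0 /andP[los shi] Dc Ds Dd db /andP[lox xhi].
have l1 : lam != 0 by rewrite gt_eqF.
have cE (c u v : R) : {within `[u, v], continuous (fun y => c * expR (lam * (y - s)))}.
  apply: (@within_cont _ (fun y => c * (expR (lam * (y - s)) * (lam * (1 + - 0))))) => y _.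
have cE' (c u v : R) : {within `[u, v], continuous (fun y => c * expR (lam * (s - y)))}.
  apply: (@within_cont _ (fun y => c * (expR (lam * (s - y)) * (lam * (0 + - 1))))) => y _.
have cD u v : {within `[u, v], continuous D} by exact: continuous_subspaceT.
have Ml : 0 <= M / lam by rewrite divr_ge0// ltW.
have key (sg : R) : `|sg| = 1 -> sg * D x <= M / lam * expR (lam * `|x - s|).
  move=> sg1.
  have sd y : lo < y < hi -> sg * d y <= M * expR (lam * `|y - s|).
    move=> hy; apply: le_trans (ler_norm _) _; rewrite normrM sg1 mul1r; exact: db.
  have sDd y : lo < y < hi -> is_derive y 1 (fun y => sg * D y) (sg * d y).
    by move=> /Dd; exact: der_scale.
  case: (lerP s x) => sx.
    have : M / lam * expR (lam * (s - s)) - sg * D s <= M / lam * expR (lam * (x - s)) - sg * D x.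
      apply: (@ge0_derive_le (fun y => M / lam * expR (lam * (y - s)) - sg * D y)
        (fun y => M / lam * (expR (lam * (y - s)) * (lam * (1 + - 0))) + - (sg * d y)) _ _ sx).
      - move=> y; apply: cvgB; first exact: cE.
        by apply: cvgMr; exact: cD.
      - move=> y /andP[y1 y2]; apply: der_add; last first.
          by apply: der_opp; apply: sDd; rewrite (lt_trans los y1) (lt_le_trans y2 xhi).
      - move=> y /andP[y1 y2].
        have := sd y; rewrite (lt_trans los y1) (lt_le_trans y2 xhi) => /(_ isT).
        rewrite ger0_norm ?subr_ge0 ?(ltW y1)// => h.
        by rewrite [leRHS](_ : _ = M * expR (lam * (y - s))); last by field.
    rewrite subrr mulr0 expR0 mulr1 Ds mulr0 subr0; lra.
  have : M / lam * expR (lam * (s - s)) - sg * D s <= M / lam * expR (lam * (s - x)) - sg * D x.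
    apply: (@le0_derive_ge (fun y => M / lam * expR (lam * (s - y)) - sg * D y)
      (fun y => M / lam * (expR (lam * (s - y)) * (lam * (0 + - 1))) + - (sg * d y)) _ _ (ltW sx)).
    - move=> y; apply: cvgB; first exact: cE'.
      by apply: cvgMr; exact: cD.
    - move=> y /andP[y1 y2]; apply: der_add; last first.
        by apply: der_opp; apply: sDd; rewrite (le_lt_trans lox y1) (lt_trans y2 shi).
    - move=> y /andP[y1 y2].
      have hy : lo < y < hi by rewrite (le_lt_trans lox y1) (lt_trans y2 shi).
      have : - (sg * d y) <= M * expR (lam * `|y - s|).
        apply: le_trans (ler_norm _) _; rewrite normrN normrM sg1 mul1r; exact: db.
      rewrite ler0_norm ?subr_le0 ?(ltW y2)// opprB => h.
      by rewrite [leLHS](_ : _ = - (M * expR (lam * (s - y)))) 1?lerNl//; last by field.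
  rewrite subrr mulr0 expR0 mulr1 Ds mulr0 subr0; lra.
rewrite ler_norml -[D x]mul1r -lerNl -mulNr; apply/andP; split; apply: key.
  by rewrite normrN1.
by rewrite normr1.
Qed.

End Calculus.

Ltac der_auto :=
  cbv beta;
  first
  [ exact: der_cst | exact: der_id | eassumption
  | match goal with
    | |- is_derive _ _ (fun y => @GRing.add _ (@?f y) (@?g y)) _ => eapply (@der_add _ f g); der_auto
    | |- is_derive _ _ (fun y => @GRing.opp _ (@?f y)) _ => eapply (@der_opp _ f); der_auto
    | |- is_derive _ _ (fun y => @GRing.mul _ ?c (@?g y)) _ => eapply (@der_scale _ g c); der_auto
    | |- is_derive _ _ (fun y => @GRing.mul _ (@?f y) (@?g y)) _ => eapply (@der_mul _ f g); der_auto
    | |- is_derive _ _ (fun y => @expR _ (@?g y)) _ => eapply (@der_expR _ g); der_auto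
    | |- _ => idtac
    end ].

Ltac derive_auto := eapply is_derive_eq; [der_auto | cbv beta].

(** * Picard iteration and Gronwall estimate *)

Section Picard.
Context {R : realType}.
Implicit Types (x : R).

Lemma le_half_powers_eq0 (a C : R) : (forall K : nat, `|a| <= C / 2 ^+ K) -> a = 0.
Proof.
move=> h; apply/eqP; rewrite -normr_le0.
have lim : geometric C 2^-1 @ \oo --> (0 : R).
  by apply: cvg_geometric; rewrite ger0_norm ?invr_ge0// invf_lt1// ltr1n.
by apply: (ler_cvg_to (cvg_cst `|a|) lim); near=> K; rewrite /geometric /= exprVn.
Unshelve. all: by end_near. Qed.

(** One Picard step integrates three times. In the weighted norm its Lipschitz constant is L/lam^3,
    and lam = 1 + 2L makes this at most 1/2, so the interval need not be short. *)
Lemma picard (F : R -> R -> R) (lo hi s L y0 y1 y2 : R) : lo < s < hi -> 0 <= L ->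
  (forall x h k, `|F x h - F x k| <= L * `|h - k|) ->
  (forall y, continuous y -> continuous (fun x => F x (y x))) ->
  exists z0 z1 z2 : R -> R, [/\ z0 s = y0, z1 s = y1, z2 s = y2 &
    forall x, lo < x < hi -> [/\ is_derive x 1 z0 (z1 x), is_derive x 1 z1 (z2 x)
      & is_derive x 1 z2 (F x (z0 x))]].
Proof.
move=> los L0 FL Fc; have /andP[ls sh] := los.
have lohi : lo <= hi := ltW (lt_trans ls sh).
have [P HP] : {P : (R -> R) -> (R -> R) & forall f, continuous f ->
   [/\ continuous (P f), P f s = 0, (forall x, lo < x < hi -> is_derive x 1 (P f) (f x))
    & forall x, P f (clamp lo hi x) = P f x]}.
  apply: (choice (P := fun (f : R -> R) (G : R -> R) => continuous f ->
   [/\ continuous G, G s = 0, (forall x, lo < x < hi -> is_derive x 1 G (f x))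
    & forall x, G (clamp lo hi x) = G x])) => f.
  have [fc|nfc] := pselect (continuous f); last by exists f.
  by have [G HG] := antiderivative los fc; exists G.
pose lam := 1 + 2 * L.
have lam1 : 1 <= lam by rewrite /lam lerDl mulr_ge0.
have lam0 : 0 < lam := lt_le_trans ltr01 lam1.
pose w x := expR (lam * `|x - s|).
have w1 x : 1 <= w x by rewrite /w -expR0 ler_expR mulr_ge0// ltW.
have PB f g M : continuous f -> continuous g -> 0 <= M ->
    (forall x, lo <= x <= hi -> `|f x - g x| <= M * w x) ->
    forall x, lo <= x <= hi -> `|P f x - P g x| <= M / lam * w x.
  move=> fc gc M0 fg x xlh.
  have [c1 s1 d1 _] := HP f fc; have [c2 s2 d2 _] := HP g gc.
  apply: (@weighted_antiderivative _ lo hi s M lam (fun x => P f x - P g x)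
    (fun x => f x - g x)) => //.
  - by move=> y; apply: cvgB; [exact: c1|exact: c2].
  - by rewrite s1 s2 subrr.
  - by move=> y hy; apply: der_add; [exact: d1|apply: der_opp; exact: d2].
  - by move=> y /andP[/ltW h1 /ltW h2]; apply: fg; rewrite h1 h2.
pose Z2 y x := y2 + P (fun x => F x (y x)) x.
pose Z1 y x := y1 + P (Z2 y) x.
pose Z0 y x := y0 + P (Z1 y) x.
have addc (c : R) (f : R -> R) : continuous f -> continuous (fun x => c + f x).
  by move=> fc x; apply: cvgD; [exact: cvg_cst|exact: fc].
have c2 y : continuous y -> continuous (Z2 y).
  by move=> /Fc /HP[h _ _ _]; exact: addc.
have c1 y : continuous y -> continuous (Z1 y).
  by move=> /c2 /HP[h _ _ _]; exact: addc.
have c0 y : continuous y -> continuous (Z0 y).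
  by move=> /c1 /HP[h _ _ _]; exact: addc.
have contr y y' M : continuous y -> continuous y' -> 0 <= M ->
    (forall x, lo <= x <= hi -> `|y x - y' x| <= M * w x) ->
    forall x, lo <= x <= hi -> `|Z0 y x - Z0 y' x| <= M / 2 * w x.
  move=> yc yc' M0 hM x xlh.
  have b2 : forall x, lo <= x <= hi -> `|Z2 y x - Z2 y' x| <= (L * M) / lam * w x.
    move=> u hu; rewrite /Z2 opprD addrACA subrr add0r.
    apply: PB => //; [exact: Fc|exact: Fc|exact: mulr_ge0|move=> v hv].
    by apply: (le_trans (FL _ _ _)); rewrite -mulrA; apply: ler_wpM2l => //; exact: hM.
  have b1 : forall x, lo <= x <= hi -> `|Z1 y x - Z1 y' x| <= (L * M) / lam / lam * w x.
    move=> u hu; rewrite /Z1 opprD addrACA subrr add0r.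
    apply: PB => //; [exact: c2|exact: c2|by rewrite divr_ge0 ?mulr_ge0// ltW].
  have b0 : `|Z0 y x - Z0 y' x| <= (L * M) / lam / lam / lam * w x.
    rewrite /Z0 opprD addrACA subrr add0r.
    apply: PB => //; [exact: c1|exact: c1|by rewrite !divr_ge0 ?mulr_ge0// ltW].
  apply: (le_trans b0); apply: ler_wpM2r; first exact: expR_ge0.
  have il : lam^-1 <= 1 by rewrite invf_le1.
  have il0 : 0 <= lam^-1 by rewrite invr_ge0 ltW.
  have Ll : L / lam <= 1 / 2 by rewrite ler_pdivrMr// /lam; lra.
  have -> : L * M / lam / lam / lam = (L / lam) * M * (lam^-1 * lam^-1) by ring.
  have h1 : (L / lam) * M <= 1 / 2 * M by apply: ler_wpM2r.
  have h2 : lam^-1 * lam^-1 <= 1 by rewrite mulr_ile1.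
  apply: (@le_trans _ _ (L / lam * M * 1)).
    by apply: ler_wpM2l => //; rewrite mulr_ge0// divr_ge0// ltW.
  by rewrite mulr1 (le_trans h1)// mul1r mulrC.
pose Y k := iter k Z0 (fun _ : R => y0).
have Yc k : continuous (Y k).
  elim: k => [|k IH]; first by move=> x; exact: cvg_cst.
  exact: c0.
have Ycl k x : Y k (clamp lo hi x) = Y k x.
  case: k => [//|k]; rewrite /Y iterS -/(Y k) /Z0; congr (_ + _).
  by have [_ _ _] := HP _ (c1 _ (Yc k)).
have [M M0 hM] : exists2 M, 0 <= M & forall x, lo <= x <= hi -> `|Y 1%N x - Y 0%N x| <= M * w x.
  have [|c clh hc] := @EVT_max R (fun x => `|Y 1%N x - Y 0%N x|) lo hi lohi.
    apply: continuous_subspaceT => x; apply: cvg_norm; apply: cvgB; exact: Yc.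
  exists `|Y 1%N c - Y 0%N c| => // x xlh.
  apply: (le_trans (hc x _)); first by rewrite in_itv.
  by rewrite ler_peMr.
have dk k x : lo <= x <= hi -> `|Y k.+1 x - Y k x| <= M / 2 ^+ k * w x.
  elim: k x => [|k IH] x xlh; first by rewrite expr0 divr1; exact: hM.
  rewrite exprSr invfM mulrA.
  apply: (contr (Y k.+1) (Y k)) => //.
  by rewrite divr_ge0// exprn_ge0.
pose B := expR (lam * (hi - lo)).
have wB x : lo <= x <= hi -> w x <= B.
  move=> /andP[h1 h2]; rewrite /w /B ler_expR; apply: ler_wpM2l; first exact: ltW.
  by rewrite ler_norml; lra.
have B0 : 0 <= B := expR_ge0 _.
have dd x : dom (fun k => Y k.+1 x - Y k x) (M * B).
  move=> k; rewrite -(Ycl k.+1) -(Ycl k).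
  have h := clamp_itv x lohi; apply: (le_trans (dk _ _ h)).
  rewrite mulrAC; apply: ler_wpM2r; first by rewrite invr_ge0 exprn_ge0.
  by apply: ler_wpM2l => //; exact: wB.
(* The limit of the iterates as a telescoping series, so that convergence and continuity come from
   the domination [dd]. *)
pose y x := y0 + ssum (fun k => Y k.+1 x - Y k x).
have yc : continuous y.
  apply: addc; apply: (continuous_ssum dd) => k x; apply: cvgB; exact: Yc.
have yY K x : `|y x - Y K x| <= 2 * (M * B) / 2 ^+ K.
  have := ssum_tail K (dd x); congr (`|_| <= _).
  rewrite seriesEord /= /y.
  have -> : \sum_(k < K) (Y k.+1 x - Y k x) = Y K x - Y 0%N x.
    elim: K => [|K IH]; first by rewrite big_ord0 subrr.
    by rewrite big_ord_recr /= IH addrC subrKA.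
  by rewrite (_ : Y 0%N x = y0) //; ring.
have Zy x : lo <= x <= hi -> Z0 y x = y x.
  move=> xlh; apply/eqP; rewrite -subr_eq0; apply/eqP.
  apply: (@le_half_powers_eq0 _ (2 * (M * B) * (B + 1))) => K.
  have h1 : `|Z0 y x - Y K.+1 x| <= 2 * (M * B) / 2 ^+ K / 2 * w x.
    apply: (contr y (Y K)) => //; first by rewrite divr_ge0 ?exprn_ge0// !mulr_ge0.
    by move=> u hu; apply: (le_trans (yY K u)); rewrite ler_peMr// divr_ge0 ?exprn_ge0// !mulr_ge0.
  have h2 := yY K.+1 x.
  have -> : Z0 y x - y x = (Z0 y x - Y K.+1 x) - (y x - Y K.+1 x) by ring.
  apply: (le_trans (ler_normB _ _)); apply: (le_trans (lerD h1 h2)).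
  rewrite exprS invfM.
  set q := (2 ^+ K)^-1; have q0 : 0 <= q by rewrite invr_ge0 exprn_ge0.
  have : 2 * (M * B) * q * w x <= 2 * (M * B) * q * B.
    by apply: ler_wpM2l; [rewrite !mulr_ge0|exact: wB].
  have : 0 <= 2 * (M * B) * q by rewrite !mulr_ge0.
  have : 0 <= 2 * (M * B) * q * B by rewrite !mulr_ge0.
  set t := 2 * (M * B) * q.
  have -> : 2 * (M * B) * (B + 1) * q = t * B + t by rewrite /t; ring.
  have -> : 2 * (M * B) * (2^-1 * q) = t / 2 by rewrite /t; ring.
  have -> : t / 2 * w x = t * w x / 2 by ring.
  lra.
exists (Z0 y), (Z1 y), (Z2 y); split.
- by rewrite /Z0; have [_ -> _ _] := HP _ (c1 _ yc); rewrite addr0.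
- by rewrite /Z1; have [_ -> _ _] := HP _ (c2 _ yc); rewrite addr0.
- by rewrite /Z2; have [_ -> _ _] := HP _ (Fc _ yc); rewrite addr0.
move=> x xlh.
have [_ _ d0 _] := HP _ (c1 _ yc); have [_ _ d1 _] := HP _ (c2 _ yc).
have [_ _ d2 _] := HP _ (Fc _ yc).
split.
- by have := der_add (der_cst y0 x) (d0 _ xlh); rewrite add0r.
- by have := der_add (der_cst y1 x) (d1 _ xlh); rewrite add0r.
- have := der_add (der_cst y2 x) (d2 _ xlh); rewrite add0r Zy//.
  by case/andP: xlh => /ltW -> /ltW ->.
Qed.

(** The inequalities 2uv <= u^2 + v^2 give |E'| <= (2 + L^2) E. Both directions of time are kept:
    gluing compares two solutions on either side of the point where they agree. *)
Lemma gronwall (D D1 D2 D3 : R -> R) (L a b : R) : a <= b -> 0 <= L ->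
  (forall x, a <= x <= b -> [/\ is_derive x 1 D (D1 x), is_derive x 1 D1 (D2 x),
     is_derive x 1 D2 (D3 x) & `|D3 x| <= L * `|D x|]) ->
  let E x := D x ^+ 2 + D1 x ^+ 2 + D2 x ^+ 2 in
  E b <= E a * expR ((2 + L ^+ 2) * (b - a)) /\
  E a <= E b * expR ((2 + L ^+ 2) * (b - a)).
Proof.
move=> ab L0 h E.
pose C := 2 + L ^+ 2.
pose E' x := 2 * (D x * D1 x + D1 x * D2 x + D2 x * D3 x).
have Ed x : a <= x <= b -> is_derive x 1 E (E' x).
  move=> /h[d0 d1 d2 _]; rewrite /E /E'.
  have -> : (fun x => D x ^+ 2 + D1 x ^+ 2 + D2 x ^+ 2) =
            (fun x => D x * D x + D1 x * D1 x + D2 x * D2 x) by [].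
  apply: (is_derive_eq (der_add (der_add (der_mul d0 d0) (der_mul d1 d1)) (der_mul d2 d2))); ring.
have EE x : a <= x <= b -> `|E' x| <= C * E x.
  move=> /h[_ _ _ d3].
  have d3' : D3 x ^+ 2 <= L ^+ 2 * D x ^+ 2.
    rewrite -exprMn -(real_normK (num_real (D3 x))) -(real_normK (num_real (L * D x))).
    by rewrite lerXn2r ?nnegrE// normrM (ger0_norm L0).
  rewrite /E' /E /C.
  have s0 := sqr_ge0 (D x); have s1 := sqr_ge0 (D1 x); have s2 := sqr_ge0 (D2 x).
  have l1 : 0 <= L ^+ 2 * D1 x ^+ 2 by rewrite mulr_ge0// sqr_ge0.
  have l2 : 0 <= L ^+ 2 * D2 x ^+ 2 by rewrite mulr_ge0// sqr_ge0.
  have p1 := sqr_ge0 (D x + D1 x); have m1 := sqr_ge0 (D x - D1 x).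
  have p2 := sqr_ge0 (D1 x + D2 x); have m2 := sqr_ge0 (D1 x - D2 x).
  have p3 := sqr_ge0 (D2 x + D3 x); have m3 := sqr_ge0 (D2 x - D3 x).
  rewrite ler_norml; move: p1 m1 p2 m2 p3 m3 d3' s0 s1 s2 l1 l2.
  rewrite !sqrrD !sqrrN !mulrN.
  set u := D x; set v := D1 x; set w := D2 x; set z := D3 x => *.
  apply/andP; split; lra.
split.
- have : E b * expR (- C * b) <= E a * expR (- C * a).
    apply: (@le0_derive_ge_cc _ (fun x => E x * expR (- C * x))
      (fun x => E' x * expR (- C * x) + E x * (expR (- C * x) * (- C * 1)))) => //.
    + by move=> x hx; apply: der_mul (Ed _ hx) (der_expR (der_scale _ (der_id _))).
    + move=> x /EE; rewrite ler_norml => /andP[_ hE].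
      rewrite (_ : _ + _ = expR (- C * x) * (E' x - C * E x)); last by ring.
      by rewrite pmulr_rle0 ?expR_gt0// subr_le0.
  rewrite -ler_pdivlMr ?expR_gt0// -mulrA -expRN -expRD; congr (_ <= _ * expR _).
  by rewrite -/C; ring.
- have : E a * expR (C * a) <= E b * expR (C * b).
    apply: (@ge0_derive_le_cc _ (fun x => E x * expR (C * x))
      (fun x => E' x * expR (C * x) + E x * (expR (C * x) * (C * 1)))) => //.
    + by move=> x hx; apply: der_mul (Ed _ hx) (der_expR (der_scale _ (der_id _))).
    + move=> x /EE; rewrite ler_norml => /andP[hE _].
      rewrite (_ : _ + _ = expR (C * x) * (E' x + C * E x)); last by ring.
      by rewrite pmulr_rge0 ?expR_gt0// -lerBlDr sub0r.
  rewrite -ler_pdivlMr ?expR_gt0// -mulrA -expRN -expRD; congr (_ <= _ * expR _).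
  by rewrite -/C; ring.
Qed.

End Picard.

(** * The formal solution and its convergence *)

Section PolyNorm.
Context {R : realType}.
Implicit Types (p q : {poly R}).

Definition pnorm p : R := \sum_(i < size p) `|p`_i|.

Lemma pnorm_widen p m : (size p <= m)%N -> pnorm p = \sum_(i < m) `|p`_i|.
Proof.
move=> h; rewrite /pnorm (big_ord_widen m (fun i => `|p`_i|) h) big_mkcond /=.
by apply: eq_bigr => i _; case: ltnP => // hi; rewrite nth_default ?normr0.
Qed.

Lemma pnorm_ge0 p : 0 <= pnorm p.
Proof. by apply: sumr_ge0. Qed.

Lemma pnorm0 : pnorm 0 = 0.
Proof. by rewrite /pnorm size_poly0 big_ord0. Qed.

Lemma pnorm1 : pnorm 1 = 1.
Proof. by rewrite /pnorm size_poly1 big_ord1 coef1 normr1. Qed.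

Lemma pnorm_le (C : R) p q : 0 <= C ->
  (forall i, `|p`_i| <= C * `|q`_i|) -> pnorm p <= C * pnorm q.
Proof.
move=> C0 h; pose m := maxn (size p) (size q).
rewrite (@pnorm_widen p m) ?leq_maxl// (@pnorm_widen q m) ?leq_maxr// mulr_sumr.
by apply: ler_sum => i _; exact: h.
Qed.

Lemma pnormD p q : pnorm (p + q) <= pnorm p + pnorm q.
Proof.
pose m := maxn (size p) (size q).
rewrite (@pnorm_widen (p + q) m) ?size_polyD// (@pnorm_widen p m) ?leq_maxl//.
rewrite (@pnorm_widen q m) ?leq_maxr// -big_split /=.
by apply: ler_sum => i _; rewrite coefD ler_normD.
Qed.

Lemma pnormZ (c : R) p : pnorm (c *: p) <= `|c| * pnorm p.
Proof. by apply: pnorm_le => // i; rewrite coefZ normrM. Qed.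

Lemma pnormN p : pnorm (- p) <= pnorm p.
Proof. by rewrite -[leRHS]mul1r; apply: pnorm_le => // i; rewrite coefN normrN mul1r. Qed.

Lemma pnormB p q : pnorm (p - q) <= pnorm p + pnorm q.
Proof. by apply: (le_trans (pnormD _ _)); rewrite lerD2l pnormN. Qed.

Lemma pnorm_cons p (c : R) : pnorm (p * 'X + c%:P) = pnorm p + `|c|.
Proof.
rewrite (@pnorm_widen _ (size p).+1); last first.
  apply: (leq_trans (size_polyD _ _)); rewrite geq_max; apply/andP; split.
    by apply: (leq_trans (size_polyMleq _ _)); rewrite size_polyX addnC.
  by rewrite (leq_trans (size_polyC_leq1 _)).
rewrite big_ord_recl /= coefD coefMX coefC eqxx /= add0r addrC; congr (_ + _).
by apply: eq_bigr => i _; rewrite coefD coefMX coefC /= addr0.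
Qed.

Lemma pnormMX p : pnorm (p * 'X) = pnorm p.
Proof. by have := pnorm_cons p 0; rewrite addr0 normr0 addr0. Qed.

Lemma pnormXM p : pnorm ('X * p) = pnorm p.
Proof. by rewrite mulrC pnormMX. Qed.

Lemma pnormM p q : pnorm (p * q) <= pnorm p * pnorm q.
Proof.
elim/poly_ind: p => [|p c IH]; first by rewrite mul0r pnorm0 mul0r.
rewrite pnorm_cons mulrDl mulrDl.
apply: (le_trans (pnormD _ _)); apply: lerD.
  by rewrite -mulrA [_ * q]mulrC mulrA pnormMX.
by rewrite mul_polyC; exact: pnormZ.
Qed.

Lemma pnorm_sum m (F : nat -> {poly R}) :
  pnorm (\sum_(i < m) F i) <= \sum_(i < m) pnorm (F i).
Proof.
elim: m => [|m IH]; first by rewrite !big_ord0 pnorm0.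
by rewrite !big_ord_recr /=; apply: (le_trans (pnormD _ _)); rewrite lerD2r.
Qed.

Lemma coef_le_pnorm p i : `|p`_i| <= pnorm p.
Proof.
case: (ltnP i (size p)) => h; last by rewrite nth_default// normr0 pnorm_ge0.
by rewrite /pnorm (bigD1 (Ordinal h)) //= lerDl sumr_ge0.
Qed.

(** The recursion step is given a whole function of which it may consult only earlier values; the
    list of values found so far plays that function, with a default beyond its length. *)
Lemma course_of_values (T : Type) (step : nat -> (nat -> T) -> T) (x0 : T) :
  (forall N f f', (forall M, (M < N)%N -> f M = f' M) -> step N f = step N f') ->
  exists g, forall N, g N = step N g.
Proof.
move=> h.
pose l := fix l N := if N is N'.+1 then rcons (l N') (step N' (nth x0 (l N'))) else [::].
have sl N : size (l N) = N by elim: N => //= N IH; rewrite size_rcons IH.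
have nl N K M : (M < N)%N -> nth x0 (l (N + K)%N) M = nth x0 (l N) M.
  move=> MN; elim: K => [|K IH]; first by rewrite addn0.
  by rewrite addnS /= nth_rcons sl (leq_trans MN) ?leq_addr.
exists (fun N => nth x0 (l N.+1) N) => N.
rewrite /= nth_rcons sl ltnn eqxx; apply: h => M MN.
by have := nl M.+1 (N - M.+1)%N M (ltnSn M); rewrite subnKC.
Qed.

(** The ranges matter: f is summed only below K while h goes up to K. In [partial_sums] this bounds
    the next sum by sums already controlled. *)
Lemma convolution_le (f h : nat -> R) K : (forall i, 0 <= f i) -> (forall i, 0 <= h i) ->
  \sum_(N < K.+1) \sum_(M < N) f M * h (N - M)%N <=
  (\sum_(M < K) f M) * (\sum_(L < K.+1) h L).
Proof.
move=> f0 h0.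
have -> : \sum_(N < K.+1) \sum_(M < N) f M * h (N - M)%N =
    \sum_(N < K.+1) \sum_(M < K) (if (M < N)%N then f M * h (N - M)%N else 0).
  apply: eq_bigr => N _.
  by rewrite (big_ord_widen K (fun M => f M * h (N - M)%N)) ?big_mkcond// -ltnS.
rewrite exchange_big /= mulr_suml; apply: ler_sum => M _.
have -> : \sum_(N < K.+1) (if (M < N)%N then f M * h (N - M)%N else 0) =
    f M * \sum_(N < K.+1) (if (M < N)%N then h (N - M)%N else 0).
  by rewrite mulr_sumr; apply: eq_bigr => N _; case: ifP; rewrite ?mulr0.
apply: ler_wpM2l => //.
have key m k : \sum_(N < k) (if (m < N)%N then h (N - m)%N else 0) <= \sum_(L < k - m) h L.
  elim: k => [|k IH]; first by rewrite big_ord0 sumr_ge0.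
  rewrite big_ord_recr /=; case: ltnP => hk.
    by rewrite subSn ?(ltnW hk)// [leRHS]big_ord_recr /= lerD2r.
  rewrite addr0; apply: (le_trans IH); have -> : (k - m = 0)%N by apply/eqP; rewrite subn_eq0.
  by rewrite big_ord0 sumr_ge0.
apply: (le_trans (key M K.+1)).
rewrite (big_ord_widen K.+1 h (leq_subr M K.+1)) big_mkcond /=.
by apply: ler_sum => i _; case: ifP.
Qed.

End PolyNorm.

(** * Homogeneous parts, the indicial polynomial and the recursion for the coefficients *)

Section Multipliers.
Context {R : realType}.
Implicit Types (p q : {poly R}) (m : nat -> nat -> R).

(** A diagonal operator on the homogeneous part of degree N. With m = [mu beta] it is D, since the
    monomials are eigenvectors of D; powers of [mu beta] give iterates of D. *)
Definition mult m N p : {poly R} := \poly_(j < N.+1) (m N j * p`_j).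

Lemma coef_mult m N p j : (size p <= N.+1)%N -> (mult m N p)`_j = m N j * p`_j.
Proof.
move=> h; rewrite coef_poly; case: ltnP => // hj.
by rewrite nth_default ?mulr0// (leq_trans h).
Qed.

Lemma size_mult m N p : (size (mult m N p) <= N.+1)%N.
Proof. exact: size_poly. Qed.

Lemma mult0 m N : mult m N 0 = 0.
Proof. by apply/polyP => j; rewrite coef_poly coef0 mulr0 if_same. Qed.

Lemma pnorm_mult m N p (C : R) : 0 <= C ->
  (forall j, (j <= N)%N -> `|m N j| <= C) -> pnorm (mult m N p) <= C * pnorm p.
Proof.
move=> C0 h; apply: pnorm_le => // i; rewrite coef_poly; case: ltnP => hi.
  by rewrite normrM; apply: ler_wpM2r => //; exact: h.
by rewrite normr0 mulr_ge0.
Qed.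

Lemma pnorm_mult_mult m m' N p (C : R) : 0 <= C ->
  (forall j, (j <= N)%N -> `|m N j * m' N j| <= C) ->
  pnorm (mult m N (mult m' N p)) <= C * pnorm p.
Proof.
move=> C0 h; apply: pnorm_le => // i; rewrite coef_poly; case: ltnP => hi.
  by rewrite coef_poly hi mulrA normrM; apply: ler_wpM2r => //; exact: h.
by rewrite normr0 mulr_ge0.
Qed.

(** The exponent j + beta (N - j) of x^j (x^beta)^(N - j), written without subtraction of natural
    numbers. *)
Definition mu (beta : R) (N j : nat) : R := beta * N%:R + (1 - beta) * j%:R.

Lemma muE beta N j : (j <= N)%N -> mu beta N j = j%:R + beta * (N - j)%:R.
Proof. by move=> h; rewrite /mu natrB//; ring. Qed.

Lemma mu_ge beta N j : 0 < beta -> (j <= N)%N -> Num.min 1 beta * N%:R <= mu beta N j.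
Proof.
move=> b0 jN; rewrite muE//.
have -> : N%:R = j%:R + (N - j)%:R :> R by rewrite -natrD subnKC.
rewrite mulrDr; apply: lerD.
  by rewrite ler_piMl// ge_min lexx.
by apply: ler_wpM2r => //; rewrite ge_min lexx orbT.
Qed.

(* The indicial polynomial of the linearised equation, whose roots -1, 0, 1 the
   nonresonance condition keeps away from the exponents mu with j < N. *)
Definition indicial (beta : R) N j : R := mu beta N j ^+ 3 - mu beta N j.

(** For mu >= 2 the cubic term dominates. Since mu is at least a positive multiple of N, only
    finitely many pairs have mu < 2, and at these it suffices that the indicial polynomial is not 0.
    For j >= 1 one has mu > 1 anyway; for j = 0 the value mu = 1 is the excluded resonance. *)
Lemma indicial_lower_bound (beta : R) : 0 < beta ->
  (forall m : nat, (0 < m)%N -> beta * m%:R <> 1) ->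
  exists2 A : R, 0 < A & forall N j k, (j < N)%N -> (k <= 3)%N ->
    mu beta N j ^+ k <= A * `|indicial beta N j|.
Proof.
move=> b0 nr; rewrite /indicial.
set c0 := Num.min 1 beta.
have c00 : 0 < c0 by rewrite lt_min ltr01.
have ne N j : (j < N)%N -> 0 < `|mu beta N j ^+ 3 - mu beta N j|.
  move=> jN; rewrite normr_gt0.
  have mu0 : 0 < mu beta N j.
    apply: lt_le_trans (mu_ge b0 (ltnW jN)); rewrite mulr_gt0// ltr0n.
    exact: leq_ltn_trans jN.
  have mu1 : mu beta N j != 1.
    rewrite muE ?(ltnW jN)//; case: j jN {mu0} => [|j] jN.
      by rewrite add0r subn0; apply/eqP; exact: nr.
    rewrite gt_eqF// (@lt_le_trans _ _ (1 + beta * (N - j.+1)%:R))//.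
      by rewrite ltrDl mulr_gt0// ltr0n subn_gt0.
    by rewrite lerD2r ler1n.
  rewrite (_ : _ - _ = mu beta N j * ((mu beta N j - 1) * (mu beta N j + 1))); last by ring.
  apply: mulf_neq0; first by rewrite gt_eqF.
  by apply: mulf_neq0; [rewrite subr_eq0|rewrite gt_eqF// addr_gt0].
have [B hB] : exists B : nat, forall N j, (j < N)%N -> mu beta N j < 2 -> (N < B)%N.
  exists (Num.bound (2 / c0)) => N j jN h.
  rewrite -(ltr_nat R); apply: lt_trans (archi_boundP _); last by rewrite divr_ge0// ltW.
  by rewrite ltr_pdivlMr// mulrC; apply: le_lt_trans h; exact: mu_ge b0 (ltnW jN).
(* A crude maximum over the finite exceptional set: a sum of nonnegative terms over a full square.
   Pairs with a vanishing denominator contribute 8 / 0 = 0. *)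
pose A1 := \sum_(N < B) \sum_(j < B) 8 / `|mu beta N j ^+ 3 - mu beta N j|.
have A10 : 0 <= A1 by apply: sumr_ge0 => i _; apply: sumr_ge0 => j _; rewrite divr_ge0.
exists (2 + A1) => [|N j k jN k3]; first by rewrite ltr_wpDr.
have mu0 : 0 <= mu beta N j.
  by apply: le_trans (mu_ge b0 (ltnW jN)); rewrite mulr_ge0// ltW.
have [mu2|mu2] := ltP (mu beta N j) 2; last first.
  have m1 : 1 <= mu beta N j by apply: le_trans mu2; rewrite ler1n.
  apply: (@le_trans _ _ (mu beta N j ^+ 3)); first by rewrite ler_weXn2l.
  apply: (@le_trans _ _ (2 * `|mu beta N j ^+ 3 - mu beta N j|)); last first.
    by apply: ler_wpM2r => //; rewrite lerDl.
  apply: le_trans (ler_wpM2l _ (ler_norm _)) => //.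
  set x := mu beta N j in mu2 m1 *.
  have : 0 <= x * ((x - 2) * (x + 2)) by rewrite !mulr_ge0// ?subr_ge0// addr_ge0.
  rewrite (_ : x * _ = x ^+ 3 - 4 * x); last by ring.
  lra.
apply: (@le_trans _ _ 8).
  apply: (@le_trans _ _ (2 ^+ k)); first by rewrite lerXn2r ?nnegrE// ltW.
  apply: (@le_trans _ _ (2 ^+ 3)); first by rewrite ler_weXn2l// ler1n.
  by rewrite -natrX.
apply: (@le_trans _ _ (A1 * `|mu beta N j ^+ 3 - mu beta N j|)); last first.
  by apply: ler_wpM2r => //; rewrite lerDr.
rewrite -ler_pdivrMr ?ne//.
have NB := hB _ _ jN mu2; have jB := ltn_trans jN NB.
rewrite /A1 (bigD1 (Ordinal NB)) //= (bigD1 (Ordinal jB)) //= -addrA lerDl.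
apply: addr_ge0; apply: sumr_ge0 => i _; first by rewrite divr_ge0.
by apply: sumr_ge0 => l _; rewrite divr_ge0.
Qed.

Section Recursion.
Variables (n beta kappa r : R).

Definition invmu N j := (mu beta N j)^-1.

(** The forcing carries a factor x^beta, so it has no monomial with j = N; cutting there avoids the
    zero of the indicial polynomial at N = j = 1. *)
Definition invind N j := if (j < N)%N then (indicial beta N j)^-1 else 0.

(** With y1, y2 the scaled x and x^beta, this inverts D^3 - D on -kappa y2 (1 - r y1) g. Multiplying
    by y2 raises the degree and keeps the polynomial, since powers of y1 index its coefficients;
    multiplying by y1 y2 raises the degree by two and brings in ['X]. *)
Definition forced (g : nat -> {poly R}) N : {poly R} :=
  match N with
  | 0 => 0
  | 1 => mult invind 1 (- kappa *: g 0%N)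
  | N'.+2 => mult invind N (- kappa *: (g N'.+1 - r *: ('X * g N')))
  end.

(** The part of degree N of phi. In degree 1 the monomial y1 is in the kernel of D^3 - D, which
    leaves room for [a]. *)
Definition vcoef (a : R) g N : {poly R} := (if N == 1%N then a *: 'X else 0) + forced g N.

(** The part of degree N of (1 + phi) D g = (1 - n) g D phi, solved for D g. Only M < N occurs
    because phi has no constant term; the value 1 in degree 0 normalises g. *)
Definition gstep a N (g : nat -> {poly R}) : {poly R} :=
  if N == 0%N then 1 else
  mult invmu N (\sum_(M < N) ((1 - n) *: (g M * mult (mu beta) (N - M)%N (vcoef a g (N - M)%N))
     - vcoef a g (N - M)%N * mult (mu beta) M (g M))).

Lemma gstep_exists : exists g : R -> nat -> {poly R}, forall a N, g a N = gstep a N (g a).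
Proof.
suff h a : exists g, forall N, g N = gstep a N g.
  by have [g hg] := choice h; exists g.
apply: (course_of_values 0) => N f f' h; rewrite /gstep; case: eqVneq => // N0.
congr (mult _ _ _); apply: eq_bigr => M _.
have v : vcoef a f (N - M)%N = vcoef a f' (N - M)%N.
  rewrite /vcoef; congr (_ + _).
  case E : (N - M)%N => [//|[|k]] /=.
    by rewrite h// lt0n.
  have hk : (k.+1 < N)%N by rewrite (leq_trans _ (leq_subr M N))// E.
  by rewrite (h k.+1)// (h k)// ltnW.
by rewrite v h.
Qed.

End Recursion.

End Multipliers.

(** * Evaluation of homogeneous series along the curve t -> (e^t, e^(beta t)) / 64 *)

Section Path.
Context {R : realType}.
Variable beta : R.
Hypothesis beta_gt0 : 0 < beta.
Implicit Types (p : {poly R}) (q : nat -> {poly R}) (t C : R).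
Local Notation c0 := (Num.min 1 beta).

Let c0_gt0 : 0 < c0. Proof. by rewrite lt_min ltr01. Qed.

(* The value at (y1, y2) = (e^t, e^(beta t)) / 64 of the homogeneous polynomial
   of degree N in (y1, y2) whose coefficient of y1^j y2^(N - j) is p`_j. *)
Definition ev N p t : R := \sum_(j < N.+1) p`_j * expR (mu beta N j * t) / 64 ^+ N.

(** Dehomogenisation: y2^N p(y1/y2), where y1/y2 = e^((1 - beta) t). In this form evaluation is
    visibly multiplicative. *)
Lemma evE N p t : (size p <= N.+1)%N ->
  ev N p t = (expR (beta * t) / 64) ^+ N * p.[expR ((1 - beta) * t)].
Proof.
move=> h; rewrite /ev (horner_coef_wide _ h) mulr_sumr; apply: eq_bigr => j _.
rewrite exprMn exprVn -!expRM_natr /mu.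
have -> : (beta * N%:R + (1 - beta) * j%:R) * t =
  beta * t * N%:R + (1 - beta) * t * j%:R by ring.
by rewrite expRD; ring.
Qed.

Lemma ev_coefD N p p' t : ev N (p + p') t = ev N p t + ev N p' t.
Proof. by rewrite -big_split /=; apply: eq_bigr => j _; rewrite coefD; ring. Qed.

Lemma ev_coefZ N (c : R) p t : ev N (c *: p) t = c * ev N p t.
Proof. by rewrite mulr_sumr; apply: eq_bigr => j _; rewrite coefZ; ring. Qed.

Lemma ev_sum N m (F : nat -> {poly R}) t :
  ev N (\sum_(i < m) F i) t = \sum_(i < m) ev N (F i) t.
Proof.
elim: m => [|m IH]; last by rewrite !big_ord_recr /= ev_coefD IH.
by rewrite !big_ord0 /ev big1// => j _; rewrite coef0 !mul0r.
Qed.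

Lemma size_mul_homog N M (p p' : {poly R}) : (size p <= N.+1)%N -> (size p' <= M.+1)%N ->
  (size (p * p')%R <= (N + M).+1)%N.
Proof.
move=> h h'; apply: (leq_trans (size_polyMleq _ _)).
apply: (@leq_trans (N.+1 + M.+1).-1); last by rewrite addnS.
by rewrite -!subn1 leq_sub2r// leq_add.
Qed.

Lemma evM N M p p' t : (size p <= N.+1)%N -> (size p' <= M.+1)%N ->
  ev (N + M) (p * p') t = ev N p t * ev M p' t.
Proof.
by move=> h h'; rewrite !evE ?size_mul_homog// hornerM exprD; ring.
Qed.

Lemma evS N p t : (size p <= N.+1)%N -> ev N.+1 p t = expR (beta * t) / 64 * ev N p t.
Proof. by move=> h; rewrite !evE ?(leq_trans h)// exprS mulrA. Qed.

Lemma evSX N p t : (size p <= N.+1)%N -> ev N.+1 ('X * p) t = expR t / 64 * ev N p t.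
Proof.
move=> h; rewrite !evE//; last first.
  by rewrite (@size_mul_homog 1 N)// size_polyX.
rewrite hornerM hornerX exprS.
have -> : expR t = expR (beta * t) * expR ((1 - beta) * t).
  by rewrite -expRD; congr expR; ring.
by ring.
Qed.

Lemma ev_le N p t : (size p <= N.+1)%N -> t <= 0 -> `|ev N p t| <= pnorm p / 64 ^+ N.
Proof.
move=> h t0; rewrite (pnorm_widen h) mulr_suml; apply: (le_trans (ler_norm_sum _ _ _)).
apply: ler_sum => j _; rewrite 2!normrM (ger0_norm (expR_ge0 _)).
rewrite [`|_ ^-1|]ger0_norm ?invr_ge0 ?exprn_ge0//.
apply: ler_wpM2r; first by rewrite invr_ge0 exprn_ge0.
rewrite ler_piMr// expR_le1 mulr_ge0_le0//.
by apply: le_trans (mu_ge beta_gt0 _); rewrite ?mulr_ge0 ?(ltW c0_gt0)// -ltnS.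
Qed.

Lemma ev_le_exp N p t : (0 < N)%N -> (size p <= N.+1)%N -> t <= 0 ->
  `|ev N p t| <= pnorm p / 64 ^+ N * expR (c0 * t).
Proof.
move=> N0 h t0; rewrite (pnorm_widen h) !mulr_suml; apply: (le_trans (ler_norm_sum _ _ _)).
apply: ler_sum => j _; rewrite 2!normrM (ger0_norm (expR_ge0 _)).
rewrite [`|_ ^-1|]ger0_norm ?invr_ge0 ?exprn_ge0// mulrAC.
apply: ler_wpM2l; first by rewrite mulr_ge0// invr_ge0 exprn_ge0.
rewrite ler_expR ler_wnM2r//.
have hj : (j <= N)%N by rewrite -ltnS.
by apply: le_trans (mu_ge beta_gt0 hj); rewrite ler_peMr ?ler1n// ltW.
Qed.

Lemma inv64_le N : (64 ^+ N)^-1 <= (4 ^+ N)^-1 :> R.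
Proof. by rewrite lef_pV2 ?posrE ?exprn_gt0// lerXn2r ?nnegrE// ler_nat. Qed.

Lemma inv4_le N : (4 ^+ N)^-1 <= (2 ^+ N)^-1 :> R.
Proof. by rewrite lef_pV2 ?posrE ?exprn_gt0// lerXn2r ?nnegrE// ler_nat. Qed.

Section Family.
Variables (q : nat -> {poly R}) (C : R).
Hypothesis sq : forall N, (size (q N) <= N.+1)%N.
Hypothesis nq : forall N, pnorm (q N) <= C.

Lemma family_ge0 : 0 <= C.
Proof. exact: le_trans (pnorm_ge0 _) (nq 0). Qed.

Lemma ev_dom4 t N : t <= 0 -> `|ev N (q N) t| <= C / 4 ^+ N.
Proof.
move=> t0; apply: (le_trans (ev_le (sq N) t0)).
apply: ler_pM => //; rewrite ?pnorm_ge0 ?invr_ge0 ?exprn_ge0// inv64_le//.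
Qed.

Lemma ev_dom t : t <= 0 -> dom (fun N => ev N (q N) t) C.
Proof.
by move=> t0; apply: dom_pow4 => N; exact: ev_dom4.
Qed.

Definition psum (q : nat -> {poly R}) t : R := ssum (fun N => ev N (q N) t).

Lemma psum_le t : t <= 0 -> `|psum q t| <= 2 * C.
Proof. by move=> t0; exact: ssum_le (ev_dom t0). Qed.

Lemma ev0E p t : ev 0 p t = p`_0.
Proof. by rewrite /ev big_ord1 /mu !mulr0 addr0 mul0r expR0 mulr1 expr0 divr1. Qed.

Lemma psum_asymptotics t : t <= 0 -> `|psum q t - (q 0%N)`_0| <= 2 * (C * expR (c0 * t)).
Proof.
move=> t0; rewrite /psum (ssum_split 1 (ev_dom t0)) big_ord1 ev0E addrAC subrr add0r.
apply: ssum_le => N; rewrite add1n.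
apply: (le_trans (ev_le_exp _ (sq _) t0)) => //.
rewrite mulrAC; apply: ler_pM => //.
- by rewrite mulr_ge0 ?pnorm_ge0 ?expR_ge0.
- by apply: ler_wpM2r => //; exact: expR_ge0.
- apply: (le_trans (inv64_le _)); apply: (le_trans (inv4_le _)).
  by rewrite lef_pV2 ?posrE ?exprn_gt0// ler_eXn2l ?ltr1n.
Qed.

Lemma mu_le N j : (j <= N)%N -> mu beta N j <= (1 + beta) * N%:R.
Proof.
move=> jN; rewrite muE// mulrDl mul1r; apply: lerD; first by rewrite ler_nat.
by apply: ler_wpM2l; [exact: ltW|rewrite ler_nat leq_subr].
Qed.

Lemma mu_nonneg N j : (j <= N)%N -> 0 <= mu beta N j.
Proof. by move=> jN; apply: le_trans (mu_ge beta_gt0 jN); rewrite mulr_ge0// ltW. Qed.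

(** Everything follows from 1 + y <= e^y. Factoring out e^(m t) shows that the remainder is
    nonnegative. Factoring out e^(m (t + h)) leaves a nonpositive term plus m h times a difference
    of exponentials, which is estimated from the side that suits the sign of m h. *)
Lemma exp_remainder (m t h : R) : 0 <= m -> t <= 0 -> t + h <= 0 ->
  `|expR (m * (t + h)) - expR (m * t) - h * (m * expR (m * t))| <= m ^+ 2 * h ^+ 2.
Proof.
move=> m0 t0 th0.
have e1 : expR (m * (t + h)) - expR (m * t) - h * (m * expR (m * t)) =
    expR (m * t) * (expR (m * h) - 1 - m * h).
  by rewrite mulrDr expRD; ring.
have e2 : expR (m * (t + h)) - expR (m * t) - h * (m * expR (m * t)) =
    expR (m * (t + h)) * (1 - expR (- (m * h)) - m * h) + m * h * (expR (m * (t + h)) - expR (m * t)).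
  have -> : expR (m * t) = expR (m * (t + h)) * expR (- (m * h)).
    by rewrite -expRD; congr expR; ring.
  by ring.
have g1 := expR_ge1Dx (m * h); have g2 := expR_ge1Dx (- (m * h)).
have a0 := expR_ge0 (m * t); have a1 : expR (m * t) <= 1 by rewrite expR_le1 mulr_ge0_le0.
have b0 := expR_ge0 (m * (t + h)).
have b1 : expR (m * (t + h)) <= 1 by rewrite expR_le1 mulr_ge0_le0.
have lo : 0 <= expR (m * (t + h)) - expR (m * t) - h * (m * expR (m * t)).
  by rewrite e1 mulr_ge0// subr_ge0 lerBrDl.
rewrite ger0_norm// e2.
have n1 : expR (m * (t + h)) * (1 - expR (- (m * h)) - m * h) <= 0.
  by apply: mulr_ge0_le0 => //; lra.
have n2 : m * h * (expR (m * (t + h)) - expR (m * t)) <= (m * h) ^+ 2.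
  have e3 : expR (m * (t + h)) - expR (m * t) <= expR (m * (t + h)) * (m * h).
    have -> : expR (m * t) = expR (m * (t + h)) * expR (- (m * h)).
      by rewrite -expRD; congr expR; ring.
    rewrite -{1}[expR (m * (t + h))]mulr1 -mulrBr; apply: ler_wpM2l => //; lra.
  have e4 : expR (m * t) * (m * h) <= expR (m * (t + h)) - expR (m * t).
    have -> : expR (m * (t + h)) = expR (m * t) * expR (m * h) by rewrite mulrDr expRD.
    rewrite -[X in _ - X]mulr1 -mulrBr; apply: ler_wpM2l => //; lra.
  have s0 := sqr_ge0 (m * h).
  have [mh|mh] := lerP 0 (m * h).
    apply: (le_trans (ler_wpM2l mh e3)); rewrite mulrCA -expr2.
    by rewrite ler_piMl.
  have := ler_wnM2l (ltW mh) e4; rewrite mulrCA -expr2 => h5; apply: (le_trans h5).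
  by rewrite ler_piMl.
by rewrite -exprMn; lra.
Qed.

Lemma sqr_le4 N : (N%:R) ^+ 2 <= 4 ^+ N :> R.
Proof.
have -> : 4 ^+ N = (2 ^+ N) ^+ 2 :> R by rewrite -exprM mulnC exprM; congr (_ ^+ _); ring.
by rewrite lerXn2r ?nnegrE// -natrX ler_nat ltnW// ltn_expl.
Qed.

Lemma is_derive_psum t : t < 0 ->
  is_derive t 1 (psum q) (psum (fun N => mult (mu beta) N (q N)) t).
Proof.
move=> t0; have C0 := family_ge0.
have e0 : 0 < - t by rewrite oppr_gt0.
have th h : `|h| < - t -> t + h <= 0.
  by move=> /ltW; rewrite ler_norml => /andP[_]; rewrite -subr_le0 opprK addrC.
have p2 N : 0 <= (2 ^+ N)^-1 :> R by rewrite invr_ge0 exprn_ge0.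
(* Here the factor 64 is spent: 64 = 4 * 16, where 4^N absorbs the N^2 coming from two derivatives
   and 16^N still leaves more than 2^N. *)
have N64 N : N%:R ^+ 2 / 64 ^+ N <= (2 ^+ N)^-1 :> R.
  have -> : 64 ^+ N = 4 ^+ N * 16 ^+ N :> R by rewrite -exprMn -natrM.
  rewrite invfM mulrA; apply: (@le_trans _ _ (1 * (16 ^+ N)^-1)).
    apply: ler_wpM2r; first by rewrite invr_ge0 exprn_ge0.
    by rewrite ler_pdivrMr ?exprn_gt0// mul1r sqr_le4.
  by rewrite mul1r lef_pV2 ?posrE ?exprn_gt0// lerXn2r ?nnegrE// ler_nat.
apply: (@is_derive_ssum _ (fun N => ev N (q N)) (fun N => ev N (mult (mu beta) N (q N)))
  t C ((1 + beta) * C) ((1 + beta) ^+ 2 * C) (- t) e0).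
- by move=> h /th; exact: ev_dom.
- move=> N; apply: (le_trans (ev_le (size_mult _ _ _) (ltW t0))).
  apply: (@le_trans _ _ ((1 + beta) * N%:R * C / 64 ^+ N)).
    apply: ler_wpM2r; first by rewrite invr_ge0 exprn_ge0.
    apply: (le_trans (@pnorm_mult _ _ _ _ ((1 + beta) * N%:R) _ _)).
    + by rewrite mulr_ge0// addr_ge0// ltW.
    + by move=> j jN; rewrite ger0_norm ?mu_nonneg// mu_le.
    + by apply: ler_wpM2l => //; rewrite mulr_ge0// addr_ge0// ltW.
  have -> : (1 + beta) * N%:R * C / 64 ^+ N = (1 + beta) * C * (N%:R / 64 ^+ N) by ring.
  apply: ler_wpM2l; first by rewrite mulr_ge0// addr_ge0// ltW.
  apply: le_trans (N64 N); apply: ler_wpM2r; first by rewrite invr_ge0 exprn_ge0.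
  by rewrite -natrX ler_nat; case: (N) => // k; rewrite -mulnn leq_pmulr.
- move=> N h /th hth.
  have -> : ev N (q N) (t + h) - ev N (q N) t - h * ev N (mult (mu beta) N (q N)) t =
    \sum_(j < N.+1) (q N)`_j / 64 ^+ N * (expR (mu beta N j * (t + h)) - expR (mu beta N j * t)
        - h * (mu beta N j * expR (mu beta N j * t))).
    rewrite /ev mulr_sumr -!sumrB; apply: eq_bigr => j _.
    by rewrite coef_mult//; ring.
  apply: (le_trans (ler_norm_sum _ _ _)).
  apply: (@le_trans _ _ (\sum_(j < N.+1) `|(q N)`_j| * ((1 + beta) ^+ 2 * h ^+ 2 / 2 ^+ N))).
    apply: ler_sum => j _; rewrite normrM normrM -mulrA; apply: ler_wpM2l => //.
    have jN : (j <= N)%N by rewrite -ltnS.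
    rewrite ger0_norm ?invr_ge0 ?exprn_ge0//.
    apply: (@le_trans _ _ ((64 ^+ N)^-1 * (((1 + beta) * N%:R) ^+ 2 * h ^+ 2))).
      apply: ler_wpM2l; first by rewrite invr_ge0 exprn_ge0.
      apply: (le_trans (exp_remainder (mu_nonneg jN) (ltW t0) hth)).
      apply: ler_wpM2r; first exact: sqr_ge0.
      rewrite lerXn2r ?nnegrE ?mu_nonneg ?mu_le//.
      by rewrite mulr_ge0// addr_ge0// ltW.
    have -> : (64 ^+ N)^-1 * (((1 + beta) * N%:R) ^+ 2 * h ^+ 2) =
      (1 + beta) ^+ 2 * h ^+ 2 * (N%:R ^+ 2 / 64 ^+ N) by ring.
    by apply: ler_wpM2l => //; rewrite mulr_ge0// sqr_ge0.
  rewrite -mulr_suml -pnorm_widen//.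
  have -> : (1 + beta) ^+ 2 * C * h ^+ 2 / 2 ^+ N = C * ((1 + beta) ^+ 2 * h ^+ 2 / 2 ^+ N) by ring.
  by apply: ler_wpM2r => //; rewrite mulr_ge0// mulr_ge0 ?sqr_ge0.
Qed.

End Family.
End Path.

(** * Convergence of the formal solution and the equations satisfied by its sum *)

Section LocalSolution.
Context {R : realType}.
Variables (n beta kappa r A a : R) (g : nat -> {poly R}).
Hypothesis beta_gt0 : 0 < beta.
Hypothesis n_le : `|1 - n| <= 2.
Hypothesis kappa_ge0 : 0 <= kappa.
Hypothesis r_itv : 0 <= r <= 1.
Hypothesis A_gt0 : 0 < A.
Hypothesis A_bound : forall N j k, (j < N)%N -> (k <= 3)%N ->
  mu beta N j ^+ k <= A * `|indicial beta N j|.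
Hypothesis gE : forall N, g N = gstep n beta kappa r a N g.

Local Notation V := (vcoef beta kappa r a g).
Local Notation W := (forced beta kappa r g).
Local Notation c0 := (Num.min 1 beta).

Let c0_gt0 : 0 < c0. Proof. by rewrite lt_min ltr01. Qed.

Lemma g_0 : g 0%N = 1. Proof. by rewrite gE. Qed.

Lemma vcoef0 : V 0%N = 0. Proof. by rewrite /vcoef addr0. Qed.

Lemma size_g N : (size (g N) <= N.+1)%N.
Proof. by rewrite gE /gstep; case: eqP => [->|_]; rewrite ?size_poly1// size_mult. Qed.

Lemma size_forced N : (size (W N) <= N.+1)%N.
Proof. by case: N => [|[|N]]; rewrite /= ?size_poly0// size_mult. Qed.

Lemma size_vcoef N : (size (V N) <= N.+1)%N.
Proof.
rewrite /vcoef; apply: (leq_trans (size_polyD _ _)); rewrite geq_max size_forced andbT.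
case: eqP => [->|_]; last by rewrite size_poly0.
by apply: (leq_trans (size_scale_leq _ _)); rewrite size_polyX.
Qed.

Lemma indicial_neq0 N j : (j < N)%N -> indicial beta N j != 0.
Proof.
move=> jN; have := @A_bound N j 0%N jN (leq0n _); rewrite expr0 -normr_gt0 => h.
by rewrite -(pmulr_rgt0 _ A_gt0) (lt_le_trans ltr01 h).
Qed.

Lemma invindK N (p : {poly R}) : (size p <= N)%N -> forall j,
  indicial beta N j * (mult (invind beta) N p)`_j = p`_j.
Proof.
move=> h j; rewrite coef_mult ?(leq_trans h)// /invind.
by case: ltnP => jN; [rewrite mulVKf// indicial_neq0|rewrite mul0r mulr0 nth_default// (leq_trans h)].
Qed.

(** The equation (D^3 - D) phi = -kappa y2 (1 - r y1) g, coefficient by coefficient. The term with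
    [a] drops out because its exponent is 1, a root of the indicial polynomial. *)
Lemma vcoef_indicial N j : indicial beta N j * (V N)`_j =
  - kappa * ((if N is N'.+1 then (g N')`_j else 0)
             - r * (if N is N'.+2 then ('X * g N')`_j else 0)).
Proof.
rewrite /vcoef coefD mulrDr.
have -> : indicial beta N j * (if N == 1%N then a *: 'X else 0)`_j = 0.
  case: eqP => [->|_]; last by rewrite coef0 mulr0.
  rewrite coefZ coefX; case: eqP => [->|_]; last by rewrite !mulr0.
  by rewrite /indicial /mu; ring.
rewrite add0r; case: N => [|[|N]].
- by rewrite /= coef0 !mulr0 subr0 mulr0.
- rewrite invindK; first by rewrite coefZ mulr0 subr0.
  by rewrite (leq_trans (size_scale_leq _ _))// size_g.
- rewrite invindK; first by rewrite coefZ coefB coefZ.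
  rewrite (leq_trans (size_scale_leq _ _))// (leq_trans (size_polyD _ _))// geq_max size_g /=.
  rewrite size_polyN (leq_trans (size_scale_leq _ _))//.
  by rewrite (leq_trans (size_polyMleq _ _))// size_polyX add2n /= ltnS size_g.
Qed.

Let G N := pnorm (g N).
Let P N := pnorm (mult (mu beta) N (g N)).
Let E N := pnorm (mult (mu beta) N (V N)).

Lemma mu_ge0 N j : (j <= N)%N -> 0 <= mu beta N j.
Proof. by move=> jN; apply: le_trans (mu_ge beta_gt0 jN); rewrite mulr_ge0// ltW. Qed.

Lemma mu_ge_c0 N j : (0 < N)%N -> (j <= N)%N -> c0 <= mu beta N j.
Proof.
by move=> N0 jN; apply: le_trans (mu_ge beta_gt0 jN); rewrite ler_peMr ?ler1n// ltW.
Qed.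

(** Division by the cubic indicial polynomial pays for up to three factors of mu; this is what makes
    D^3 phi converge with the same bounds as phi. *)
Lemma pnorm_forced k N : (k <= 3)%N ->
  pnorm (mult (fun N j => mu beta N j ^+ k) N (W N)) <=
  A * kappa * ((if N is N'.+1 then G N' else 0) + (if N is N'.+2 then G N' else 0)).
Proof.
move=> k3.
have key M p : pnorm (mult (fun N j => mu beta N j ^+ k) M (mult (invind beta) M p)) <= A * pnorm p.
  apply: pnorm_mult_mult; first exact: ltW.
  move=> j jM; rewrite /invind; case: ltnP => jM'; last by rewrite mulr0 normr0 ltW.
  rewrite normrM normfV ger0_norm ?exprn_ge0 ?mu_ge0//.
  rewrite ler_pdivrMr ?normr_gt0 ?indicial_neq0//; exact: A_bound.
case: N => [|[|N]].
- by rewrite /= addr0 mulr0 mult0 pnorm0.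
- apply: (le_trans (key _ _)); rewrite addr0 -mulrA; apply: ler_wpM2l; first exact: ltW.
  by apply: (le_trans (pnormZ _ _)); rewrite normrN ger0_norm.
- apply: (le_trans (key _ _)); rewrite -mulrA; apply: ler_wpM2l; first exact: ltW.
  apply: (le_trans (pnormZ _ _)); rewrite normrN ger0_norm//; apply: ler_wpM2l => //.
  apply: (le_trans (pnormB _ _)); rewrite lerD2l.
  apply: (le_trans (pnormZ _ _)); rewrite pnormXM; case/andP: r_itv => r0 r1.
  by rewrite ger0_norm// ler_piMl// pnorm_ge0.
Qed.

Lemma pnorm_Dvcoef_le N : E N <= (if N == 1%N then `|a| else 0) +
  A * kappa * ((if N is N'.+1 then G N' else 0) + (if N is N'.+2 then G N' else 0)).
Proof.
have -> : E N = pnorm (mult (mu beta) N (if N == 1%N then a *: 'X else 0)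
   + mult (fun N j => mu beta N j ^+ 1) N (W N)).
  congr pnorm; apply/polyP => j; rewrite coefD !coef_poly; case: ifP => // _.
    by rewrite expr1 -mulrDr -coefD.
  by rewrite addr0.
apply: (le_trans (pnormD _ _)); apply: lerD; last exact: pnorm_forced.
case: eqP => [->|_].
  have -> : mult (mu beta) 1 (a *: 'X) = a *: 'X.
    apply/polyP => i; rewrite coef_poly coefZ coefX.
    case: i => [|[|i]] /=; rewrite ?mulr0 ?mulr1//.
    by rewrite /mu; ring.
  by apply: (le_trans (pnormZ _ _)); rewrite -['X]mulr1 pnormXM pnorm1 mulr1.
by rewrite mult0 pnorm0.
Qed.

Lemma pnorm_vcoef_le_D N : pnorm (V N) <= E N / c0.
Proof.
case: N => [|N]; first by rewrite vcoef0 pnorm0 divr_ge0 ?pnorm_ge0// ltW.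
rewrite mulrC; apply: pnorm_le; first by rewrite invr_ge0 ltW.
move=> i; case: (ltnP i N.+2) => hi; last first.
  by rewrite nth_default ?(leq_trans (size_vcoef _))// normr0 mulr_ge0// invr_ge0 ltW.
rewrite coef_mult ?size_vcoef// normrM ler_pdivlMl//; apply: ler_wpM2r => //.
by rewrite ger0_norm ?mu_ge0// mu_ge_c0.
Qed.

Lemma pnorm_g_le_D N : (0 < N)%N -> G N <= P N / c0.
Proof.
move=> N0; rewrite mulrC; apply: pnorm_le; first by rewrite invr_ge0 ltW.
move=> i; case: (ltnP i N.+1) => hi; last first.
  by rewrite nth_default ?(leq_trans (size_g _))// normr0 mulr_ge0// invr_ge0 ltW.
rewrite coef_mult ?size_g// normrM ler_pdivlMl//; apply: ler_wpM2r => //.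
by rewrite ger0_norm ?mu_ge0// mu_ge_c0.
Qed.

Lemma pnorm_Dg0 : P 0%N = 0.
Proof.
rewrite /P (_ : mult _ _ _ = 0) ?pnorm0//; apply/polyP => j.
by rewrite coef_poly coef0; case: j => [|j] //=; rewrite /mu !mulr0 addr0 mul0r.
Qed.

Lemma mult_mu_g N : mult (mu beta) N (g N) =
  \sum_(M < N) ((1 - n) *: (g M * mult (mu beta) (N - M)%N (V (N - M)%N))
     - V (N - M)%N * mult (mu beta) M (g M)).
Proof.
case: N => [|N].
  rewrite big_ord0; apply/polyP => j.
  by rewrite coef_poly coef0; case: j => [|j] //=; rewrite /mu !mulr0 addr0 mul0r.
rewrite {1}gE /gstep /=; set S := \sum_(M < N.+1) _.
have sS : (size S <= N.+2)%N.
  apply: (leq_trans (size_sum _ _ _)); apply/bigmax_leqP => M _.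
  have hM : (M <= N.+1)%N by exact: ltnW.
  have sz (p q : {poly R}) u v : (size p <= u.+1)%N -> (size q <= v.+1)%N ->
      (u + v = N.+1)%N -> (size (p * q)%R <= N.+2)%N.
    by move=> hp hq <-; exact: size_mul_homog.
  apply: (leq_trans (size_polyD _ _)); rewrite geq_max size_polyN; apply/andP; split.
    apply: (leq_trans (size_scale_leq _ _)); apply: (sz _ _ M (N.+1 - M)%N).
    - exact: size_g.
    - exact: size_mult.
    - by rewrite subnKC.
  apply: (sz _ _ (N.+1 - M)%N M); last by rewrite subnK.
    exact: size_vcoef.
  exact: size_mult.
apply/polyP => j; rewrite coef_mult ?size_mult// coef_poly.
case: ltnP => hj; last by rewrite mulr0 nth_default// (leq_trans sS).
by rewrite /invmu mulVKf// gt_eqF// (lt_le_trans c0_gt0)// mu_ge_c0.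
Qed.

Lemma g_ode N : \sum_(M < N.+1) V (N - M)%N * mult (mu beta) M (g M) + mult (mu beta) N (g N)
  = (1 - n) *: \sum_(M < N.+1) g M * mult (mu beta) (N - M)%N (V (N - M)%N).
Proof.
have D0 : mult (mu beta) 0 (V 0%N) = 0.
  by rewrite vcoef0; apply/polyP => j; rewrite coef_poly coef0 mulr0 if_same.
rewrite (mult_mu_g N) !big_ord_recr /= subnn D0 vcoef0 mul0r addr0 mulr0 addr0.
by rewrite scaler_sumr -big_split /=; apply: eq_bigr => M _; rewrite addrC subrK.
Qed.

Lemma pnorm_Dg_le N : P N <= 2 * \sum_(M < N) G M * E (N - M)%N + (\sum_(M < N) P M * E (N - M)%N) / c0.
Proof.
rewrite /P mult_mu_g mulr_sumr mulr_suml -big_split /=.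
pose F M := (1 - n) *: (g M * mult (mu beta) (N - M)%N (V (N - M)%N))
     - V (N - M)%N * mult (mu beta) M (g M).
apply: (le_trans (pnorm_sum N F)); apply: ler_sum => M _; rewrite /F.
apply: (le_trans (pnormB _ _)); apply: lerD.
  apply: (le_trans (pnormZ _ _)); apply: ler_pM => //; first exact: pnorm_ge0.
  exact: pnormM.
apply: (le_trans (pnormM _ _)); rewrite mulrC -mulrA; apply: ler_wpM2l; first exact: pnorm_ge0.
exact: pnorm_vcoef_le_D.
Qed.

Hypothesis small : `|a| + 4 * (A * kappa) <= c0 / 5.

Let G0 N : 0 <= G N. Proof. exact: pnorm_ge0. Qed.
Let P_0 N : 0 <= P N. Proof. exact: pnorm_ge0. Qed.
Let E_0 N : 0 <= E N. Proof. exact: pnorm_ge0. Qed.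
Let Ak0 : 0 <= A * kappa. Proof. by rewrite mulr_ge0// ltW. Qed.

Lemma sum_prev (f : nat -> R) K :
  \sum_(N < K.+1) (if nat_of_ord N is N'.+1 then f N' else 0) = \sum_(N < K) f N.
Proof. by rewrite big_ord_recl add0r. Qed.

Lemma sum_prev2 (f : nat -> R) K : (forall i, 0 <= f i) ->
  \sum_(N < K.+1) (if nat_of_ord N is N'.+2 then f N' else 0) <= \sum_(N < K) f N.
Proof.
move=> f0; rewrite big_ord_recl add0r.
case: K => [|K]; first by rewrite !big_ord0.
rewrite big_ord_recl /= add0r.
by rewrite [leRHS]big_ord_recr /= lerDl.
Qed.

Lemma sum_forced k K : (k <= 3)%N ->
  \sum_(N < K.+1) pnorm (mult (fun N j => mu beta N j ^+ k) N (W N))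
  <= 2 * (A * kappa) * \sum_(N < K) G N.
Proof.
move=> k3; eapply le_trans; first by apply: ler_sum => i _; exact: (pnorm_forced i k3).
rewrite -mulr_sumr big_split /= sum_prev//.
have := sum_prev2 K G0; have S0 : 0 <= \sum_(N < K) G N by exact: sumr_ge0.
by move=> /(ler_wpM2l Ak0); rewrite mulrDr; lra.
Qed.

Lemma sum_E K : \sum_(N < K.+1) E N <= `|a| + 2 * (A * kappa) * \sum_(N < K) G N.
Proof.
eapply le_trans; first by apply: ler_sum => i _; exact: pnorm_Dvcoef_le.
rewrite big_split /=; apply: lerD.
  rewrite big_ord_recl /= add0r; case: K => [|K]; first by rewrite big_ord0.
  by rewrite big_ord_recl /= big1 ?addr0.
rewrite -mulr_sumr big_split /= sum_prev//.
have := sum_prev2 K G0; have S0 : 0 <= \sum_(N < K) G N by exact: sumr_ge0.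
by move=> /(ler_wpM2l Ak0); rewrite mulrDr; lra.
Qed.

(** A bootstrap on K. The bound 2 on the earlier G gives sum E <= c0/5 by [small]. With |1 - n| <= 2
    the sum of P is then at most 2 * 2 * c0/5 + c0/5 = c0, which is where the 5 comes from. Dividing
    by c0 and adding g_0 = 1 returns the bound 2 for G. *)
Lemma partial_sums K : \sum_(N < K) G N <= 2 /\ \sum_(N < K) P N <= c0.
Proof.
elim: K => [|K [IG IP]]; first by rewrite !big_ord0; split => //; exact: ltW.
have hE : \sum_(N < K.+1) E N <= c0 / 5.
  apply: le_trans small; apply: (le_trans (sum_E K)); rewrite lerD2l.
  by have := ler_wpM2l Ak0 IG; lra.
have SE0 : 0 <= \sum_(N < K.+1) E N by exact: sumr_ge0.
have SG0 : 0 <= \sum_(N < K) G N by exact: sumr_ge0.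
have SP0 : 0 <= \sum_(N < K) P N by exact: sumr_ge0.
have hP : \sum_(N < K.+1) P N <= c0.
  eapply le_trans; first by apply: ler_sum => i _; exact: pnorm_Dg_le.
  rewrite big_split /= -mulr_sumr -mulr_suml.
  have h1 := le_trans (convolution_le K G0 E_0) (ler_pM SG0 SE0 IG hE).
  have h2 := le_trans (convolution_le K P_0 E_0) (ler_pM SP0 SE0 IP hE).
  have h3 : (\sum_(i < K.+1) \sum_(M < i) P M * E (i - M)%N) / c0 <= c0 / 5.
    by rewrite ler_pdivrMr//; apply: (le_trans h2); rewrite mulrC.
  by lra.
split => //.
rewrite big_ord_recl {1}/G g_0 pnorm1.
have : \sum_(i < K) G (lift ord0 i) <= (\sum_(N < K.+1) P N) / c0.
  rewrite big_ord_recl pnorm_Dg0 add0r mulr_suml; apply: ler_sum => i _; exact: pnorm_g_le_D.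
have : (\sum_(N < K.+1) P N) / c0 <= 1 by rewrite ler_pdivrMr// mul1r.
by lra.
Qed.

Lemma le_partial (f : nat -> R) N : (forall i, 0 <= f i) -> f N <= \sum_(i < N.+1) f i.
Proof. by move=> f0; rewrite big_ord_recr /= lerDr sumr_ge0. Qed.

Lemma g_bound N : pnorm (g N) <= 2.
Proof. by apply: (le_trans (le_partial N G0)); have [] := partial_sums N.+1. Qed.

Lemma Dg_bound N : pnorm (mult (mu beta) N (g N)) <= 1.
Proof.
apply: (le_trans (le_partial N P_0)); have [_ h] := partial_sums N.+1.
by apply: (le_trans h); rewrite ge_min lexx.
Qed.

Lemma V_bound N : pnorm (V N) <= 5^-1.
Proof.
apply: (le_trans (pnorm_vcoef_le_D N)); rewrite ler_pdivrMr// mulrC.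
apply: (le_trans (le_partial N E_0)); apply: (le_trans (sum_E N)).
apply: le_trans small; rewrite lerD2l.
by have [IG _] := partial_sums N; have := ler_wpM2l Ak0 IG; lra.
Qed.

Lemma forced_bound k N : (k <= 3)%N ->
  pnorm (mult (fun N j => mu beta N j ^+ k) N (W N)) <= 4 * (A * kappa).
Proof.
move=> k3; have := @le_partial (fun N => pnorm (mult (fun N j => mu beta N j ^+ k) N (W N))) N.
move=> /(_ (fun i => pnorm_ge0 _)) h; apply: (le_trans h); apply: (le_trans (sum_forced N k3)).
by have [IG _] := partial_sums N; have := ler_wpM2l Ak0 IG; lra.
Qed.

Local Notation muk k := (fun N j => mu beta N j ^+ k).

(** D^k phi without its linear term. The split matters because the bounds on [psi] do not involve
    [a]: in the shooting argument [psi] is the error and the linear term is the signal. *)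
Definition psi k (t : R) : R := psum beta (fun N => mult (muk k) N (W N)) t.
Definition phi k (t : R) : R := a * expR t / 64 + psi k t.
Definition gfun (t : R) : R := psum beta g t.

Lemma psi_le k (t : R) : (k <= 3)%N -> t <= 0 -> `|psi k t| <= 8 * (A * kappa).
Proof.
move=> k3 t0; have -> : 8 * (A * kappa) = 2 * (4 * (A * kappa)) by ring.
apply: psum_le => // N; first exact: size_mult.
exact: (forced_bound).
Qed.

Lemma psi_asymptotics k (t : R) : (k <= 3)%N -> t <= 0 ->
  `|psi k t| <= 8 * (A * kappa) * expR (c0 * t).
Proof.
move=> k3 t0.
have h := @psum_asymptotics R beta beta_gt0 (fun N => mult (muk k) N (W N))
  (4 * (A * kappa)) (fun N => size_mult _ _ _)
  (fun N => forced_bound N k3) t t0.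
move: h; rewrite /= mult0 coef0 subr0 => h; apply: (le_trans h).
by rewrite le_eqVlt; apply/orP; left; apply/eqP; ring.
Qed.

Lemma multS k N (p : {poly R}) : mult (mu beta) N (mult (muk k) N p) = mult (muk k.+1) N p.
Proof.
by apply/polyP => j; rewrite !coef_poly; case: ltnP => // _; rewrite exprS mulrA.
Qed.

Lemma psi_derive k (t : R) : (k <= 2)%N -> t < 0 -> is_derive t 1 (psi k) (psi k.+1 t).
Proof.
move=> k2 t0.
have := @is_derive_psum R beta beta_gt0 (fun N => mult (muk k) N (W N)) (4 * (A * kappa)) _ _ t t0.
have -> : (fun N => mult (mu beta) N (mult (muk k) N (W N))) = (fun N => mult (muk k.+1) N (W N)).
  by apply/funext => N; rewrite multS.
apply => N; first exact: size_mult.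
apply: (forced_bound).
exact: leq_trans k2 _.
Qed.

Lemma phi_derive k (t : R) : (k <= 2)%N -> t < 0 -> is_derive t 1 (phi k) (phi k.+1 t).
Proof.
move=> k2 t0; apply: der_add; last exact: psi_derive.
have -> : (fun t : R => a * expR t / 64) = (fun t => a / 64 * expR t).
  by apply/funext => s; ring.
apply: (is_derive_eq (der_scale (a / 64) (is_derive_expR t))); ring.
Qed.

Let c01 : c0 <= 1. Proof. by rewrite ge_min lexx. Qed.

Lemma phi_asymptotics k (t : R) : (k <= 3)%N -> t <= 0 -> `|phi k t| <= 2^-1 * expR (c0 * t).
Proof.
move=> k3 t0; apply: (le_trans (ler_normD _ _)).
have h1 := psi_asymptotics k3 t0.
have h2 : expR t <= expR (c0 * t).
  by rewrite ler_expR -[leLHS]mul1r; apply: ler_wnM2r.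
rewrite 2!normrM normfV (ger0_norm (expR_ge0 t)) (ger0_norm (_ : 0 <= 64 :> R))//.
have h3 : `|a| * expR t / 64 <= `|a| * expR (c0 * t) / 64.
  by apply: ler_wpM2r => //; exact: ler_wpM2l.
have h4 : (`|a| / 64 + 8 * (A * kappa)) * expR (c0 * t) <= 2^-1 * expR (c0 * t).
  apply: ler_wpM2r; first exact: expR_ge0.
  by have := normr_ge0 a; have := small; have := c01; have := Ak0; lra.
apply: le_trans h4; rewrite mulrDl; apply: lerD => //.
by apply: (le_trans h3); rewrite mulrAC.
Qed.

Lemma phi_le k (t : R) : (k <= 3)%N -> t <= 0 -> `|phi k t| <= 2^-1.
Proof.
move=> k3 t0; apply: (le_trans (phi_asymptotics k3 t0)).
by rewrite ler_piMr// expR_le1 mulr_ge0_le0// ltW.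
Qed.

Let L N : {poly R} := if N == 1%N then a *: 'X else 0.

Lemma size_linear_part N : (size (L N) <= N.+1)%N.
Proof.
rewrite /L; case: eqP => [->|_]; last by rewrite size_poly0.
by rewrite (leq_trans (size_scale_leq _ _))// size_polyX.
Qed.

Lemma pnorm_linear_part N : pnorm (L N) <= `|a|.
Proof.
rewrite /L; case: eqP => _; last by rewrite pnorm0.
by apply: (le_trans (pnormZ _ _)); rewrite -['X]mulr1 pnormXM pnorm1 mulr1.
Qed.

Lemma mult_vcoef k N : mult (muk k) N (V N) = L N + mult (muk k) N (W N).
Proof.
apply/polyP => j; rewrite coefD /vcoef -/(L N) 2!coef_poly coefD; case: ltnP => hj; last first.
  by rewrite addr0 nth_default// (leq_trans _ hj)// size_linear_part.
rewrite mulrDr; congr (_ + _); rewrite /L; case: eqP hj => [->|_] hj; last by rewrite coef0 mulr0.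
rewrite coefZ coefX; case: j hj => [|[|j]]//= _; rewrite ?mulr0// mulr1 /mu.
by rewrite (_ : _ + _ = 1) ?expr1n ?mul1r//; ring.
Qed.

Lemma psum_vcoef k (t : R) : (k <= 3)%N -> t <= 0 ->
  dom (fun N => ev beta N (mult (muk k) N (V N)) t) (`|a| + 4 * (A * kappa)) /\
  psum beta (fun N => mult (muk k) N (V N)) t = phi k t.
Proof.
move=> k3 t0.
have eqF : (fun N => ev beta N (mult (muk k) N (V N)) t) =
         (fun N => ev beta N (L N) t + ev beta N (mult (muk k) N (W N)) t).
  by apply/funext => N; rewrite -ev_coefD mult_vcoef.
have dL : dom (fun N => ev beta N (L N) t) `|a|.
  by apply: (ev_dom beta_gt0 (q := L)) => // N; [exact: size_linear_part|exact: pnorm_linear_part].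
have dW : dom (fun N => ev beta N (mult (muk k) N (W N)) t) (4 * (A * kappa)).
  apply: (ev_dom beta_gt0 (q := (fun N => mult (muk k) N (W N)))) => // N; first exact: size_mult.
  exact: (forced_bound).
split; first by rewrite eqF; exact: domD.
rewrite /psum eqF (ssumD dL dW); congr (_ + _).
rewrite (@ssum_finite _ _ 2).
  rewrite big_ord_recl big_ord1 /= /ev big_ord1 coef0 !mul0r add0r.
  rewrite big_ord_recl big_ord1 /= !coefZ !coefX /= mulr0 !mul0r add0r mulr1 expr1.
  by rewrite (_ : mu beta 1 _ = 1) ?mul1r// /mu /bump /=; ring.
case=> [|[|N]]// _; rewrite /ev big1// => j _.
by rewrite /L /= coef0 !mul0r.
Qed.


(** Sum of [vcoef_indicial] over N. The two forcing terms are the series of g shifted by one and by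
    two degrees, whence the two uses of [dom_shift]. *)
Lemma phi_ode (t : R) : t <= 0 -> phi 3 t - phi 1 t =
  - (kappa / 64) * expR (beta * t) * (1 - r / 64 * expR t) * gfun t.
Proof.
move=> t0.
have [d3 <-] := psum_vcoef (leqnn 3) t0.
have [d1 <-] := @psum_vcoef 1 t isT t0.
have dg : dom (fun N => ev beta N (g N) t) 2 by exact: (ev_dom beta_gt0 size_g g_bound).
have [s1 e1] := dom_shift dg; have [s2 e2] := dom_shift s1.
set b := expR (beta * t) / 64.
pose c1 := - kappa * b; pose c2 := kappa * r * b * (expR t / 64).
have eqF : (fun N => ev beta N (mult (muk 3) N (V N)) t + -1 * ev beta N (mult (muk 1) N (V N)) t) =
  (fun N => c1 * (if N is N'.+1 then ev beta N' (g N') t else 0)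
   + c2 * (if N is N''.+1 then (if N'' is N'.+1 then ev beta N' (g N') t else 0) else 0)).
  apply/funext => N.
  transitivity (ev beta N (- kappa *: ((if N is N'.+1 then g N' else 0)
             - r *: (if N is N'.+2 then 'X * g N' else 0))) t).
    rewrite -ev_coefZ -ev_coefD /ev; apply: eq_bigr => j _; congr (_ * _ * _).
    move: (nat_of_ord j) => {}j.
    rewrite coefD coefZ !coef_mult ?size_vcoef// expr1.
    have := vcoef_indicial N j; rewrite /indicial => h.
    rewrite mulN1r -mulrBl h coefZ coefB coefZ; congr (_ * (_ - _ * _)).
      by case: (N) => [|N']; rewrite ?coef0.
    by case: (N) => [|[|N']]; rewrite ?coef0.
  rewrite ev_coefZ ev_coefD -scaleNr ev_coefZ.
  case: N => [|[|N]].
  - by rewrite /ev !big_ord1 !coef0 !mul0r !mulr0 addr0 mulr0.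
  - rewrite evS ?size_g// (_ : ev _ _ 0 _ = 0); last by rewrite /ev big1// => j _; rewrite coef0 !mul0r.
    by rewrite /c1 /b; ring.
  - rewrite (@evS _ beta N.+1 (g N.+1)) ?size_g// (@evS _ beta N.+1 ('X * g N)); last by rewrite (@size_mul_homog _ 1 N) ?size_polyX ?size_g.
    by rewrite evSX ?size_g// /c1 /c2 /b; ring.
transitivity (ssum (fun N => ev beta N (mult (muk 3) N (V N)) t + -1 * ev beta N (mult (muk 1) N (V N)) t)).
  by rewrite (ssumD d3 (domZ _ d1)) (ssumZ _ d1) mulN1r.
rewrite eqF (ssumD (domZ _ s1) (domZ _ s2)) (ssumZ _ s1) (ssumZ _ s2) e2 e1.
by rewrite /gfun /psum /c1 /c2 /b; ring.
Qed.

(** Sum of [g_ode] over N, both sides being Cauchy products; the bounds are taken with 4^(-N) for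
    that reason. *)
Lemma gfun_ode (t : R) : t <= 0 ->
  (1 + phi 0 t) * psum beta (fun N => mult (mu beta) N (g N)) t = (1 - n) * (gfun t * phi 1 t).
Proof.
move=> t0.
have [d0 e0] := @psum_vcoef 0 t isT t0; have [d1 e1] := @psum_vcoef 1 t isT t0.
have m0 N : mult (muk 0) N (V N) = V N.
  apply/polyP => j; rewrite coef_poly; case: ltnP => hj; first by rewrite mul1r.
  by rewrite nth_default// (leq_trans (size_vcoef _)).
have m1 N : mult (muk 1) N (V N) = mult (mu beta) N (V N).
  by apply/polyP => j; rewrite !coef_poly expr1.
have dV N : `|ev beta N (V N) t| <= 5^-1 / 4 ^+ N.
  apply: (ev_dom4 beta_gt0 (q := V)) => // M; first exact: size_vcoef.
  exact: (V_bound).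
have dG N : `|ev beta N (g N) t| <= 2 / 4 ^+ N by exact: (ev_dom4 beta_gt0 size_g g_bound).
have dDG N : `|ev beta N (mult (mu beta) N (g N)) t| <= 1 / 4 ^+ N.
  apply: (ev_dom4 beta_gt0 (q := fun N => mult (mu beta) N (g N))) => // M; first exact: size_mult.
  exact: (Dg_bound).
have dDV N : `|ev beta N (mult (mu beta) N (V N)) t| <= (`|a| + 4 * (A * kappa)) / 4 ^+ N.
  rewrite -m1; apply: (ev_dom4 beta_gt0 (q := fun N => mult (muk 1) N (V N))) => // M.
    exact: size_mult.
  rewrite mult_vcoef; apply: (le_trans (pnormD _ _)); apply: lerD; first exact: pnorm_linear_part.
  exact: (forced_bound).
have p1 : phi 1 t = ssum (fun N => ev beta N (mult (mu beta) N (V N)) t).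
  by rewrite -e1 /psum; congr ssum; apply/funext => N; rewrite m1.
have p0 : phi 0 t = ssum (fun N => ev beta N (V N) t).
  by rewrite -e0 /psum; congr ssum; apply/funext => N; rewrite m0.
have evMs N M (p p' : {poly R}) : (M <= N)%N -> (size p <= (N - M).+1)%N -> (size p' <= M.+1)%N ->
    ev beta N (p * p') t = ev beta (N - M)%N p t * ev beta M p' t.
  by move=> MN hp hp'; rewrite -{1}(subnK MN) evM.
have dC (c d : nat -> R) (K K' : R) : (forall N, `|c N| <= K / 4 ^+ N) ->
    (forall N, `|d N| <= K' / 4 ^+ N) -> dom (fun N => \sum_(j < N.+1) c j * d (N - j)%N) (K * K').
  move=> hc hd N; have K0 : 0 <= K by move: (hc 0%N); rewrite expr0 divr1; apply: le_trans.
  have K'0 : 0 <= K' by move: (hd 0%N); rewrite expr0 divr1; apply: le_trans.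
  apply: (le_trans (ler_norm_sum _ _ _)).
  apply: (@le_trans _ _ (\sum_(j < N.+1) K * K' / 4 ^+ N)).
    apply: ler_sum => j _; have jN : (j <= N)%N by rewrite -ltnS.
    have e4 : 4 ^+ N = 4 ^+ j * 4 ^+ (N - j) :> R by rewrite -exprD subnKC.
    rewrite normrM e4 invfM mulrACA; exact: ler_pM.
  rewrite sumr_const card_ord -[_ *+ _]mulr_natr -mulrA; apply: ler_wpM2l; first exact: mulr_ge0.
  have -> : 4 ^+ N = 2 ^+ N * 2 ^+ N :> R by rewrite -exprMn -natrM.
  rewrite invfM -mulrA ler_piMr ?invr_ge0 ?exprn_ge0// ler_pdivrMl ?exprn_gt0// mulr1.
  by rewrite -natrX ler_nat ltn_expl.
rewrite mulrDl mul1r p0 p1 /gfun /psum [_ * ssum (fun N => ev beta N (mult _ _ _) t)]mulrC.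
rewrite -(ssum_cauchy dDG dV) -(ssum_cauchy dG dDV).
rewrite -(ssumD (dom_pow4 dDG) (dC _ _ _ _ dDG dV)) -(ssumZ _ (dC _ _ _ _ dG dDV)).
congr ssum; apply/funext => N.
have := congr1 (fun p => ev beta N p t) (g_ode N).
rewrite /= ev_coefD ev_coefZ.
rewrite (@ev_sum _ beta N N.+1 (fun M => V (N - M)%N * mult (mu beta) M (g M))).
rewrite (@ev_sum _ beta N N.+1 (fun M => g M * mult (mu beta) (N - M)%N (V (N - M)%N))).
rewrite addrC => h.
rewrite (_ : \sum_(j < N.+1) ev beta j (mult (mu beta) j (g j)) t * ev beta (N - j)%N (V (N - j)%N) t
  = \sum_(i < N.+1) ev beta N (V (N - i)%N * mult (mu beta) i (g i)) t); last first.
  apply: eq_bigr => j _; have jN : (j <= N)%N by rewrite -ltnS.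
  by rewrite (evMs N j) ?size_mult ?size_vcoef// mulrC.
rewrite h; congr (_ * _); apply: eq_bigr => j _; have jN : (j <= N)%N by rewrite -ltnS.
by rewrite mulrC (evMs N j) ?size_mult ?size_g// mulrC.
Qed.

Lemma one_phi_gt0 (t : R) : t <= 0 -> 0 < 1 + phi 0 t.
Proof. by move=> /(@phi_le 0 _ isT); rewrite ler_norml => /andP[]; lra. Qed.

(* gfun and (1 + phi)^(1 - n) solve the same linear first-order equation, and
   both tend to 1 at -oo. *)
Lemma gfunE (t : R) : t < 0 -> gfun t = (1 + phi 0 t) `^ (1 - n).
Proof.
move=> t0.
pose Q s := gfun s * (1 + phi 0 s) `^ (n - 1).
have gd (s : R) : s < 0 -> is_derive s 1 gfun (psum beta (fun N => mult (mu beta) N (g N)) s).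
  by move=> s0; exact: (is_derive_psum beta_gt0 size_g g_bound).
have Qd (s : R) : s < 0 -> is_derive s 1 Q 0.
  move=> s0; have p0 := one_phi_gt0 (ltW s0).
  have d1 : is_derive s 1 (fun s => 1 + phi 0 s) (phi 1 s).
    by apply: (is_derive_eq (der_add (der_cst 1 s) (@phi_derive 0 s isT s0))); rewrite add0r.
  have hd := der_mul (gd s s0) (@der_powR _ (fun s => 1 + phi 0 s) (n - 1) s (phi 1 s) p0 d1); cbv beta in hd; apply: (is_derive_eq hd).
  have -> : (1 + phi 0 s) `^ (n - 1) = (1 + phi 0 s) `^ (n - 1 - 1) * (1 + phi 0 s).
    rewrite -[X in _ * X]powRr1 ?(ltW p0)// -powRD; first by rewrite subrK.
    by apply/implyP => _; rewrite gt_eqF.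
  have := gfun_ode (ltW s0); set z := psum _ _ _; set w := _ `^ _ => h.
  have -> : z * (w * (1 + phi 0 s)) + gfun s * ((n - 1) * w * phi 1 s) =
    w * ((1 + phi 0 s) * z - (1 - n) * (gfun s * phi 1 s)) by ring.
  by rewrite h subrr mulr0.
have Qc (s : R) : s < t -> Q s = Q t.
  move=> st; apply/eqP; rewrite eq_le; apply/andP; split.
    apply: (@ge0_derive_le_cc _ Q (fun=> 0)) => //; first exact: ltW.
    by move=> x /andP[_ xt]; apply: Qd; exact: le_lt_trans xt t0.
  apply: (@le0_derive_ge_cc _ Q (fun=> 0)) => //; first exact: ltW.
  by move=> x /andP[_ xt]; apply: Qd; exact: le_lt_trans xt t0.
have E0 : expR (c0 * - m%:R) @[m --> \oo] --> (0 : R).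
  have -> : (fun m : nat => expR (c0 * - m%:R)) = (fun m : nat => geometric 1 (expR (- c0)) m).
    apply/funext => m; rewrite /geometric /= mul1r -expRM_natr; congr expR; ring.
  by apply: cvg_geometric; rewrite ger0_norm ?expR_ge0// expR_lt1 oppr_lt0.
have sq (f : R -> R) (l K : R) : (forall s, s <= 0 -> `|f s - l| <= K * expR (c0 * s)) ->
    f (- m%:R) @[m --> \oo] --> l.
  move=> hf; apply: cvg_sub0 (cvg_cst l).
  have z0 : (fun m : nat => K * expR (c0 * - m%:R)) @ \oo --> (0 : R).
    by rewrite -[0](mulr0 K); apply: cvgMr.
  apply: (@squeeze_cvgr _ _ _ _ (fun m : nat => - (K * expR (c0 * - m%:R)))
    (fun m : nat => K * expR (c0 * - m%:R))) => //; last by rewrite -oppr0; apply: cvgN.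
  by near=> m; rewrite -ler_norml; apply: hf; rewrite oppr_le0.
have Q1 : Q (- m%:R) @[m --> \oo] --> (1 : R).
  rewrite /Q -[X in _ --> X]mulr1; apply: cvgM.
    apply: (sq _ _ (2 * 2)) => s s0.
    have := psum_asymptotics beta_gt0 size_g g_bound s0.
    by rewrite g_0 coef1 mulrA.
  have p1 : 1 + phi 0 (- m%:R) @[m --> \oo] --> (1 : R).
    apply: (sq (fun s => 1 + phi 0 s) _ 2^-1) => s s0.
    by rewrite addrAC subrr add0r; exact: phi_asymptotics.
  have e1 : (1 : R) `^ (n - 1) = 1 by rewrite powR1.
  rewrite -[X in _ --> X]e1.
  exact: (cvg_comp _ _ p1 (derive_cont (is_derive1_powR (n - 1) ltr01))).
have [M hM] : exists M : nat, forall m : nat, (M <= m)%N -> Q (- m%:R) = Q t.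
  exists (Num.bound (- t)) => m hm; apply: Qc; rewrite ltrNl.
  apply: (@lt_le_trans _ _ (Num.bound (- t))%:R); last by rewrite ler_nat.
  by apply: archi_boundP; rewrite oppr_ge0 ltW.
have Qt : Q t = 1.
  have h : Q (- m%:R) @[m --> \oo] --> Q t.
    by apply: cvg_near_cst; exists M => // m /hM.
  exact: (cvg_unique (@Rhausdorff R) h Q1).
have p0 := one_phi_gt0 (ltW t0).
move: Qt; rewrite /Q => h.
have e : (1 + phi 0 t) `^ (n - 1) * (1 + phi 0 t) `^ (1 - n) = 1.
  rewrite -powRD; last by apply/implyP => _; rewrite gt_eqF.
  by rewrite (_ : n - 1 + (1 - n) = 0) ?powRr0//; ring.
by rewrite -[LHS]mulr1 -[X in _ * X = _]e mulrA h mul1r.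
Unshelve. all: by end_near. Qed.

End LocalSolution.


(** * The local solutions near x = 0 *)

Section CoefficientContinuity.
Context {R : realType}.
Implicit Types (p q : R -> {poly R}).

(** Continuity in the parameter is asked of each coefficient only. This suffices because every [ev]
    is a finite sum, and the passage to series is made by domination uniform in the parameter. *)
Definition ccont p := forall j, continuous (fun a => (p a)`_j).

Lemma ccont_cst (p0 : {poly R}) : ccont (fun=> p0).
Proof. by move=> j x; exact: cvg_cst. Qed.

Lemma ccontD p q : ccont p -> ccont q -> ccont (fun a => p a + q a).
Proof.
move=> hp hq j; have -> : (fun a => (p a + q a)`_j) = (fun a => (p a)`_j + (q a)`_j).
  by apply/funext => a; rewrite coefD.
by move=> x; apply: cvgD; [exact: hp|exact: hq].
Qed.

Lemma ccontZ (c : R) p : ccont p -> ccont (fun a => c *: p a).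
Proof.
move=> hp j; have -> : (fun a => (c *: p a)`_j) = (fun a => c * (p a)`_j).
  by apply/funext => a; rewrite coefZ.
by move=> x; apply: cvgMr; exact: hp.
Qed.

Lemma ccontB p q : ccont p -> ccont q -> ccont (fun a => p a - q a).
Proof.
move=> hp hq; have := ccontD hp (@ccontZ (-1) q hq).
by have -> : (fun a => p a + -1 *: q a) = (fun a => p a - q a) by apply/funext => a; rewrite scaleN1r.
Qed.

Lemma continuous_sum_ord m (F : nat -> R -> R) : (forall i, (i < m)%N -> continuous (F i)) ->
  continuous (fun a => \sum_(i < m) F i a).
Proof.
elim: m => [|m IH] h.
  have -> : (fun a => \sum_(i < 0) F i a) = (fun=> 0) by apply/funext => a; rewrite big_ord0.
  by move=> x; exact: cvg_cst.
have -> : (fun a => \sum_(i < m.+1) F i a) = (fun a => \sum_(i < m) F i a + F m a).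
  by apply/funext => a; rewrite big_ord_recr.
move=> x; apply: cvgD; last by apply: h.
by apply: IH => i im; apply: h; exact: ltnW.
Qed.

Lemma ccontM p q : ccont p -> ccont q -> ccont (fun a => p a * q a).
Proof.
move=> hp hq j.
have -> : (fun a => (p a * q a)`_j) = (fun a => \sum_(i < j.+1) (p a)`_i * (q a)`_(j - i)).
  by apply/funext => a; rewrite coefM.
apply: (@continuous_sum_ord j.+1 (fun i a => (p a)`_i * (q a)`_(j - i))) => i _ x.
by apply: cvgM; [exact: hp|exact: hq].
Qed.

Lemma ccont_sum m (F : nat -> R -> {poly R}) : (forall i, (i < m)%N -> ccont (F i)) ->
  ccont (fun a => \sum_(i < m) F i a).
Proof.
elim: m => [|m IH] h.
  have -> : (fun a => \sum_(i < 0) F i a) = (fun=> 0) by apply/funext => a; rewrite big_ord0.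
  exact: ccont_cst.
have -> : (fun a => \sum_(i < m.+1) F i a) = (fun a => \sum_(i < m) F i a + F m a).
  by apply/funext => a; rewrite big_ord_recr.
apply: ccontD; last by apply: h.
by apply: IH => i im; apply: h; exact: ltnW.
Qed.

Lemma ccont_mult m N p : ccont p -> ccont (fun a => mult m N (p a)).
Proof.
move=> hp j.
have -> : (fun a => (mult m N (p a))`_j) = (fun a => (if (j < N.+1)%N then m N j else 0) * (p a)`_j).
  by apply/funext => a; rewrite coef_poly; case: ltnP => // _; rewrite mul0r.
by move=> x; apply: cvgMr; exact: hp.
Qed.

Lemma ccont_scaleX (f : R -> R) : continuous f -> ccont (fun a => f a *: 'X).
Proof.
move=> hf j; have -> : (fun a => (f a *: 'X)`_j) = (fun a => f a * ('X : {poly R})`_j).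
  by apply/funext => a; rewrite coefZ.
by move=> x; apply: cvgMl; exact: hf.
Qed.

Lemma ccont_forced (beta kappa r : R) (g : R -> nat -> {poly R}) N :
  (forall M, (M < N)%N -> ccont (fun a => g a M)) ->
  ccont (fun a => forced beta kappa r (g a) N).
Proof.
case: N => [|[|N]] h /=; first exact: ccont_cst.
  by apply: ccont_mult; apply: ccontZ; exact: h.
apply: ccont_mult; apply: ccontZ; apply: ccontB; first exact: h.
by apply: ccontZ; apply: ccontM; [exact: ccont_cst|apply: h; exact: ltnW].
Qed.

Lemma ccont_vcoef (beta kappa r : R) (f : R -> R) (g : R -> nat -> {poly R}) N :
  continuous f -> (forall M, (M < N)%N -> ccont (fun a => g a M)) ->
  ccont (fun a => vcoef beta kappa r (f a) (g a) N).
Proof.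
move=> hf h; apply: ccontD; last exact: ccont_forced.
by case: eqP => _; [exact: ccont_scaleX|exact: ccont_cst].
Qed.

Lemma ccont_g (n beta kappa r : R) (f : R -> R) (g : R -> nat -> {poly R}) : continuous f ->
  (forall a N, g a N = gstep n beta kappa r (f a) N (g a)) ->
  forall N, ccont (fun a => g a N).
Proof.
move=> hf hg N; have [m] := ubnP N; elim: m N => // m IH N Nm.
have -> : (fun a => g a N) = (fun a => gstep n beta kappa r (f a) N (g a)).
  by apply/funext => a; exact: hg.
rewrite /gstep; case: eqP => [_|/eqP N0]; first exact: ccont_cst.
have IH' M : (M < N)%N -> ccont (fun a => g a M).
  by move=> MN; apply: IH; exact: (leq_trans MN).
apply: ccont_mult.
apply: (@ccont_sum N (fun M a => (1 - n) *: (g a M * mult (mu beta) (N - M)%N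
   (vcoef beta kappa r (f a) (g a) (N - M)%N))
     - vcoef beta kappa r (f a) (g a) (N - M)%N * mult (mu beta) M (g a M))) => M MN.
have hV : ccont (fun a => vcoef beta kappa r (f a) (g a) (N - M)%N).
  by apply: ccont_vcoef => // k kN; apply: IH'; apply: (leq_trans kN); exact: leq_subr.
apply: ccontB.
  by apply: ccontZ; apply: ccontM; [exact: IH'|exact: ccont_mult].
by apply: ccontM => //; apply: ccont_mult; exact: IH'.
Qed.

Lemma continuous_ev (beta t : R) N p : ccont p -> continuous (fun a => ev beta N (p a) t).
Proof.
move=> hp; rewrite /ev.
apply: (@continuous_sum_ord N.+1 (fun j a => (p a)`_j * expR (mu beta N j * t) / 64 ^+ N)).
by move=> j _ x; apply: cvgMl; apply: cvgMl; exact: hp.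
Qed.

End CoefficientContinuity.

(** * The local solutions in the original variable x = X e^t *)

Section LocalProfile.
Context {R : realType}.
Variables (n beta theta A X a : R) (g : nat -> {poly R}).
Hypothesis n_lt3 : n < 3.
Hypothesis betaE : beta = 3 - n.
Hypothesis theta_gt0 : 0 < theta.
Hypothesis X_gt0 : 0 < X.
Let kappa := 64 * (theta `^ (- n) * X `^ beta).
Let r := 64 * X.
Hypothesis n_le : `|1 - n| <= 2.
Hypothesis r_le1 : r <= 1.
Hypothesis A_gt0 : 0 < A.
Hypothesis A_bound : forall N j k, (j < N)%N -> (k <= 3)%N ->
  mu beta N j ^+ k <= A * `|indicial beta N j|.
Hypothesis gE : forall N, g N = gstep n beta kappa r a N g.
Hypothesis small : `|a| + 4 * (A * kappa) <= Num.min 1 beta / 5.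

Let beta_gt0 : 0 < beta. Proof. by rewrite betaE subr_gt0. Qed.
Let kappa_ge0 : 0 <= kappa. Proof. by rewrite mulr_ge0// mulr_ge0// powR_ge0. Qed.
Let r_itv : 0 <= r <= 1. Proof. by rewrite r_le1 mulr_ge0// ltW. Qed.
Local Notation c0 := (Num.min 1 beta).

Let ph k (x : R) := phi beta kappa r a g k (ln (x / X)).
Let logt (x : R) : 0 < x < X -> ln (x / X) < 0.
Proof. by move=> /andP[x0 xX]; rewrite ln_lt0// divr_gt0//= ltr_pdivrMr// mul1r. Qed.

(** With x d/dx = D, the next two definitions are H' = theta (1 + phi + D phi) and H'' = (theta/x)
    (D phi + D^2 phi). *)
Definition hloc (x : R) := theta * x * (1 + phi beta kappa r a g 0 (ln (x / X))).
Definition uloc (x : R) := theta * (1 + phi beta kappa r a g 0 (ln (x / X))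
  + phi beta kappa r a g 1 (ln (x / X))).
Definition wloc (x : R) := theta / x * (phi beta kappa r a g 1 (ln (x / X))
  + phi beta kappa r a g 2 (ln (x / X))).

Let dlog (x : R) : 0 < x -> is_derive x 1 (fun x => ln (x / X)) x^-1.
Proof.
move=> x0; have xX : 0 < x / X by rewrite divr_gt0.
have d : is_derive x 1 (fun x => x / X) X^-1.
  have -> : (fun x : R => x / X) = (fun x => X^-1 * x) by apply/funext => y; rewrite mulrC.
  by apply: (is_derive_eq (der_scale X^-1 (der_id x))); rewrite mulr1.
have d2 := @der_comp _ (@ln R) (fun x => x / X) x _ _ (is_derive1_ln xX) d.
cbv beta in d2; apply: (is_derive_eq d2).
by rewrite invf_div mulrAC divff ?mul1r// gt_eqF.
Qed.

Let dph k (x : R) : (k <= 2)%N -> 0 < x < X -> is_derive x 1 (ph k) (ph k.+1 x / x).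
Proof.
move=> k2 xX; have x0 : 0 < x by case/andP: xX.
exact: (@der_comp _ (phi beta kappa r a g k) (fun x => ln (x / X)) x _ _
  (phi_derive beta_gt0 n_le kappa_ge0 r_itv A_gt0 A_bound gE small k2 (logt xX)) (dlog x0)).
Qed.

Lemma hloc_derive (x : R) : 0 < x < X -> is_derive x 1 hloc (uloc x).
Proof.
move=> xX; have x0 : 0 < x by case/andP: xX.
have d := der_mul (der_scale theta (der_id x)) (der_add (der_cst 1 x) (@dph 0 x isT xX)).
apply: (is_derive_eq d); rewrite /uloc -/(ph 0 x) -/(ph 1 x) mulr1 add0r; field.
by rewrite gt_eqF.
Qed.

Lemma uloc_derive (x : R) : 0 < x < X -> is_derive x 1 uloc (wloc x).
Proof.
move=> xX; have x0 : 0 < x by case/andP: xX.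
have d := der_scale theta (der_add (der_add (der_cst 1 x) (@dph 0 x isT xX)) (@dph 1 x isT xX)).
apply: (is_derive_eq d); rewrite /wloc -/(ph 1 x) -/(ph 2 x) add0r; field.
by rewrite gt_eqF.
Qed.

(** Differentiating H'' gives theta x^(-2) (D^3 phi - D phi). The constants [kappa] and [r] are
    chosen so that the scale X cancels: (kappa/64) (x/X)^beta = theta^(-n) x^beta and (r/64) (x/X) =
    x. *)
Lemma wloc_derive (x : R) : 0 < x < X ->
  is_derive x 1 wloc (- (1 - x) * hloc x `^ (1 - n)).
Proof.
move=> xX; have /andP[x0 xltX] := xX; have xn0 : x != 0 by rewrite gt_eqF.
have dinv : is_derive x 1 (fun x : R => x^-1) (- x ^- 2).
  apply: (is_derive_eq (is_deriveV xn0 (der_id x))).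
  by rewrite [_ *: _]mulr1.
have d := der_mul (der_scale theta dinv) (der_add (@dph 1 x isT xX) (@dph 2 x isT xX)).
apply: (is_derive_eq d).
have t0 := logt xX.
have E := phi_ode beta_gt0 n_le kappa_ge0 r_itv A_gt0 A_bound gE small (ltW t0).
rewrite (gfunE beta_gt0 n_le kappa_ge0 r_itv A_gt0 A_bound gE small t0) in E.
rewrite -/(ph 3 x) -/(ph 1 x) -/(ph 0 x) in E.
have xX0 : 0 < x / X by rewrite divr_gt0.
have p0 : 0 <= 1 + ph 0 x.
  by apply: ltW; exact: (one_phi_gt0 beta_gt0 n_le kappa_ge0 r_itv A_gt0 A_bound gE small (ltW t0)).
have e1 : expR (beta * ln (x / X)) = (x / X) `^ beta by rewrite /powR gt_eqF.
have e2 : r / 64 * expR (ln (x / X)) = x.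
  by rewrite lnK ?posrE// /r; field; rewrite gt_eqF.
have e3 : kappa / 64 * (x / X) `^ beta = theta `^ (- n) * x `^ beta.
  have -> : x `^ beta = (x / X) `^ beta * X `^ beta.
    by rewrite -powRM ?(ltW xX0) ?(ltW X_gt0)// divfK// gt_eqF.
  by rewrite /kappa; field.
rewrite e1 e2 in E.
have e4 : hloc x `^ (1 - n) = theta `^ (1 - n) * x `^ (1 - n) * (1 + ph 0 x) `^ (1 - n).
  by rewrite /hloc -/(ph 0 x) !powRM// ?mulr_ge0// ?ltW.
have e5 : theta * theta `^ (- n) = theta `^ (1 - n).
  rewrite -{1}[theta]powRr1 ?(ltW theta_gt0)// -powRD//.
  by apply/implyP => _; rewrite gt_eqF.
have e6 : x `^ beta = x `^ (1 - n) * x ^+ 2.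
  rewrite -powR_mulrn ?(ltW x0)// -powRD; first by congr (_ `^ _); rewrite betaE; ring.
  by apply/implyP => _; rewrite gt_eqF.
rewrite e4 -e5.
have -> : theta * (- x ^- 2) * (ph 1 x + ph 2 x) + theta * x^-1 * (ph 2 x / x + ph 3 x / x)
   = theta * x ^- 2 * (ph 3 x - ph 1 x) by field.
rewrite E mulNr mulNr e3 e6; field.
by [].
Qed.

Let phle k (x : R) : (k <= 3)%N -> 0 < x < X -> `|ph k x| <= 2^-1.
Proof.
move=> k3 /logt/ltW t0.
exact: (phi_le beta_gt0 n_le kappa_ge0 r_itv A_gt0 A_bound gE small k3 t0).
Qed.

Lemma hloc_bounds (x : R) : 0 < x < X -> theta * x / 2 <= hloc x <= 2 * theta * x.
Proof.
move=> xX; have := @phle 0 x isT xX; rewrite ler_norml => /andP[h1 h2].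
have /andP[x0 _] := xX.
have tx : 0 < theta * x by rewrite mulr_gt0.
rewrite /hloc -/(ph 0 x); apply/andP; split.
  by apply: ler_wpM2l; [exact: ltW|lra].
have -> : 2 * theta * x = theta * x * 2 by ring.
by apply: ler_wpM2l; [exact: ltW|lra].
Qed.

Lemma uloc_bounds (x : R) : 0 < x < X -> 0 <= uloc x <= 2 * theta.
Proof.
move=> xX; have := @phle 0 x isT xX; rewrite ler_norml => /andP[h1 h2].
have := @phle 1 x isT xX; rewrite ler_norml => /andP[h3 h4].
rewrite /uloc -/(ph 0 x) -/(ph 1 x); apply/andP; split.
  by apply: mulr_ge0; [exact: ltW|lra].
by rewrite mulrC; apply: ler_wpM2r; [exact: ltW|lra].
Qed.

(** D and D^2 both fix e^t, so the linear term contributes (theta/x) * 2 a (x/X)/64. The error bound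
    is independent of [a], and this lets the ends of the parameter range decide the sign of H''. *)
Lemma wloc_estimate (x : R) : 0 < x < X ->
  `|wloc x - theta * a / (32 * X)| <= theta / x * (16 * (A * kappa)).
Proof.
move=> xX; have /andP[x0 xltX] := xX; have t0 := ltW (logt xX).
have h1 := @psi_le _ n beta kappa r A a g beta_gt0 n_le kappa_ge0 r_itv A_gt0 A_bound gE small 1 _ isT t0.
have h2 := @psi_le _ n beta kappa r A a g beta_gt0 n_le kappa_ge0 r_itv A_gt0 A_bound gE small 2 _ isT t0.
have xX0 : 0 < x / X by rewrite divr_gt0.
have -> : wloc x - theta * a / (32 * X) =
   theta / x * (psi beta kappa r g 1 (ln (x / X)) + psi beta kappa r g 2 (ln (x / X))).
  rewrite /wloc /phi lnK ?posrE//; field.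
  by rewrite !gt_eqF.
rewrite normrM gtr0_norm ?divr_gt0//; apply: ler_wpM2l; first by rewrite divr_ge0// ltW.
by apply: (le_trans (ler_normD _ _)); lra.
Qed.

(** These rates yield, after gluing, the one-sided derivative theta of H at 0 and the continuity of
    H' there. *)
Lemma hloc_uloc_asymptotics (x : R) : 0 < x < X ->
  `|hloc x / x - theta| <= theta * (x / X) `^ c0 /\ `|uloc x - theta| <= theta * (x / X) `^ c0.
Proof.
move=> xX; have /andP[x0 xltX] := xX; have t0 := ltW (logt xX).
have h k (k3 : (k <= 3)%N) : `|ph k x| <= 2^-1 * (x / X) `^ c0.
  have xX0 : 0 < x / X by rewrite divr_gt0.
  rewrite /powR gt_eqF//.
  exact: (phi_asymptotics beta_gt0 n_le kappa_ge0 r_itv A_gt0 A_bound gE small k3 t0).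
have h0 := h 0%N isT; have h1 := h 1%N isT.
have p0 : 0 <= (x / X) `^ c0 := powR_ge0 _ _.
split.
  have -> : hloc x / x - theta = theta * ph 0 x.
    by rewrite /hloc -/(ph 0 x); field; rewrite gt_eqF.
  rewrite normrM gtr0_norm//; apply: ler_wpM2l; first exact: ltW.
  by apply: (le_trans h0); lra.
have -> : uloc x - theta = theta * (ph 0 x + ph 1 x) by rewrite /uloc -/(ph 0 x) -/(ph 1 x); ring.
rewrite normrM gtr0_norm//; apply: ler_wpM2l; first exact: ltW.
by apply: (le_trans (ler_normD _ _)); lra.
Qed.

End LocalProfile.

(** * One-sided derivatives and the equation as a first-order system *)

Section Derivatives.
Context {R : realType}.
Implicit Types (A : set R) (f g : R -> R) (x l : R).

Lemma is_derive_onP A f x l : is_derive_on A f x l <->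
  forall eps : R, 0 < eps -> exists2 d : R, 0 < d & forall y : R, A y -> y != x ->
    `|y - x| < d -> `|l - (f y - f x) / (y - x)| <= eps.
Proof.
rewrite /is_derive_on; split.
  move=> /cvgrPdist_le h eps /h; rewrite /within /dnbhs /= => -[d /= d0 hd].
  exists d => // y Ay yx yd; have := hd y; rewrite /ball /= distrC; exact.
move=> h; apply/cvgrPdist_le => eps /h[d d0 hd].
exists d => // y /=; rewrite distrC => yd yx Ay; exact: hd.
Qed.

Lemma is_deriveP f x l : is_derive x 1 f l <-> is_derive_on setT f x l.
Proof.
rewrite is_derive_onP; split.
  move=> [/cvg_ex[l' hl'] hl].
  have ll : l' = l by rewrite -hl; apply/esym/cvg_lim; [exact: Rhausdorff|exact: hl'].
  move: hl'; rewrite ll => /cvgrPdist_le h eps /h[d /= d0 hd].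
  exists d => // y _ yx yd.
  have := hd (y - x); rewrite /= sub0r normrN => /(_ yd); rewrite subr_eq0 => /(_ yx).
  by rewrite [(y - x) *: 1]mulr1 subrK [_ *: _]mulrC.
move=> h.
have lim : h^-1 *: (f (h *: 1 + x) - f x) @[h --> 0^'] --> l.
  apply/cvgrPdist_le => /= eps /h[d d0 hd].
  exists d => // y /=; rewrite sub0r normrN => yd y0.
  have := hd (y + x) I; rewrite addrK -subr_eq0 addrK => /(_ y0 yd).
  by rewrite [y *: 1]mulr1 [_ *: _]mulrC.
by apply: DeriveDef; [apply/cvg_ex; exists l|exact: cvg_lim].
Qed.

Lemma is_derive_on_sub A f x l : is_derive x 1 f l -> is_derive_on A f x l.
Proof.
move=> /is_deriveP/is_derive_onP h; apply/is_derive_onP => eps /h[d d0 hd].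
by exists d => // y _; exact: hd.
Qed.

Lemma is_derive_on_interior (a b : R) f x l : a < x < b ->
  is_derive_on `[a, b] f x l -> is_derive x 1 f l.
Proof.
move=> /andP[ax xb] /is_derive_onP h; apply/is_deriveP/is_derive_onP => eps /h[d d0 hd].
exists (Num.min d (Num.min (x - a) (b - x))).
  by rewrite !lt_min d0 !subr_gt0 ax xb.
move=> y _ yx; rewrite !lt_min => /and3P[yd ya yb]; apply: hd => //=.
rewrite in_itv /=; move: ya yb; rewrite !ltr_norml => /andP[h1 h2] /andP[h3 h4].
by apply/andP; split; lra.
Qed.

Lemma is_derive_on_unique f x l l' : 0 <= x <= 1 ->
  is_derive_on `[0, 1] f x l -> is_derive_on `[0, 1] f x l' -> l = l'.
Proof.
move=> /andP[x0 x1] /is_derive_onP h /is_derive_onP h'.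
apply/eqP; rewrite -subr_eq0 -normr_le0; apply/ler_addgt0Pr => eps eps0; rewrite add0r.
have e2 : 0 < eps / 2 by rewrite divr_gt0.
have [d d0 hd] := h _ e2; have [d' d'0 hd'] := h' _ e2.
pose m := Num.min d (Num.min d' 1) / 4.
have m0 : 0 < m by rewrite divr_gt0// !lt_min d0 d'0 ltr01.
have md : m < d.
  rewrite /m ltr_pdivrMr// (@le_lt_trans _ _ d)// ?ge_min ?lexx//; lra.
have md' : m < d'.
  rewrite /m ltr_pdivrMr// (@le_lt_trans _ _ d')// ?ge_min ?lexx ?orbT//; lra.
have m1 : m <= 4^-1.
  rewrite /m ler_pdivrMr// (@le_trans _ _ 1)// ?ge_min ?lexx ?orbT//; lra.
have [y [y01 yx yd yd']] : exists y : R, [/\ `[0, 1]%classic y, y != x, `|y - x| < d & `|y - x| < d'].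
  have [xh|xh] := lerP x 2^-1.
    exists (x + m); rewrite /= in_itv /= addrAC subrr add0r gtr0_norm//; split => //.
      by apply/andP; split; lra.
    by rewrite gt_eqF// ltrDl.
  exists (x - m); rewrite /= in_itv /= addrAC subrr add0r normrN gtr0_norm//; split => //.
    by apply/andP; split; lra.
  by rewrite lt_eqF// gtrDl oppr_lt0.
have := hd y y01 yx yd; have := hd' y y01 yx yd'.
set q := (f y - f x) / (y - x) => h2 h1.
have -> : l - l' = (l - q) - (l' - q) by ring.
by apply: (le_trans (ler_normB _ _)); lra.
Qed.

Lemma is_derive_on_cont (a b : R) f g :
  (forall x, `[a, b]%classic x -> is_derive_on `[a, b] f x (g x)) -> {within `[a, b], continuous f}.
Proof.
move=> h; apply/subspace_continuousP => x ax; apply/cvgrPdist_le => eps eps0.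
have /is_derive_onP /(_ 1 ltr01) [d d0 hd] := h x ax.
have K0 : 0 < `|g x| + 1 by rewrite ltr_pwDr.
have e0 : 0 < Num.min d (eps / (`|g x| + 1)) by rewrite lt_min d0 divr_gt0.
exists (Num.min d (eps / (`|g x| + 1))) => // y /=; rewrite distrC lt_min => /andP[yd ye] ay.
have [->|yx] := eqVneq y x; first by rewrite subrr normr0 ltW.
have := hd y ay yx yd => hq.
have yx0 : y - x != 0 by rewrite subr_eq0.
have hq2 : `|(f y - f x) / (y - x)| <= `|g x| + 1.
  rewrite -[(_ / _)](subKr (g x)); apply: (le_trans (ler_normB _ _)); lra.
rewrite distrC -[f y - f x](divfK yx0) normrM.
apply: (@le_trans _ _ ((`|g x| + 1) * `|y - x|)); first exact: ler_wpM2r.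
by rewrite mulrC -ler_pdivlMr// ltW.
Qed.

(** The problem as a system for (H, H', H''), with the equation divided by the positive factor H^(n
    - 1). The slope conditions at the endpoints become values of the continuous function u; nothing
    is asked of w there. *)
Definition profile (n theta : R) (H u w : R -> R) :=
  [/\ [/\ {within `[0, 1], continuous H}, {within `[0, 1], continuous u},
          H 0 = 0, u 0 = theta & u 1 = 0],
      forall x, 0 < x < 1 -> 0 < H x,
      forall x, 0 < x < 1 -> is_derive x 1 H (u x),
      forall x, 0 < x < 1 -> is_derive x 1 u (w x)
    & forall x, 0 < x < 1 -> is_derive x 1 w (- (1 - x) * H x `^ (1 - n))].

Lemma is_solution_profile (n theta : R) (H : R -> R) :
  is_solution n theta H -> exists u w, profile n theta H u w.
Proof.
move=> [[[u [du uc]] [dk _]] Hpos ode [H0 dH0] dH1].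
have d1 x : 0 < x < 1 -> is_derive x 1 H (u x).
  move=> x01; apply: (is_derive_on_interior x01); apply: du; rewrite /= in_itv /=.
  by case/andP: x01 => /ltW -> /ltW ->.
have uE x : 0 < x < 1 -> u x = H^`(1)%classic x.
  by move=> x01; rewrite derive1n1 derive1E; have [_ ->] := d1 x x01.
have dn i x : (i < 3)%N -> 0 < x < 1 -> is_derive x 1 (H^`(i)%classic) (H^`(i.+1)%classic x).
  move=> i3 x01; apply: DeriveDef; first by apply: dk => //=; rewrite in_itv.
  by rewrite derive1nS derive1E.
exists u, (H^`(2)%classic); split.
- split => //.
  + exact: (is_derive_on_cont du).
  + by apply: (@is_derive_on_unique H 0); rewrite ?lexx ?ler01//; apply: du; rewrite /= in_itv /= lexx ler01.
  + by apply: (@is_derive_on_unique H 1); rewrite ?lexx ?ler01//; apply: du; rewrite /= in_itv /= lexx ler01.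
- by move=> x x01; apply: Hpos; rewrite in_itv.
- exact: d1.
- move=> x x01; apply: (@near_eq_is_derive _ _ _ (H^`(1)%classic)); last exact: (dn 1%N).
  by apply: (near_itvoo_eq x01) => y y01; rewrite uE.
- move=> x x01; apply: (is_derive_eq (dn 2%N x isT x01)).
  have x01' : x \in `]0, 1[ by rewrite in_itv.
  have h := ode x x01'; have p := Hpos x x01'.
  have e : H x `^ (1 - n) * H x `^ (n - 1) = 1.
    rewrite -powRD; last by apply/implyP => _; rewrite gt_eqF.
    by rewrite (_ : 1 - n + (n - 1) = 0) ?powRr0//; ring.
  have -> : H^`(3)%classic x = H x `^ (1 - n) * H x `^ (n - 1) * H^`(3)%classic x.
    by rewrite e mul1r.
  by rewrite -mulrA h; ring.
Qed.

Lemma profile_is_solution (n theta : R) (H u w : R -> R) : profile n theta H u w ->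
  is_derive_on `[0, 1] H 0 theta -> is_derive_on `[0, 1] H 1 0 -> is_solution n theta H.
Proof.
move=> [[Hc uc H0 u0 u1] Hpos d1 d2 d3] dH0 dH1.
pose z x := - (1 - x) * H x `^ (1 - n).
have E1 x : 0 < x < 1 -> H^`(1)%classic x = u x.
  by move=> x01; rewrite derive1n1 derive1E; have [_ ->] := d1 x x01.
have D1 x : 0 < x < 1 -> is_derive x 1 (H^`(1)%classic) (w x).
  move=> x01; apply: (@near_eq_is_derive _ _ _ u); last exact: d2.
  by apply: (near_itvoo_eq x01) => y y01; rewrite E1.
have E2 x : 0 < x < 1 -> H^`(2)%classic x = w x.
  by move=> x01; rewrite derive1nS derive1E; have [_ ->] := D1 x x01.
have D2 x : 0 < x < 1 -> is_derive x 1 (H^`(2)%classic) (z x).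
  move=> x01; apply: (@near_eq_is_derive _ _ _ w); last exact: d3.
  by apply: (near_itvoo_eq x01) => y y01; rewrite E2.
have E3 x : 0 < x < 1 -> H^`(3)%classic x = z x.
  by move=> x01; rewrite derive1nS derive1E; have [_ ->] := D2 x x01.
split => //.
- split.
    exists u; split => // x; rewrite /= in_itv /= => /andP[x0 x1].
    have [->|xn0] := eqVneq x 0; first by rewrite u0.
    have [->|xn1] := eqVneq x 1; first by rewrite u1.
    by apply: is_derive_on_sub; apply: d1; rewrite !lt_neqAle eq_sym xn0 x0 xn1 x1.
  split.
    move=> [|[|[|//]]] x _; rewrite /= in_itv /= => x01.
    + by have [] := d1 x x01.
    + by have [] := D1 x x01.
    + by have [] := D2 x x01.
  apply/subspace_continuousP => x; rewrite /= in_itv /= => x01.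
  have zc : z y @[y --> x] --> z x.
    apply: cvgM.
      by apply: cvgN; apply: cvgB; [exact: cvg_cst|exact: cvg_id].
    exact: (derive_cont (der_powR (1 - n) (Hpos x x01) (d1 x x01))).
  have : H^`(3)%classic y @[y --> x] --> H^`(3)%classic x.
    rewrite [X in _ --> X]E3//; apply: cvg_trans zc; apply: near_eq_cvg.
    by apply: (near_itvoo_eq x01) => y y01; rewrite E3.
  exact: cvg_within_filter.
move=> x x01i; have x01 : 0 < x < 1 by move: x01i; rewrite in_itv.
rewrite E3// /z; have p := Hpos x x01.
rewrite mulrCA -powRD; last by apply/implyP => _; rewrite gt_eqF.
by rewrite (_ : n - 1 + (1 - n) = 0) ?powRr0; ring.
Qed.

End Derivatives.

(** * Uniqueness *)

Section Uniqueness.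
Context {R : realType}.
Implicit Types (x : R).

Lemma within01_near (f : R -> R) (x0 : R) : {within `[0, 1], continuous f} -> 0 <= x0 <= 1 ->
  forall eps, 0 < eps -> exists2 d, 0 < d &
    forall x, 0 <= x <= 1 -> `|x - x0| < d -> `|f x - f x0| <= eps.
Proof.
move=> /subspace_continuousP h x01 eps eps0.
have x0i : `[0, 1]%classic x0 by rewrite /= in_itv.
have /cvgrPdist_le /(_ _ eps0) [d /= d0 hd] := h x0 x0i.
exists d => // x xi xd; rewrite distrC; apply: hd; first by rewrite /= distrC.
by rewrite /= in_itv.
Qed.

Lemma bounded01 (f : R -> R) : {within `[0, 1], continuous f} ->
  exists2 C : R, 0 < C & forall x, 0 <= x <= 1 -> `|f x| <= C.
Proof.
move=> fc.
have [|c _ hc] := @EVT_max R (fun x => `|f x|) 0 1 ler01.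
  by move=> x; apply: cvg_norm; exact: fc.
exists (`|f c| + 1); first by rewrite ltr_pwDr.
by move=> x x01; apply: (le_trans (hc x _)); rewrite ?in_itv// lerDl.
Qed.

Lemma sub01_cont (f : R -> R) a b : {within `[0, 1], continuous f} -> 0 <= a -> b <= 1 ->
  {within `[a, b], continuous f}.
Proof.
move=> fc a0 b1; apply: continuous_subspaceW fc => y /=.
by rewrite !in_itv /= => /andP[h1 h2]; rewrite (le_trans a0 h1) (le_trans h2 b1).
Qed.

(** The slope z is concave with end values m and 0, so it lies above the chord (1 - x) m.
    Integration gives Z >= m (x - x^2/2), and x - x^2/2 >= x/2 on [0, 1]. *)
Lemma concave_slope_lower (Z z z1 z2 : R -> R) (m : R) :
  {within `[0, 1], continuous Z} -> {within `[0, 1], continuous z} ->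
  Z 0 = 0 -> z 0 = m -> z 1 = 0 -> 0 <= m ->
  (forall x, 0 < x < 1 -> is_derive x 1 Z (z x)) ->
  (forall x, 0 < x < 1 -> is_derive x 1 z (z1 x)) ->
  (forall x, 0 < x < 1 -> is_derive x 1 z1 (z2 x)) ->
  (forall x, 0 < x < 1 -> z2 x <= 0) ->
  forall x, 0 <= x <= 1 -> m * x / 2 <= Z x.
Proof.
move=> Zc zc Z0 z0 z1' m0 d1 d2 d3 neg x /andP[x0 x1].
have low y : 0 <= y <= 1 -> (1 - y) * m <= z y.
  move=> y01; have := concave_chord ltr01 y01 zc d2 d3 neg.
  by rewrite z0 z1' !subr0 mul1r mulr0 addr0.
have : Z 0 - m * (0 - 0 * 0 / 2) <= Z x - m * (x - x * x / 2).
  apply: (@ge0_derive_le _ (fun x => Z x - m * (x - x * x / 2)) (fun x => z x - m * (1 - x))) => //.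
  - move=> y; apply: cvgB; first exact: (sub01_cont Zc).
    have c : continuous (fun y : R => m * (y - y * y / 2)).
      move=> t; apply: (@derive_cont _ _ _ (m * (1 - t))).
      have -> : (fun y : R => m * (y - y * y / 2)) = (fun y => m * (y - 2^-1 * (y * y))).
        by apply/funext => s; rewrite [_ / 2]mulrC.
      by derive_auto; field.
    exact: (@continuous_subspaceT _ _ `[0, x]%classic _ c).
  - move=> y /andP[y0 yx].
    have -> : (fun y : R => Z y - m * (y - y * y / 2)) = (fun y => Z y - m * (y - 2^-1 * (y * y))).
      by apply/funext => s; rewrite [_ / 2]mulrC.
    have dZ0 : is_derive y 1 Z (z y) by apply: d1; rewrite y0 (lt_le_trans yx x1).
    by derive_auto; field.
  - move=> y /andP[y0 yx]; rewrite subr_ge0 mulrC; apply: low.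
    by rewrite (ltW y0) (le_trans (ltW yx) x1).
rewrite Z0 !mul0r !subr0 mulr0 subr0 subr_ge0; apply: le_trans.
have -> : m * (x - x * x / 2) = m * x / 2 + m * (x * (1 - x)) / 2 by field.
by rewrite lerDl divr_ge0// mulr_ge0// mulr_ge0// subr_ge0.
Qed.

Lemma slope_upper (Z z : R -> R) (C : R) : {within `[0, 1], continuous Z} -> Z 0 = 0 ->
  (forall x, 0 < x < 1 -> is_derive x 1 Z (z x)) ->
  forall x, 0 <= x <= 1 -> (forall y, 0 < y < x -> `|z y| <= C) -> `|Z x| <= C * x.
Proof.
move=> Zc Z0 d1 x /andP[x0 x1] hC.
have zC := sub01_cont Zc (lexx 0) x1.
have cC : {within `[0, x], continuous (fun y : R => C * y)}.
  by apply: continuous_subspaceT => t; apply: cvgMr; exact: cvg_id.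
have dy y : 0 < y < x -> is_derive y 1 Z (z y).
  by move=> /andP[y0 yx]; apply: d1; rewrite y0 (lt_le_trans yx x1).
rewrite ler_norml; apply/andP; split.
- have : C * 0 + Z 0 <= C * x + Z x.
    apply: (@ge0_derive_le _ (fun y => C * y + Z y) (fun y => C * 1 + z y)) => //.
    + by move=> y; apply: cvgD; [exact: cC|exact: zC].
    + by move=> y yx; exact: der_add (der_scale C (der_id y)) (dy y yx).
    + by move=> y /hC; rewrite ler_norml => /andP[h _]; rewrite mulr1 -lerBlDl sub0r.
  by rewrite Z0 mulr0 addr0 -lerBlDl sub0r.
- have : C * 0 - Z 0 <= C * x - Z x.
    apply: (@ge0_derive_le _ (fun y => C * y - Z y) (fun y => C * 1 - z y)) => //.
    + by move=> y; apply: cvgB; [exact: cC|exact: zC].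
    + by move=> y yx; exact: der_add (der_scale C (der_id y)) (der_opp (dy y yx)).
    + by move=> y /hC; rewrite ler_norml => /andP[_ h]; rewrite mulr1 subr_ge0.
  by rewrite Z0 mulr0 subr0 subr_ge0.
Qed.

Section Facts.
Variables (n theta : R) (H u w : R -> R).
Hypothesis theta_gt0 : 0 < theta.
Hypothesis P : profile n theta H u w.

Lemma profile_lower x : 0 <= x <= 1 -> theta * x / 2 <= H x.
Proof.
move: P => [[Hc uc H0 u0 u1] Hpos d1 d2 d3].
apply: (concave_slope_lower Hc uc H0 u0 u1 (ltW theta_gt0) d1 d2 d3) => y /andP[y0 y1].
by rewrite mulNr oppr_le0 mulr_ge0 ?powR_ge0// subr_ge0 ltW.
Qed.

Lemma profile_upper : exists2 C : R, 0 < C & forall x, 0 <= x <= 1 -> H x <= C * x.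
Proof.
move: P => [[Hc uc H0 u0 u1] Hpos d1 d2 d3].
have [C C0 hC] := bounded01 uc; exists C => // x x01.
apply: (le_trans (ler_norm _)); apply: (slope_upper Hc H0 d1) => // y /andP[y0 yx].
by apply: hC; rewrite (ltW y0) (le_trans (ltW yx))//; case/andP: x01.
Qed.

Lemma profile_ge0 x : 0 <= x <= 1 -> 0 <= H x.
Proof.
move=> x01; apply: (le_trans _ (profile_lower x01)); case/andP: x01 => x0 _.
by rewrite divr_ge0// mulr_ge0// ltW.
Qed.

End Facts.

(* For n <= 1 the nonlinearity h^(1 - n) is sublinear: enlarge the largest t
   with t H2 <= H1 until it reaches 1. *)
Lemma profile_le_sublinear (n theta : R) (H1 u1 w1 H2 u2 w2 : R -> R) :
  0 < n -> n <= 1 -> 0 < theta ->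
  profile n theta H1 u1 w1 -> profile n theta H2 u2 w2 ->
  forall x, 0 <= x <= 1 -> H2 x <= H1 x.
Proof.
move=> n0 n1 th0 P1 P2.
pose S := [set s : R | 0 <= s <= 1 /\ forall x, 0 <= x <= 1 -> s * H2 x <= H1 x].
have S0 : S 0.
  by split; [rewrite lexx ler01|move=> x x01; rewrite mul0r; exact: (profile_ge0 th0 P1)].
have Sb : has_ubound S by exists 1 => s [/andP[_ ?] _].
have Ssup : has_sup S by split => //; exists 0.
pose t := sup S.
have t0 : 0 <= t by exact: ub_le_sup.
have t1 : t <= 1 by apply: sup_le_ub; [exists 0|move=> s [/andP[_ ?] _]].
have [C C0 hC] := profile_upper P2.
(* The supremum belongs to S because the defining inequalities are closed in s. *)
have St : S t.
  split; first by rewrite t0 t1.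
  move=> x x01; apply/ler_addgt0Pr => eps eps0.
  have h2 : 0 <= H2 x := profile_ge0 th0 P2 x01.
  have K0 : 0 < H2 x + 1 by rewrite ltr_pwDr.
  have [s [_ hs] ts] := @sup_adherent R S (eps / (H2 x + 1)) (divr_gt0 eps0 K0) Ssup.
  have h3 : (t - eps / (H2 x + 1)) * H2 x <= s * H2 x by apply: ler_wpM2r => //; exact: ltW.
  have h4 : eps / (H2 x + 1) * H2 x <= eps.
    rewrite -mulrA ler_piMr ?(ltW eps0)// ler_pdivrMl// mulr1; lra.
  have := hs x x01; rewrite mulrBl in h3; lra.
have [t_lt1|] := ltP t 1; last first.
  by move=> t1' x x01; have [_ /(_ x x01)] := St; rewrite (le_anti (_ : t <= 1 <= t)) ?t1 ?t1'// mul1r.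
exfalso.
have [_ ht] := St.
have [[Hc1 uc1 H01 u01 u11] Hp1 d11 d12 d13] := P1.
have [[Hc2 uc2 H02 u02 u12] Hp2 d21 d22 d23] := P2.
(* H1^(1 - n) >= (t H2)^(1 - n) = t^(1 - n) H2^(1 - n) >= t H2^(1 - n), because 0 <= 1 - n <= 1 and
   t <= 1. So the third derivative of H1 - t H2 is nonpositive, while its slope at 0 is (1 - t)
   theta > 0. *)
have Zlow x : 0 <= x <= 1 -> (1 - t) * theta * x / 2 <= H1 x - t * H2 x.
  apply: (@concave_slope_lower (fun x => H1 x - t * H2 x) (fun x => u1 x - t * u2 x)
    (fun x => w1 x - t * w2 x)
    (fun x => - (1 - x) * H1 x `^ (1 - n) - t * (- (1 - x) * H2 x `^ (1 - n)))).
  - by move=> y; apply: cvgB; [exact: Hc1|apply: cvgMr; exact: Hc2].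
  - by move=> y; apply: cvgB; [exact: uc1|apply: cvgMr; exact: uc2].
  - by rewrite H01 H02 mulr0 subr0.
  - by rewrite u01 u02; ring.
  - by rewrite u11 u12 mulr0 subr0.
  - by rewrite mulr_ge0 ?(ltW th0)// subr_ge0.
  - by move=> y y01; exact: der_add (d11 y y01) (der_opp (der_scale t (d21 y y01))).
  - by move=> y y01; exact: der_add (d12 y y01) (der_opp (der_scale t (d22 y y01))).
  - by move=> y y01; exact: der_add (d13 y y01) (der_opp (der_scale t (d23 y y01))).
  - move=> y y01; have /andP[y0 y1] := y01.
    have -> : - (1 - y) * H1 y `^ (1 - n) - t * (- (1 - y) * H2 y `^ (1 - n)) =
      - ((1 - y) * (H1 y `^ (1 - n) - t * H2 y `^ (1 - n))) by ring.
    rewrite oppr_le0 mulr_ge0 ?subr_ge0 ?(ltW y1)//.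
    have y01' : 0 <= y <= 1 by rewrite (ltW y0) (ltW y1).
    have h2 := ltW (Hp2 y y01); have h1 := ltW (Hp1 y y01).
    apply: (@le_trans _ _ ((t * H2 y) `^ (1 - n))); last first.
      by apply: ge0_ler_powR; rewrite ?nnegrE ?subr_ge0 ?mulr_ge0//; exact: ht.
    rewrite powRM//; apply: ler_wpM2r; first exact: powR_ge0.
    move: (t0); rewrite le_eqVlt => /predU1P[<-|tpos]; first exact: powR_ge0.
    by apply: ger1_powR; [rewrite tpos t1|rewrite gerBl ltW].
(* With H2 <= C x, this increment of t costs at most dl C x = (1 - t) theta x/2, exactly the gap
   available from [Zlow]. *)
pose dl := (1 - t) * theta / (2 * C).
have dl0 : 0 < dl by rewrite divr_gt0 ?mulr_gt0// subr_gt0.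
pose s := Num.min (t + dl) 1.
have Ss : S s.
  split.
    by rewrite /s le_min ge_min lexx orbT ler01 addr_ge0// ltW.
  move=> x x01.
  apply: (@le_trans _ _ ((t + dl) * H2 x)).
    by apply: ler_wpM2r; [exact: (profile_ge0 th0 P2)|rewrite ge_min lexx].
  have h := Zlow x x01; rewrite mulrDl.
  have : dl * H2 x <= (1 - t) * theta * x / 2.
    apply: (@le_trans _ _ (dl * (C * x))); first by apply: ler_wpM2l; [exact: ltW|exact: hC].
    by rewrite le_eqVlt /dl; apply/orP; left; apply/eqP; field; rewrite gt_eqF.
  lra.
have : s <= t by exact: ub_le_sup.
by rewrite /s ge_min !leNgt t_lt1 ltrDl dl0.
Qed.

End Uniqueness.

Section UniquenessSuperlinear.
Context {R : realType}.
Implicit Types (x : R).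

(* For n >= 1 the right-hand side is monotone in H, so that
   E = (1 - x)(W W'' - W'^2 / 2) + W W', for the difference W of two solutions,
   is nondecreasing; it vanishes at both ends. *)
Lemma profile_unique_superlinear (n theta : R) (H1 u1 w1 H2 u2 w2 : R -> R) :
  1 <= n -> n < 3 -> 0 < theta ->
  profile n theta H1 u1 w1 -> profile n theta H2 u2 w2 ->
  forall x, 0 <= x <= 1 -> H1 x = H2 x.
Proof.
move=> n1 n3 th0 P1 P2.
have [[Hc1 uc1 H01 u01 u11] Hp1 d11 d12 d13] := P1.
have [[Hc2 uc2 H02 u02 u12] Hp2 d21 d22 d23] := P2.
pose W x := H1 x - H2 x; pose w x := u1 x - u2 x; pose v x := w1 x - w2 x.
pose z x := - (1 - x) * (H1 x `^ (1 - n) - H2 x `^ (1 - n)).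
have dW x : 0 < x < 1 -> is_derive x 1 W (w x).
  by move=> x01; exact: der_add (d11 x x01) (der_opp (d21 x x01)).
have dw x : 0 < x < 1 -> is_derive x 1 w (v x).
  by move=> x01; exact: der_add (d12 x x01) (der_opp (d22 x x01)).
have dv x : 0 < x < 1 -> is_derive x 1 v (z x).
  move=> x01; apply: (is_derive_eq (der_add (d13 x x01) (der_opp (d23 x x01)))).
  by rewrite /z mulrBr.
have Wc : {within `[0, 1], continuous W} by move=> y; apply: cvgB; [exact: Hc1|exact: Hc2].
have wc : {within `[0, 1], continuous w} by move=> y; apply: cvgB; [exact: uc1|exact: uc2].
have W0 : W 0 = 0 by rewrite /W H01 H02 subrr.
have w0 : w 0 = 0 by rewrite /w u01 u02 subrr.
have w1' : w 1 = 0 by rewrite /w u11 u12 subrr.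
pose E x := (1 - x) * (W x * v x - w x * w x / 2) + W x * w x.
have dE x : 0 < x < 1 -> is_derive x 1 E ((1 - x) * (W x * z x) + 3 / 2 * (w x * w x)).
  move=> x01; have hW := dW x x01; have hw := dw x x01; have hv := dv x x01.
  have -> : E = (fun x => (1 - x) * (W x * v x - 2^-1 * (w x * w x)) + W x * w x).
    by apply/funext => s; rewrite /E [_ / 2]mulrC.
  by derive_auto; field.
have E'0 x : 0 < x < 1 -> 0 <= (1 - x) * (W x * z x).
  move=> x01; have /andP[x0 x1] := x01.
  rewrite /z mulNr mulrN mulrN -mulrN.
  have -> : (1 - x) * - (W x * ((1 - x) * (H1 x `^ (1 - n) - H2 x `^ (1 - n)))) =
    (1 - x) ^+ 2 * - (W x * (H1 x `^ (1 - n) - H2 x `^ (1 - n))) by ring.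
  apply: mulr_ge0; first exact: sqr_ge0.
  have h1 := Hp1 x x01; have h2 := Hp2 x x01.
  have n1' : 1 - n <= 0 by rewrite subr_le0.
  rewrite -mulrN opprB /W; case: (lerP (H1 x) (H2 x)) => h.
    by rewrite -mulrNN !opprB mulr_ge0// subr_ge0//; exact: powR_le_neg.
  by rewrite mulr_ge0// subr_ge0 ?(ltW h)//; apply: powR_le_neg => //; exact: ltW.
have Emono x y : 0 < x -> x <= y -> y < 1 -> E x <= E y.
  move=> x0 xy y1.
  apply: (@ge0_derive_le_cc _ E (fun x => (1 - x) * (W x * z x) + 3 / 2 * (w x * w x)) _ _ xy).
    by move=> s /andP[xs sy]; apply: dE; rewrite (lt_le_trans x0 xs) (le_lt_trans sy y1).
  move=> s /andP[xs sy]; apply: addr_ge0.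
    by apply: E'0; rewrite (lt_le_trans x0 xs) (le_lt_trans sy y1).
  by rewrite mulr_ge0// -expr2 sqr_ge0.
have [Bw Bw0 hBw] := bounded01 wc; have [BW BW0 hBW] := bounded01 Wc.
pose C := 2 * (theta / 2) `^ (1 - n).
have C0 : 0 <= C by rewrite mulr_ge0// powR_ge0.
have zle x : 0 < x < 1 -> `|z x| <= C * x `^ (1 - n).
  move=> x01; have /andP[x0 x1] := x01.
  have x01' : 0 <= x <= 1 by rewrite (ltW x0) (ltW x1).
  have tx : 0 < theta / 2 * x by rewrite mulr_gt0// divr_gt0.
  have hh (H : R) : theta * x / 2 <= H -> `|H `^ (1 - n)| <= (theta / 2) `^ (1 - n) * x `^ (1 - n).
    move=> hH; rewrite ger0_norm ?powR_ge0// -powRM ?(ltW x0)//; last by rewrite divr_ge0// ltW.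
    have hH' : theta / 2 * x <= H by rewrite mulrAC.
    by apply: powR_le_neg; rewrite ?subr_le0.
  have a1 := hh _ (profile_lower th0 P1 x01'); have a2 := hh _ (profile_lower th0 P2 x01').
  have nz : `|1 - x| = 1 - x by rewrite ger0_norm// subr_ge0 ltW.
  rewrite /z normrM normrN nz.
  apply: (@le_trans _ _ (1 * `|H1 x `^ (1 - n) - H2 x `^ (1 - n)|)).
    by apply: ler_wpM2r => //; rewrite gerBl ltW.
  rewrite mul1r; apply: (le_trans (ler_normB _ _)).
  by rewrite /C -mulrA; clear -a1 a2; lra.
have b0 : 0 < 3 - n by rewrite subr_gt0.
(* (x W'' - W')' = x W''' is bounded by C x^(2 - n), which is integrable at 0 because n < 3; [p] is
   its primitive. So x W'' stays bounded although W'' itself need not. *)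
have xw_bound : exists2 B, 0 < B & forall x, 0 < x <= 2^-1 -> `|x * v x| <= B.
  pose q x := x * v x - w x; pose p x := C / (3 - n) * x `^ (3 - n).
  have dq x : 0 < x < 1 -> is_derive x 1 q (x * z x).
    move=> x01; have hw := dw x x01; have hv := dv x x01.
    by rewrite /q; derive_auto; ring.
  have dp x : 0 < x < 1 -> is_derive x 1 p (C * (x `^ (1 - n) * x)).
    move=> /andP[x0 _]; apply: (is_derive_eq (der_scale (C / (3 - n)) (is_derive1_powR (3 - n) x0))).
    have -> : 3 - n - 1 = 1 - n + 1 by ring.
    rewrite powRD; last by apply/implyP => _; rewrite gt_eqF.
    by rewrite powRr1 ?(ltW x0)//; field; rewrite gt_eqF.
  have p0 x : 0 <= p x by rewrite mulr_ge0 ?powR_ge0// divr_ge0// ltW.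
  have xz x : 0 < x < 1 -> `|x * z x| <= C * (x `^ (1 - n) * x).
    move=> x01; have /andP[x0 _] := x01; rewrite normrM gtr0_norm// mulrC mulrA.
    by apply: ler_wpM2r; [exact: ltW|exact: zle].
  have lt1 x : 0 < x <= 2^-1 -> forall s, x <= s <= 2^-1 -> 0 < s < 1.
    by move=> /andP[x0 _] s /andP[xs s2]; rewrite (lt_le_trans x0 xs)/=; clear -s2; lra.
  exists (`|q 2^-1| + p 2^-1 + Bw); first by rewrite ltr_wpDl// addr_ge0.
  move=> x xh; have /andP[x0 x2] := xh.
  have up : q x + p x <= q 2^-1 + p 2^-1.
    apply: (@ge0_derive_le_cc _ (fun x => q x + p x) (fun x => x * z x + C * (x `^ (1 - n) * x))) => //.
      by move=> s /(lt1 x xh) s01; exact: der_add (dq s s01) (dp s s01).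
    by move=> s /(lt1 x xh)/xz; rewrite ler_norml => /andP[h _]; rewrite -lerBlDr sub0r.
  have dn : q 2^-1 - p 2^-1 <= q x - p x.
    apply: (@le0_derive_ge_cc _ (fun x => q x - p x) (fun x => x * z x - C * (x `^ (1 - n) * x))) => //.
      by move=> s /(lt1 x xh) s01; exact: der_add (dq s s01) (der_opp (dp s s01)).
    by move=> s /(lt1 x xh)/xz; rewrite ler_norml => /andP[_ h]; rewrite subr_le0.
  have -> : x * v x = q x + w x by rewrite /q subrK.
  apply: (le_trans (ler_normD _ _)); apply: lerD; last by apply: hBw; rewrite (ltW x0); clear -x2; lra.
  have := p0 x; have := ler_norm (q 2^-1); have := ler_norm (- q 2^-1); rewrite normrN => k1 k2 k3.
  by rewrite ler_norml; apply/andP; split; clear -up dn k1 k2 k3; lra.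
(* E(x0) >= E(x) for x near 0. Since W'(0) = 0, one has |W| <= dl x there with dl as small as
   wanted; together with the bound on x W'' this sends W W'' to 0. *)
have E0 x0 : 0 < x0 < 1 -> 0 <= E x0.
  move=> /andP[x00 x01]; rewrite -oppr_le0; apply/ler_addgt0Pr => eps eps0; rewrite add0r.
  have [B B0 hB] := xw_bound.
  pose dl := Num.min 1 (eps / (B + 2)).
  have dl0 : 0 < dl by rewrite lt_min ltr01 divr_gt0// addr_gt0.
  have z01 : 0 <= (0 : R) <= 1 by rewrite lexx ler01.
  have [d d0 hd] := within01_near wc z01 dl0.
  pose x := Num.min (d / 2) (Num.min x0 2^-1).
  have xpos : 0 < x by rewrite !lt_min divr_gt0// x00 invr_gt0 ltr0n.
  have xd : x < d by rewrite (le_lt_trans (_ : _ <= d / 2))// ?ge_min ?lexx//; clear -d0; lra.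
  have xx0 : x <= x0 by rewrite !ge_min lexx orbT.
  have x2 : x <= 2^-1 by rewrite !ge_min lexx !orbT.
  have x1 : x < 1 by clear -x2; lra.
  have hw y : 0 <= y <= x -> `|w y| <= dl.
    move=> /andP[y0 yx]; have := hd y; rewrite w0 !subr0; apply.
      by rewrite y0; clear -yx x1; lra.
    by rewrite ger0_norm// (le_lt_trans yx).
  have hW : `|W x| <= dl * x.
    apply: (slope_upper Wc W0 dW); first by rewrite (ltW xpos) ltW.
    by move=> y /andP[y0 yx]; apply: hw; rewrite !ltW.
  apply: (le_trans (_ : - E x0 <= - E x)); first by rewrite lerN2; exact: Emono.
  apply: (le_trans (ler_norm _)); rewrite normrN /E.
  have hwx : `|w x| <= dl by apply: hw; rewrite (ltW xpos) lexx.
  have dl1 : dl <= 1 by rewrite ge_min lexx.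
  have ww : `|w x * w x| <= dl.
    rewrite normrM; apply: (@le_trans _ _ (dl * 1)); last by rewrite mulr1.
    by apply: ler_pM => //; exact: le_trans dl1.
  have Ww : `|W x * w x| <= dl.
    rewrite normrM; apply: (@le_trans _ _ (1 * dl)); last by rewrite mul1r.
    apply: ler_pM => //; apply: (le_trans hW); rewrite -[leRHS]mulr1.
    by apply: ler_pM => //; exact: ltW.
  have Wv : `|W x * v x| <= dl * B.
    rewrite normrM; apply: (@le_trans _ _ (dl * x * `|v x|)); first exact: ler_wpM2r.
    rewrite -mulrA; apply: ler_wpM2l; first exact: ltW.
    by rewrite -{1}(gtr0_norm xpos) -normrM; apply: hB; rewrite xpos.
  apply: (le_trans (ler_normD _ _)).
  have h3 : `|(1 - x) * (W x * v x - w x * w x / 2)| <= dl * B + dl.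
    have nz : `|1 - x| = 1 - x by rewrite ger0_norm// subr_ge0 ltW.
    rewrite normrM nz.
    apply: (@le_trans _ _ (1 * (dl * B + dl))); last by rewrite mul1r.
    apply: ler_pM => //; [by rewrite subr_ge0 ltW|by rewrite gerBl ltW|].
    apply: (le_trans (ler_normB _ _)); apply: lerD => //.
    rewrite normrM (ger0_norm (_ : 0 <= 2^-1))//.
    by apply: (le_trans _ ww); rewrite ler_piMr// invf_le1// ler1n.
  have h4 : dl * (B + 2) <= eps.
    by rewrite -ler_pdivlMr ?addr_gt0// ge_min lexx orbT.
  by apply: (le_trans (lerD h3 Ww)); apply: (le_trans _ h4); rewrite mulrDr; clear -dl B; lra.
have v_bound : exists2 B, 0 < B & forall x, 2^-1 <= x < 1 -> `|v x| <= B.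
  pose K := C * 2^-1 `^ (1 - n).
  have K0 : 0 <= K by rewrite mulr_ge0// powR_ge0.
  have zK s : 2^-1 <= s < 1 -> `|z s| <= K.
    move=> /andP[s2 s1]; have s0 : 0 < s by clear -s2; lra.
    apply: (le_trans (zle s _)); first by rewrite s0.
    by apply: ler_wpM2l => //; apply: powR_le_neg; rewrite ?subr_le0// invr_gt0.
  exists (`|v 2^-1| + K + 1); first by rewrite ltr_wpDl// addr_ge0.
  move=> x /andP[x2 x1].
  have in1 s : 2^-1 <= s <= x -> 2^-1 <= s < 1 /\ 0 < s < 1.
    move=> /andP[a b]; split; [rewrite a /=|apply/andP; split]; clear -a b x1; lra.
  have up : v x - K * x <= v 2^-1 - K * 2^-1.
    apply: (@le0_derive_ge_cc _ (fun x => v x - K * x) (fun x => z x - K * 1)) => //.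
      by move=> s /in1[_ s01]; exact: der_add (dv s s01) (der_opp (der_scale K (der_id s))).
    by move=> s /in1[/zK + _]; rewrite ler_norml mulr1 subr_le0 => /andP[].
  have dn : v 2^-1 + K * 2^-1 <= v x + K * x.
    apply: (@ge0_derive_le_cc _ (fun x => v x + K * x) (fun x => z x + K * 1)) => //.
      by move=> s /in1[_ s01]; exact: der_add (dv s s01) (der_scale K (der_id s)).
    by move=> s /in1[/zK + _]; rewrite ler_norml mulr1 => /andP[h _]; rewrite -lerBlDr sub0r.
  have Kx : K * x <= K by rewrite ler_piMr// ltW.
  have K2 : 0 <= K * 2^-1 by rewrite mulr_ge0.
  have := ler_norm (v 2^-1); have := ler_norm (- v 2^-1); rewrite normrN => k1 k2.
  by rewrite ler_norml; apply/andP; split; clear -up dn Kx K2 k1 k2; lra.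
(* E(x0) <= E(x) for x near 1. There W'' is bounded, so the factor 1 - x disposes of the first term,
   and W'(1) = 0 of the second. *)
have E1 x0 : 0 < x0 < 1 -> E x0 <= 0.
  move=> /andP[x00 x01]; apply/ler_addgt0Pr => eps eps0; rewrite add0r.
  have [B B0 hB] := v_bound.
  have M0 : 0 < BW * B + Bw * Bw by rewrite addr_gt0// mulr_gt0.
  have dl0 : 0 < eps / 2 / BW by rewrite !divr_gt0.
  have z01 : 0 <= (1 : R) <= 1 by rewrite lexx ler01.
  have [d d0 hd] := within01_near wc z01 dl0.
  pose m := Num.min (d / 2) (Num.min (1 - x0) (Num.min 2^-1 (eps / 2 / (BW * B + Bw * Bw)))).
  have m0 : 0 < m by rewrite !lt_min divr_gt0// subr_gt0 x01 invr_gt0 ltr0n !divr_gt0.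
  have md : m < d by rewrite (le_lt_trans (_ : _ <= d / 2))// ?ge_min ?lexx//; clear -d0; lra.
  have mx : m <= 1 - x0 by rewrite !ge_min lexx orbT.
  have m2 : m <= 2^-1 by rewrite !ge_min lexx !orbT.
  have mM : m <= eps / 2 / (BW * B + Bw * Bw) by rewrite !ge_min lexx !orbT.
  pose x := 1 - m.
  have x1 : x < 1 by rewrite gtrBl.
  have x2 : 2^-1 <= x by rewrite /x; clear -m2; lra.
  have x01' : 0 <= x <= 1 by apply/andP; split; clear -x1 x2; lra.
  have hw : `|w x| <= eps / 2 / BW.
    have := hd x x01'; rewrite w1' subr0; apply.
    by rewrite /x addrAC subrr add0r normrN gtr0_norm.
  apply: (le_trans (_ : E x0 <= E x)); first by apply: Emono => //; rewrite /x; clear -mx; lra.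
  apply: (le_trans (ler_norm _)); apply: (le_trans (ler_normD _ _)).
  have Ww : `|W x * w x| <= eps / 2.
    rewrite normrM; apply: (@le_trans _ _ (BW * (eps / 2 / BW))).
      by apply: ler_pM => //; exact: hBW.
    by rewrite mulrC divfK// gt_eqF.
  have h3 : `|(1 - x) * (W x * v x - w x * w x / 2)| <= eps / 2.
    rewrite normrM (_ : 1 - x = m); last by rewrite /x; ring.
    rewrite gtr0_norm// mulrC -ler_pdivlMr//.
    apply: (@le_trans _ _ (BW * B + Bw * Bw)); last first.
      by rewrite ler_pdivlMr// mulrC -ler_pdivlMr.
    apply: (le_trans (ler_normB _ _)); apply: lerD.
      by rewrite normrM; apply: ler_pM => //; [exact: hBW|apply: hB; rewrite x2].
    rewrite normrM (ger0_norm (_ : 0 <= 2^-1))//.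
    apply: (@le_trans _ _ `|w x * w x|); first by rewrite ler_piMr// invf_le1// ler1n.
    by rewrite normrM; apply: ler_pM => //; exact: hBw.
  by apply: (le_trans (lerD h3 Ww)); rewrite -splitr.
(* E vanishes identically, hence so does E', a sum of two nonnegative terms one of which is 3/2
   W'^2. *)
have w_0 x : 0 < x < 1 -> w x = 0.
  move=> x01.
  have Ez : is_derive x 1 E 0.
    apply: (@near_eq_is_derive _ _ _ (fun _ : R => (0 : R))).
    by apply: (near_itvoo_eq x01) => y y01; apply/esym/eqP; rewrite eq_le E0// E1.
  have := derive_unique (dE x x01) Ez; have := E'0 x x01; have := sqr_ge0 (w x).
  rewrite expr2 => a b c; apply/eqP; rewrite -sqrf_eq0 expr2; apply/eqP; clear -a b c; lra.
move=> x /andP[x0 x1]; apply/eqP; rewrite -subr_eq0 -normr_le0 -(mul0r x).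
apply: (slope_upper Wc W0 dW); first by rewrite x0.
by move=> y /andP[y0 yx]; rewrite w_0 ?normr0// y0 (lt_le_trans yx).
Qed.

Lemma profile_unique (n theta : R) (H1 u1 w1 H2 u2 w2 : R -> R) :
  0 < n -> n < 3 -> 0 < theta ->
  profile n theta H1 u1 w1 -> profile n theta H2 u2 w2 ->
  forall x, 0 <= x <= 1 -> H1 x = H2 x.
Proof.
move=> n0 n3 th0 P1 P2; have [n1|/ltW n1] := lerP n 1; last first.
  exact: (profile_unique_superlinear n1 n3 th0 P1 P2).
move=> x x01; apply/eqP; rewrite eq_le.
by rewrite (profile_le_sublinear n0 n1 th0 P1 P2 x01) (profile_le_sublinear n0 n1 th0 P2 P1 x01).
Qed.

End UniquenessSuperlinear.

(** * Shooting *)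

Section Cutoff.
Context {R : realType}.
Implicit Types (x h k : R).

Lemma powR_lipschitz (e m p q : R) : e <= 1 -> 0 < m -> m <= p -> m <= q ->
  `|p `^ e - q `^ e| <= `|e| * m `^ (e - 1) * `|p - q|.
Proof.
move=> e1 m0.
wlog pq : p q / p < q.
  move=> H mp mq; have [pq|pq|->] := ltgtP p q; first exact: H.
    by rewrite distrC (distrC p); exact: H.
  by rewrite !subrr normr0 mulr0.
move=> mp mq.
have d x : p <= x <= q -> is_derive x 1 (fun x : R => x `^ e) (e * x `^ (e - 1)).
  by move=> /andP[px _]; apply: is_derive1_powR; apply: lt_le_trans px; exact: lt_le_trans mp.
have [c] : exists2 c, c \in `]p, q[ & q `^ e - p `^ e = (e * c `^ (e - 1)) * (q - p).
  apply: (MVT pq (f := fun x : R => x `^ e)) => [x|].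
    by rewrite in_itv /= => /andP[/ltW a /ltW b]; apply: d; rewrite a b.
  exact: within_cont d.
rewrite in_itv /= => /andP[pc cq] E; rewrite distrC (distrC p) E normrM; apply: ler_wpM2r => //.
rewrite normrM; apply: ler_wpM2l => //; rewrite ger0_norm ?powR_ge0//.
by apply: powR_le_neg => //; [rewrite subr_le0|exact: le_trans mp (ltW pc)].
Qed.

Lemma max_lipschitz (c h k : R) : `|Num.max h c - Num.max k c| <= `|h - k|.
Proof.
wlog hk : h k / h <= k.
  move=> H; have /orP[hk|hk] := le_total h k; first exact: H.
  by rewrite distrC (distrC h); exact: H.
rewrite distrC (distrC h) !ger0_norm ?subr_ge0//; last by rewrite ge_max le_max hk/= le_max lexx orbT.
case: (lerP h c) => hc; case: (lerP k c) => kc; rewrite ?subrr ?subr_ge0//; lra.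
Qed.

Variables (n theta X : R).
Hypothesis n_gt0 : 0 < n.
Hypothesis theta_gt0 : 0 < theta.
Hypothesis X_gt0 : 0 < X.

(** Replacing x by max(x, X/4) keeps the floor at least theta X/8 on the whole line, so that the
    power of it has a global Lipschitz constant. The solutions are used only where x >= X/4. *)
Definition cutoff x h : R := Num.max h (theta * Num.max x (X / 4) / 2).

(* The right-hand side of the equation, made globally Lipschitz in h by the
   lower bound h >= theta x / 2 that concavity gives for solutions. *)
Definition rhs x h : R := - clamp 0 1 (1 - x) * cutoff x h `^ (1 - n).

Lemma cutoff_gt0 x h : theta * X / 8 <= cutoff x h.
Proof.
rewrite /cutoff le_max; apply/orP; right.
have -> : theta * X / 8 = theta * (X / 4) / 2 by field.
by rewrite !ler_pM2r// ler_pM2l// le_max lexx orbT.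
Qed.

Let m_gt0 : 0 < theta * X / 8. Proof. by rewrite divr_gt0// mulr_gt0. Qed.

Lemma rhs_le0 x h : rhs x h <= 0.
Proof.
rewrite /rhs mulNr oppr_le0 mulr_ge0 ?powR_ge0//.
by have /andP[] := @clamp_itv R 0 1 (1 - x) ler01.
Qed.

Lemma rhs_lipschitz : exists2 L, 0 <= L & forall x h k, `|rhs x h - rhs x k| <= L * `|h - k|.
Proof.
exists (`|1 - n| * (theta * X / 8) `^ (1 - n - 1)); first by rewrite mulr_ge0// powR_ge0.
move=> x h k; rewrite /rhs -mulrBr normrM normrN.
have /andP[c0 c1] := @clamp_itv R 0 1 (1 - x) ler01.
rewrite (ger0_norm c0).
apply: (@le_trans _ _ (1 * (`|1 - n| * (theta * X / 8) `^ (1 - n - 1) * `|h - k|))); last by rewrite mul1r.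
apply: ler_pM => //.
have n1 : 1 - n <= 1 by rewrite gerBl ltW.
apply: (le_trans (powR_lipschitz n1 m_gt0 (cutoff_gt0 x h) (cutoff_gt0 x k))).
apply: ler_wpM2l; first by rewrite mulr_ge0// powR_ge0.
exact: max_lipschitz.
Qed.

Lemma rhs_continuous (y : R -> R) : continuous y -> continuous (fun x => rhs x (y x)).
Proof.
move=> yc x; apply: cvgM.
  apply: cvgN; apply: (@continuous_comp _ _ _ (fun x => 1 - x) (clamp 0 1)).
    by apply: cvgB; [exact: cvg_cst|exact: cvg_id].
  exact: continuous_clamp.
apply: (@continuous_comp _ _ _ (fun x => cutoff x (y x)) (fun p => p `^ (1 - n))); last first.
  by apply: derive_cont (is_derive1_powR _ _); apply: lt_le_trans (cutoff_gt0 _ _).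
rewrite /cutoff.
have E t : Num.max (y t) (theta * Num.max t (X / 4) / 2) =
    theta / 2 * Num.max t (X / 4) + Num.max (y t - theta / 2 * Num.max t (X / 4)) 0.
  rewrite (_ : theta * Num.max t (X / 4) / 2 = theta / 2 * Num.max t (X / 4)); last by ring.
  by rewrite addr_maxr addr0 addrC subrK.
have -> : (fun t => Num.max (y t) (theta * Num.max t (X / 4) / 2)) =
  (fun t => theta / 2 * Num.max t (X / 4) + Num.max (y t - theta / 2 * Num.max t (X / 4)) 0).
  by apply/funext.
have mc : {for x, continuous (fun t => theta / 2 * Num.max t (X / 4))}.
  by apply: cvgMr; exact: continuous_maxr.
apply: cvgD; first exact: mc.
apply: (@continuous_comp _ _ _ (fun t => y t - theta / 2 * Num.max t (X / 4)) (fun p => Num.max p 0)).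
  by apply: cvgB; [exact: yc|exact: mc].
exact: continuous_maxr.
Qed.

Lemma rhsE x h : X / 4 <= x -> x <= 1 -> 0 <= x -> theta * x / 2 <= h ->
  rhs x h = - (1 - x) * h `^ (1 - n).
Proof.
move=> Xx x1 x0 hx; rewrite /rhs clamp_id; last by apply/andP; split; lra.
by rewrite /cutoff (max_l Xx) max_l.
Qed.

Variables (s : R) (z0 z1 z2 : R -> R).
Hypothesis s_itv : X / 4 <= s <= 2^-1.
Hypothesis s_gt0 : 0 < s.
Hypothesis dz0 : forall x, s <= x <= 1 -> is_derive x 1 z0 (z1 x).
Hypothesis dz1 : forall x, s <= x <= 1 -> is_derive x 1 z1 (z2 x).
Hypothesis dz2 : forall x, s <= x <= 1 -> is_derive x 1 z2 (rhs x (z0 x)).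

Let sub x y : s <= y <= x -> x <= 1 -> s <= y <= 1.
Proof. by move=> /andP[sy yx] x1; rewrite sy (le_trans yx). Qed.

Let sh : s <= 2^-1. Proof. by case/andP: s_itv. Qed.

Lemma z2_le x : s <= x <= 1 -> z2 x <= z2 s.
Proof.
move=> /andP[sx x1]; apply: (@le0_derive_ge_cc _ z2 (fun x => rhs x (z0 x))) => //.
  by move=> y /sub /(_ x1); exact: dz2.
by move=> y _; exact: rhs_le0.
Qed.

Lemma z1_le x : s <= x <= 1 -> z1 x <= z1 s + z2 s * (x - s).
Proof.
move=> /andP[sx x1].
have : z1 x - z2 s * x <= z1 s - z2 s * s.
  apply: (@le0_derive_ge_cc _ (fun x => z1 x - z2 s * x) (fun x => z2 x - z2 s * 1)) => //.
    move=> y /sub /(_ x1) sy; exact: der_add (dz1 sy) (der_opp (der_scale (z2 s) (der_id y))).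
  by move=> y /sub /(_ x1) sy; rewrite mulr1 subr_le0; exact: z2_le.
by rewrite mulrBr; lra.
Qed.

(** H'' does not increase, so H'(1) <= H'(s) + H''(s) (1 - s). As 1 - s >= 1/2, a value below -4
    theta outweighs H'(s) <= 2 theta. *)
Lemma lower_shot : z1 s <= 2 * theta -> z2 s < - (4 * theta) -> z1 1 < 0.
Proof.
move=> h1 h2; have := @z1_le 1; rewrite lexx andbT => /(_ (le_trans sh _)).
have -> : 2^-1 <= (1 : R) by lra.
move=> /(_ isT) h.
have : z2 s * (1 - s) < - (4 * theta) * 2^-1; last by lra.
have p : 2^-1 <= 1 - s by have := sh; lra.
have z20 : z2 s < 0 by have := theta_gt0; lra.
have : z2 s * (1 - s) <= z2 s * 2^-1 by apply: ler_wnM2l => //; exact: ltW.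
have : z2 s * 2^-1 < - (4 * theta) * 2^-1 by rewrite ltr_pM2r// invr_gt0.
by move=> a b; apply: (le_lt_trans b).
Qed.

Lemma upper_shot_of_nonneg : (forall x, s <= x <= 1 -> 0 <= z2 x) -> z1 s <= z1 1.
Proof.
move=> h; apply: (@ge0_derive_le_cc _ z1 z2) => //; have := sh; lra.
Qed.

Lemma z2_lower (p q : R -> R) : (forall x, s <= x <= 1 -> is_derive x 1 p (q x)) ->
  (forall x, s <= x <= 1 -> - q x <= rhs x (z0 x)) ->
  forall x, s <= x <= 1 -> z2 s - (p x - p s) <= z2 x.
Proof.
move=> dp hq x /andP[sx x1].
have : z2 s + p s <= z2 x + p x; last by lra.
apply: (@ge0_derive_le_cc _ (fun x => z2 x + p x) (fun x => rhs x (z0 x) + q x)) => //.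
  by move=> y /sub /(_ x1) sy; exact: der_add (dz2 sy) (dp y sy).
by move=> y /sub /(_ x1) /hq; rewrite -lerBlDr sub0r.
Qed.

Lemma rhs_ge x h B : s <= x <= 1 -> 0 <= B -> cutoff x h `^ (1 - n) <= B -> - B <= rhs x h.
Proof.
move=> /andP[sx x1] B0 hB; rewrite /rhs mulNr lerN2.
have /andP[c0 c1] := @clamp_itv R 0 1 (1 - x) ler01.
apply: (@le_trans _ _ (1 * B)); last by rewrite mul1r.
by apply: ler_pM => //; exact: powR_ge0.
Qed.

(** With W = H''(s), the solution stays below 4 theta + W <= 2W. Hence |H'''| <= (2W)^(1 - n) <= 2
    W^(1 - n) <= W, the last step by 2 <= W^n. Over a length at most 1, H'' cannot fall below 0, so
    H' does not decrease. *)
Lemma upper_shot_sublinear : n <= 1 -> 0 <= z0 s <= 2 * theta -> 0 <= z1 s <= 2 * theta ->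
  4 * theta <= z2 s -> 2 <= z2 s `^ n -> z1 s <= z1 1.
Proof.
move=> n1 /andP[h0 h0'] /andP[h1 h1'] hW hW2.
set W := z2 s in hW hW2.
have W0 : 0 < W by apply: lt_le_trans hW; rewrite mulr_gt0.
have z1W x : s <= x <= 1 -> z1 x <= 2 * theta + W.
  move=> sx; apply: (le_trans (z1_le sx)); apply: lerD => //.
  by rewrite ler_piMr ?(ltW W0)//; have := s_gt0; case/andP: sx => *; lra.
have z0W x : s <= x <= 1 -> z0 x <= 4 * theta + W.
  move=> /andP[sx x1].
  have : z0 x - (2 * theta + W) * x <= z0 s - (2 * theta + W) * s.
    apply: (@le0_derive_ge_cc _ (fun x => z0 x - (2 * theta + W) * x)
      (fun x => z1 x - (2 * theta + W) * 1)) => //.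
      by move=> y /sub /(_ x1) sy; exact: der_add (dz0 sy) (der_opp (der_scale (2 * theta + W) (der_id y))).
    by move=> y /sub /(_ x1) /z1W; rewrite mulr1 subr_le0.
  have : (2 * theta + W) * (x - s) <= 2 * theta + W.
    by rewrite ler_piMr//; [rewrite addr_ge0 ?mulr_ge0 ?ltW|have := s_gt0; lra].
  by rewrite mulrBr; lra.
have B0 : 0 <= (4 * theta + W) `^ (1 - n) by exact: powR_ge0.
have BW : (4 * theta + W) `^ (1 - n) <= W.
  apply: (@le_trans _ _ ((2 * W) `^ (1 - n))).
    apply: ge0_ler_powR; rewrite ?nnegrE ?subr_ge0 ?mulr_ge0 ?(ltW W0)//; last by lra.
    by rewrite addr_ge0// ?mulr_ge0// ltW.
  rewrite powRM ?(ltW W0)//.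
  have e : W = W `^ (1 - n) * W `^ n.
    rewrite -powRD; last by apply/implyP => _; rewrite gt_eqF.
    by rewrite subrK powRr1// ltW.
  rewrite [leRHS]e mulrC; apply: ler_wpM2l; first exact: powR_ge0.
  apply: le_trans hW2; apply: ler1_powR; first by rewrite ler1n.
  by rewrite gerBl ltW.
apply: upper_shot_of_nonneg => x sx.
have := @z2_lower (fun y => (4 * theta + W) `^ (1 - n) * y)
  (fun=> (4 * theta + W) `^ (1 - n) * 1) _ _ x sx.
rewrite -mulrBr => h; apply: le_trans (h _ _).
- rewrite subr_ge0; apply: (le_trans _ BW); rewrite ler_piMr//.
  by have := s_gt0; case/andP: sx => *; lra.
- move=> y sy; rewrite mulr1; apply: rhs_ge => //.
  apply: ge0_ler_powR; rewrite ?nnegrE ?subr_ge0//.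
  + exact: le_trans (ltW m_gt0) (cutoff_gt0 _ _).
  + by rewrite addr_ge0 ?mulr_ge0 ?ltW.
  + rewrite /cutoff ge_max z0W//=.
    have /andP[sy1 sy2] := sy; have /andP[Xs _] := s_itv.
    rewrite max_l; last exact: le_trans sy1.
    have : theta * y <= theta * 1 by apply: ler_wpM2l => //; exact: ltW.
    by have := theta_gt0; lra.
Qed.

(** For n >= 1 the floor theta x/2 bounds |H'''| by K x^(1 - n) <= K x^(b - 2), whatever the
    solution. The integral from s is at most K s^(b - 1)/(1 - b). Here b <= 3 - n justifies the
    weakened exponent, and b <= 1/2 keeps 1/(1 - b) <= 2 even when 3 - n is near 1. *)
Lemma upper_shot_superlinear (b : R) : 1 <= n -> 0 < b <= 2^-1 -> b <= 3 - n ->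
  2 * (theta / 2) `^ (1 - n) * s `^ (b - 1) <= z2 s -> z1 s <= z1 1.
Proof.
move=> n1 /andP[b0 b2] bn hW.
set K := (theta / 2) `^ (1 - n) in hW.
have K0 : 0 <= K by exact: powR_ge0.
have b1 : b - 1 != 0 by rewrite lt_eqF//; lra.
apply: upper_shot_of_nonneg => x sx.
have := @z2_lower (fun y => K / (b - 1) * y `^ (b - 1))
  (fun y => K / (b - 1) * ((b - 1) * y `^ (b - 1 - 1))) _ _ x sx.
move=> h; apply: le_trans (h _ _).
- rewrite subr_ge0; apply: (le_trans _ hW).
  have xs0 := powR_ge0 x (b - 1); have ss0 := powR_ge0 s (b - 1).
  have i2 : 0 <= (1 - b)^-1 <= 2.
    have p : 0 < 1 - b by lra.
    by rewrite invr_ge0 (ltW p)/= -[leRHS]invrK lef_pV2 ?posrE//; lra.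
  have -> : K / (b - 1) * x `^ (b - 1) - K / (b - 1) * s `^ (b - 1) =
    K * (1 - b)^-1 * (s `^ (b - 1) - x `^ (b - 1)).
    by rewrite -(opprB b) invrN; ring.
  have /andP[i0 i2'] := i2.
  apply: (@le_trans _ _ (K * (1 - b)^-1 * s `^ (b - 1))).
    by apply: ler_wpM2l; [rewrite mulr_ge0|rewrite gerBl].
  by apply: ler_wpM2r => //; rewrite mulrC; apply: ler_wpM2r.
- move=> y /andP[sy _]; apply: der_scale; apply: is_derive1_powR; exact: lt_le_trans sy.
- move=> y sy; rewrite mulrA divfK//; apply: rhs_ge => //.
    by rewrite mulr_ge0// powR_ge0.
  have /andP[sy1 sy2] := sy; have y0 : 0 < y by exact: lt_le_trans sy1.
  apply: (@le_trans _ _ ((theta / 2 * y) `^ (1 - n))).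
    apply: powR_le_neg; [by rewrite subr_le0|by rewrite mulr_gt0// divr_gt0|].
    rewrite /cutoff le_max; apply/orP; right; have /andP[Xs _] := s_itv.
    by rewrite max_l ?(le_trans Xs)// mulrAC.
  rewrite powRM ?(ltW y0)//; last by rewrite divr_ge0// ltW.
  apply: ler_wpM2l => //; apply: ger_powR; first by rewrite y0.
  by lra.
Qed.

End Cutoff.

(** * Gluing the series solution to its continuation and removing the cutoff *)

Section Glue.
Context {R : realType}.
Implicit Types (x : R).
Variables (n theta X c : R) (hl ul wl z0 z1 z2 : R -> R).
Hypothesis n_gt0 : 0 < n.
Hypothesis theta_gt0 : 0 < theta.
Hypothesis X_gt0 : 0 < X.
Hypothesis X_small : 64 * X <= 1.
Hypothesis c_gt0 : 0 < c.
Hypothesis dhl : forall x, 0 < x < X -> is_derive x 1 hl (ul x).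
Hypothesis dul : forall x, 0 < x < X -> is_derive x 1 ul (wl x).
Hypothesis dwl : forall x, 0 < x < X -> is_derive x 1 wl (- (1 - x) * hl x `^ (1 - n)).
Hypothesis hl_ge : forall x, 0 < x < X -> theta * x / 2 <= hl x.
Hypothesis hl_asymp : forall x, 0 < x < X -> `|hl x / x - theta| <= theta * (x / X) `^ c.
Hypothesis ul_asymp : forall x, 0 < x < X -> `|ul x - theta| <= theta * (x / X) `^ c.
Hypothesis hl0 : hl 0 = 0.
Local Notation s := (X / 2).
Hypothesis dz : forall x, X / 4 < x < 2 -> [/\ is_derive x 1 z0 (z1 x), is_derive x 1 z1 (z2 x)
  & is_derive x 1 z2 (rhs n theta X x (z0 x))].
Hypothesis init0 : z0 s = hl s.
Hypothesis init1 : z1 s = ul s.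
Hypothesis init2 : z2 s = wl s.
Hypothesis target : z1 1 = 0.

Let X1 : X < 1. Proof. by have := X_small; lra. Qed.
Let Xq : 0 < X / 4. Proof. by rewrite divr_gt0. Qed.
Let sX : s < X. Proof. by have := X_gt0; lra. Qed.
Let qs : X / 4 < s. Proof. by have := X_gt0; lra. Qed.
Let s0 : 0 < s. Proof. by rewrite divr_gt0. Qed.
Let s1 : s < 1. Proof. exact: lt_trans X1. Qed.

(** The series solution lies above theta x/2, so on the overlap it solves the cut-off equation too;
    both have the same data at s, and [gronwall] is applied to the right and to the left of s.
    Agreement on an open interval makes the glued function differentiable at s. *)
Lemma local_eq_picard x : X / 4 < x < X -> [/\ hl x = z0 x, ul x = z1 x & wl x = z2 x].
Proof.
have [L L0 hL] := @rhs_lipschitz R n theta X n_gt0 theta_gt0 X_gt0.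
pose D0 x := hl x - z0 x; pose D1 x := ul x - z1 x; pose D2 x := wl x - z2 x.
pose D3 x := rhs n theta X x (hl x) - rhs n theta X x (z0 x).
have hD y : X / 4 < y < X -> [/\ is_derive y 1 D0 (D1 y), is_derive y 1 D1 (D2 y),
    is_derive y 1 D2 (D3 y) & `|D3 y| <= L * `|D0 y|].
  move=> /andP[y1 y2]; have y0X : 0 < y < X by rewrite y2 (lt_trans Xq).
  have [|a0 a1 a2] := @dz y; first by rewrite y1 (lt_trans y2)// (lt_trans X1)// ltr1n.
  have /andP[y0 _] := y0X.
  split.
  - exact: der_add (dhl y0X) (der_opp a0).
  - exact: der_add (dul y0X) (der_opp a1).
  - have e : rhs n theta X y (hl y) = - (1 - y) * hl y `^ (1 - n).
      apply: rhsE; [exact: ltW|exact: ltW (lt_trans y2 X1)|exact: ltW|exact: hl_ge].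
    by apply: (is_derive_eq (der_add (dwl y0X) (der_opp a2))); rewrite /D3 e.
  - exact: hL.
move=> xX; have /andP[x1 x2] := xX.
have Es : D0 s ^+ 2 + D1 s ^+ 2 + D2 s ^+ 2 = 0.
  by rewrite /D0 /D1 /D2 init0 init1 init2 !subrr expr0n/= !addr0.
have Ex : D0 x ^+ 2 + D1 x ^+ 2 + D2 x ^+ 2 <= 0.
  have [sx|/ltW xs] := lerP s x.
    have [|+ _] := @gronwall R D0 D1 D2 D3 L s x sx L0.
      by move=> y /andP[y1 y2]; apply: hD; rewrite (lt_le_trans qs y1) (le_lt_trans y2).
    by rewrite Es mul0r.
  have [|_] := @gronwall R D0 D1 D2 D3 L x s xs L0.
    by move=> y /andP[y1 y2]; apply: hD; rewrite (lt_le_trans x1 y1) (le_lt_trans y2).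
  by rewrite Es mul0r.
have a0 := sqr_ge0 (D0 x); have a1 := sqr_ge0 (D1 x); have a2 := sqr_ge0 (D2 x).
have z (t : R) : t ^+ 2 = 0 -> t = 0 by move=> /eqP; rewrite sqrf_eq0 => /eqP.
by split; apply/eqP; rewrite -subr_eq0; apply/eqP; apply: z;
  [rewrite -/(D0 x)|rewrite -/(D1 x)|rewrite -/(D2 x)]; lra.
Qed.

Let H x := if x < s then hl x else z0 x.
(** The formula for H' contains ln (x/X) and means nothing at 0, where the slope theta is put in by
    hand. H needs no such case, since [hl] vanishes at 0. *)
Let u x := if x < s then (if x <= 0 then theta else ul x) else z1 x.
Let w x := if x < s then wl x else z2 x.

Let left x : 0 < x < X -> [/\ H x = hl x, u x = ul x & w x = wl x].
Proof.
move=> /andP[x0 xX]; rewrite /H /u /w; case: ltP => xs; first by rewrite leNgt x0.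
by have [|-> -> ->] := @local_eq_picard x; first by rewrite (lt_le_trans qs xs).
Qed.

Let right x : X / 4 < x -> [/\ H x = z0 x, u x = z1 x & w x = z2 x].
Proof.
move=> x0; rewrite /H /u /w; case: ltP => xs //.
have [|-> -> ->] := @local_eq_picard x; first by rewrite x0 (lt_trans xs).
by rewrite leNgt (lt_trans Xq).
Qed.

Let zz x := if x < s then - (1 - x) * hl x `^ (1 - n) else rhs n theta X x (z0 x).

Let derivs x : 0 < x < 2 -> [/\ is_derive x 1 H (u x), is_derive x 1 u (w x) & is_derive x 1 w (zz x)].
Proof.
move=> /andP[x0 x2]; rewrite /zz; case: ltP => xs.
  have xX : 0 < x < X by rewrite x0 (lt_trans xs).
  have [eH eu ew] := left xX; split.
  - rewrite eu; apply: (@near_eq_is_derive _ _ _ hl); last exact: dhl.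
    by apply: (near_itvoo_eq xX) => y /left[].
  - rewrite ew; apply: (@near_eq_is_derive _ _ _ ul); last exact: dul.
    by apply: (near_itvoo_eq xX) => y /left[].
  - apply: (@near_eq_is_derive _ _ _ wl); last exact: dwl.
    by apply: (near_itvoo_eq xX) => y /left[].
have xX : X / 4 < x < 2 by rewrite x2 (lt_le_trans qs).
have [a0 a1 a2] := dz xX; have [eH eu ew] := right (lt_le_trans qs xs); split.
- rewrite eu; apply: (@near_eq_is_derive _ _ _ z0).
  by apply: (near_itvoo_eq xX) => y /andP[/right[]].
- rewrite ew; apply: (@near_eq_is_derive _ _ _ z1).
  by apply: (near_itvoo_eq xX) => y /andP[/right[]].
- apply: (@near_eq_is_derive _ _ _ z2).
  by apply: (near_itvoo_eq xX) => y /andP[/right[]].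
Qed.

Let H_0 : H 0 = 0. Proof. by rewrite /H s0. Qed.
Let u_0 : u 0 = theta. Proof. by rewrite /u s0 lexx. Qed.
Let u_1 : u 1 = 0. Proof. by rewrite /u ltNge (ltW s1). Qed.

Let small_near0 eps : 0 < eps -> exists2 d : R, 0 < d &
  forall y, 0 < y -> y < d -> 0 < y < X /\ theta * (y / X) `^ c <= eps.
Proof.
move=> eps0; have et : 0 < eps / theta by rewrite divr_gt0.
exists (Num.min X (X * (eps / theta) `^ c^-1)).
  by rewrite lt_min X_gt0 mulr_gt0// powR_gt0.
move=> y y0; rewrite lt_min => /andP[yX ye]; split; first by rewrite y0.
rewrite mulrC -ler_pdivlMr//.
have -> : eps / theta = ((eps / theta) `^ c^-1) `^ c.
  by rewrite -powRrM mulVf ?gt_eqF// powRr1// ltW.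
apply: ge0_ler_powR; rewrite ?nnegrE ?powR_ge0 ?(ltW c_gt0)//.
  by rewrite divr_ge0 ?ltW.
by rewrite ler_pdivrMr// mulrC ltW.
Qed.

Let dH0 : is_derive_on `[0, 1] H 0 theta.
Proof.
apply/is_derive_onP => eps /small_near0[d d0 hd]; exists d => // y.
rewrite /= in_itv /= => /andP[y0 y1] yn0; rewrite !subr0 ger0_norm// => yd.
have yp : 0 < y by rewrite lt_neqAle eq_sym yn0.
have [yX le] := hd y yp yd; have [-> _ _] := left yX.
by rewrite H_0 subr0 distrC; apply: le_trans le; exact: hl_asymp.
Qed.

Let u_cont : {within `[0, 1], continuous u}.
Proof.
apply/subspace_continuousP => x; rewrite /= in_itv /= => /andP[x0 x1].
move: x0; rewrite le_eqVlt => /predU1P[<-|x0]; last first.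
  apply: cvg_within_filter; have [|_ d _] := @derivs x.
    by rewrite x0 (le_lt_trans x1)// ltr1n.
  exact: (derive_cont d).
apply/cvgrPdist_le => eps eps0; have [d d0 hd] := small_near0 eps0.
have hy y : 0 <= y -> y < d -> `|u 0 - u y| <= eps.
  rewrite le_eqVlt => /predU1P[<-|y0] yd; first by rewrite subrr normr0 ltW.
  have [yX le] := hd y y0 yd; have [_ -> _] := left yX.
  by rewrite u_0 distrC; apply: le_trans le; exact: ul_asymp.
exists d => // y /=; rewrite sub0r normrN => yd; rewrite in_itv /= => /andP[y0 y1].
by apply: hy => //; rewrite ger0_norm in yd.
Qed.

Let du1 : is_derive_on `[0, 1] H 1 0.
Proof.
apply: is_derive_on_sub; rewrite -u_1.
by have [|d _ _] := @derivs 1; first by rewrite ltr01 ltr1n.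
Qed.

Let in2 x : 0 < x < 1 -> 0 < x < 2.
Proof. by move=> /andP[-> x1]; rewrite (lt_trans x1)// ltr1n. Qed.

Let H_cont : {within `[0, 1], continuous H}.
Proof.
apply: (@is_derive_on_cont _ 0 1 H u) => x; rewrite /= in_itv /= => /andP[x0 x1].
move: x0; rewrite le_eqVlt => /predU1P[<-|x0]; first by rewrite u_0.
apply: is_derive_on_sub; have [|//] := @derivs x.
by rewrite x0 (le_lt_trans x1)// ltr1n.
Qed.

Lemma glue : exists H u w, [/\ profile n theta H u w, is_derive_on `[0, 1] H 0 theta,
  is_derive_on `[0, 1] H 1 0 & forall x, x < X / 2 -> H x = hl x].
Proof.
(* Only the sign of the third derivative is used. The conclusion is the very inequality under which
   [rhsE] replaces the cut-off right-hand side by the true one. *)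
have low x : 0 <= x <= 1 -> theta * x / 2 <= H x.
  apply: (@concave_slope_lower _ H u w zz theta).
  - exact: H_cont.
  - exact: u_cont.
  - exact: H_0.
  - exact: u_0.
  - exact: u_1.
  - exact: ltW.
  - by move=> y /in2/derivs[].
  - by move=> y /in2/derivs[].
  - by move=> y /in2/derivs[].
  - move=> y /andP[y0 y1]; rewrite /zz; case: ifP => _; last exact: rhs_le0.
    by rewrite mulNr oppr_le0 mulr_ge0 ?powR_ge0// subr_ge0 ltW.
exists H, u, w; split => //; last by move=> x xs; rewrite /H xs.
split => //.
- move=> x /andP[x0 x1]; apply: lt_le_trans (low x _); last by rewrite (ltW x0) (ltW x1).
  by rewrite divr_gt0// mulr_gt0.
- by move=> y /in2/derivs[].
- by move=> y /in2/derivs[].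
- move=> x x01; have [_ _ d] := derivs (in2 x01); apply: (is_derive_eq d).
  have /andP[x0 x1] := x01; have lx : theta * x / 2 <= H x by apply: low; rewrite (ltW x0) (ltW x1).
  move: lx; rewrite /zz /H; case: ltP => // xs lx; rewrite rhsE ?(ltW x0) ?(ltW x1)//.
  exact: ltW (lt_le_trans qs xs).
Qed.

End Glue.

(** * Choice of the scale and of the free coefficient *)

Section Shooting.
Context {R : realType}.

Lemma exists_small_scale (p q e1 e2 e3 : R) : 0 < p -> 0 < q -> 0 < e1 -> 0 < e2 -> 0 < e3 ->
  exists X : R, [/\ 0 < X, X <= e1, X `^ p <= e2 & X `^ q <= e3].
Proof.
move=> p0 q0 e10 e20 e30.
exists (Num.min e1 (Num.min (e2 `^ p^-1) (e3 `^ q^-1))); split.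
- by rewrite !lt_min e10 !powR_gt0.
- by rewrite ge_min lexx.
- have {2}-> : e2 = (e2 `^ p^-1) `^ p by rewrite -powRrM mulVf ?gt_eqF// powRr1// ltW.
  apply: ge0_ler_powR; rewrite ?nnegrE ?powR_ge0 ?(ltW p0)// ?ge_min ?lexx ?orbT//.
  by rewrite !le_min (ltW e10) !powR_ge0.
- have {2}-> : e3 = (e3 `^ q^-1) `^ q by rewrite -powRrM mulVf ?gt_eqF// powRr1// ltW.
  apply: ge0_ler_powR; rewrite ?nnegrE ?powR_ge0 ?(ltW q0)// ?ge_min ?lexx ?orbT//.
  by rewrite !le_min (ltW e10) !powR_ge0.
Qed.

Section Family.
Variables (n theta A X eps : R) (g : R -> nat -> {poly R}).
Let beta := 3 - n.
Let kappa := 64 * (theta `^ (- n) * X `^ beta).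
Let r := 64 * X.
(** Clamping the parameter defines the family for every real [a] with the smallness condition always
    satisfied, so continuity in [a] can be proved on the whole line. *)
Let cl := clamp (- eps) eps.
Hypothesis n_gt0 : 0 < n.
Hypothesis n_lt3 : n < 3.
Hypothesis theta_gt0 : 0 < theta.
Hypothesis X_gt0 : 0 < X.
Hypothesis X_small : 64 * X <= 1.
Hypothesis A_gt0 : 0 < A.
Hypothesis A_bound : forall N j k, (j < N)%N -> (k <= 3)%N ->
  mu beta N j ^+ k <= A * `|indicial beta N j|.
Hypothesis gE : forall a N, g a N = gstep n beta kappa r (cl a) N (g a).
Hypothesis eps_gt0 : 0 < eps.
Hypothesis small : forall a, `|cl a| + 4 * (A * kappa) <= Num.min 1 beta / 5.
Hypothesis kappa_small : 2048 * (A * kappa) <= eps.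
Hypothesis X_eps : 256 * X < eps.
Hypothesis X_sublinear : n <= 1 -> 2 <= (theta * eps / 64 / X) `^ n.
Hypothesis X_superlinear : 4 * (theta / 2) `^ (1 - n) * X `^ (Num.min beta 2^-1) <= theta * eps / 64.

Local Notation s := (X / 2).
Let beta_gt0 : 0 < beta. Proof. by rewrite subr_gt0. Qed.
Let n_le : `|1 - n| <= 2.
Proof. by have h0 := n_gt0; have h3 := n_lt3; rewrite ler_norml; apply/andP; split; lra. Qed.
Let kappa_ge0 : 0 <= kappa. Proof. by rewrite mulr_ge0// mulr_ge0// powR_ge0. Qed.
Let r_itv : 0 <= r <= 1. Proof. by rewrite X_small mulr_ge0// ltW. Qed.
Let sX : 0 < s < X. Proof. by have h := X_gt0; apply/andP; split; lra. Qed.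
Let qs : X / 4 < s < 2.
Proof. by have h := X_gt0; have h' := X_small; apply/andP; split; lra. Qed.

Let h a := hloc n beta theta X (cl a) (g a) s.
Let u a := uloc n beta theta X (cl a) (g a) s.
Let w a := wloc n beta theta X (cl a) (g a) s.

Lemma phi_continuous k t : (k <= 3)%N -> t <= 0 ->
  continuous (fun a => phi beta kappa r (cl a) (g a) k t).
Proof.
move=> k3 t0 a; apply: cvgD.
  by apply: cvgMl; apply: cvgMl; exact: continuous_clamp.
apply: (@continuous_ssum R R
  (fun N a => ev beta N (mult (fun N j => mu beta N j ^+ k) N (forced beta kappa r (g a) N)) t)
  (4 * (A * kappa))).
  move=> b; apply: (ev_dom beta_gt0 (q := fun N => mult (fun N j => mu beta N j ^+ k) N (forced beta kappa r (g b) N))) => // N.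
    exact: size_mult.
  exact: (forced_bound beta_gt0 n_le kappa_ge0 r_itv A_gt0 A_bound (gE b) (small b)).
move=> N; apply: continuous_ev; apply: ccont_mult; apply: ccont_forced => M _.
exact: (ccont_g (@continuous_clamp _ _ _) gE).
Qed.

Let t_le0 : ln (s / X) <= 0.
Proof. by rewrite ln_le0// ler_pdivrMr// mul1r; case/andP: sX => _ /ltW. Qed.

Let h_cont : continuous h.
Proof.
move=> a; apply: cvgMr; apply: cvgD; first exact: cvg_cst.
exact: phi_continuous.
Qed.

Let u_cont : continuous u.
Proof.
move=> a; apply: cvgMr; apply: cvgD; last exact: phi_continuous.
by apply: cvgD; [exact: cvg_cst|exact: phi_continuous].
Qed.

Let w_cont : continuous w.
Proof. by move=> a; apply: cvgMr; apply: cvgD; exact: phi_continuous. Qed.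

Let cc := theta * eps / 64.
Let cc_gt0 : 0 < cc. Proof. by rewrite divr_gt0// mulr_gt0. Qed.

(** At s = X/2 the error is 32 theta A kappa/X, at most cc/X by [kappa_small]. At a = eps and a =
    -eps the main term is 2 cc/X in absolute value, so its sign survives with cc/X to spare. *)
Let w_est a : `|w a - theta * cl a / (32 * X)| <= cc / X.
Proof.
apply: (le_trans (wloc_estimate n_lt3 (erefl beta) theta_gt0 X_gt0 n_le X_small A_gt0 A_bound (gE a) (small a) sX)).
rewrite -/kappa.
have -> : theta / s * (16 * (A * kappa)) = (theta * (32 * (A * kappa))) / X.
  by field; rewrite gt_eqF.
apply: ler_wpM2r; first by rewrite invr_ge0 ltW.
rewrite /cc -mulrA; apply: ler_wpM2l; first exact: ltW.
by have := kappa_small; lra.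
Qed.

Let cl_id a : - eps <= a <= eps -> cl a = a.
Proof. exact: clamp_id. Qed.

Let w_plus : cc / X <= w eps.
Proof.
have := w_est eps; rewrite cl_id; last by have e0 := eps_gt0; apply/andP; split; lra.
have -> : theta * eps / (32 * X) = 2 * (cc / X) by rewrite /cc; field; rewrite gt_eqF.
by rewrite ler_norml => /andP[]; lra.
Qed.

Let w_minus : w (- eps) <= - (cc / X).
Proof.
have := w_est (- eps); rewrite cl_id; last by have e0 := eps_gt0; apply/andP; split; lra.
have -> : theta * - eps / (32 * X) = - (2 * (cc / X)) by rewrite /cc; field; rewrite gt_eqF.
by rewrite ler_norml => /andP[]; lra.
Qed.

Let h_bd a : 0 <= h a <= 2 * theta.
Proof.
have /andP[h1 h2] := hloc_bounds n_lt3 (erefl beta) theta_gt0 X_gt0 n_le X_small A_gt0 A_bound (gE a) (small a) sX.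
have /andP[s0 _] := sX.
apply/andP; split; first by apply: le_trans h1; rewrite divr_ge0// mulr_ge0// ltW.
apply: (le_trans h2); rewrite ler_piMr ?mulr_ge0 ?(ltW theta_gt0)//.
by have := X_small; lra.
Qed.

Let u_bd a : 0 <= u a <= 2 * theta.
Proof.
exact: (uloc_bounds n_lt3 (erefl beta) theta_gt0 X_gt0 n_le X_small A_gt0 A_bound (gE a) (small a) sX).
Qed.

(** Intermediate value theorem for H'(1) as a function of [a]. The continuation runs to 2, so that x
    = 1 is an interior point and the derivatives there are two-sided. *)
Lemma shooting_parameter : exists a z0 z1 z2, [/\ z0 s = h a, z1 s = u a, z2 s = w a, z1 1 = 0 &
  forall x, X / 4 < x < 2 -> [/\ is_derive x 1 z0 (z1 x), is_derive x 1 z1 (z2 x)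
    & is_derive x 1 z2 (rhs n theta X x (z0 x))]].
Proof.
have [L L0 hL] := @rhs_lipschitz R n theta X n_gt0 theta_gt0 X_gt0.
have ex a := picard (h a) (u a) (w a) qs L0 hL (@rhs_continuous R n theta X theta_gt0 X_gt0).
have [z0 {}ex] := choice ex.
have [z1 {}ex] := choice ex.
have [z2 {}ex] := choice ex.
have in2 x : s <= x <= 1 -> X / 4 < x < 2.
  by move=> /andP[sx x1]; have /andP[a _] := qs; rewrite (lt_le_trans a sx) (le_lt_trans x1)// ltr1n.
have s12 : s <= 2^-1 by have := X_small; lra.
have s1 : s <= 1 by lra.
have qs' : X / 4 <= s <= 2^-1 by rewrite s12 andbT; case/andP: qs => /ltW.
have s0 : 0 < s by case/andP: sX.
(* The data at s depend continuously on [a], and [gronwall] carries their difference to x = 1. *)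
have fcont : continuous (fun a => z1 a 1).
  move=> a; apply/cvgrPdist_le => e e0.
  pose M := expR ((2 + L ^+ 2) * (1 - s)).
  pose Es b := ((h a - h b) ^+ 2 + (u a - u b) ^+ 2 + (w a - w b) ^+ 2) * M.
  have Ec : Es b @[b --> a] --> (0 : R).
    have -> : (0 : R) = Es a by rewrite /Es !subrr expr0n /= !addr0 mul0r.
    have sq (f : R -> R) : continuous f -> (f a - f b) ^+ 2 @[b --> a] --> (f a - f a) ^+ 2.
      move=> fc; have d : f a - f b @[b --> a] --> f a - f a by apply: cvgB; [exact: cvg_cst|exact: fc].
      by rewrite expr2; apply: (cvgM d d).
    apply: cvgMl; apply: cvgD; last exact: sq.
    by apply: cvgD; exact: sq.
  have e20 : 0 < e ^+ 2 by rewrite exprn_gt0.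
  move/cvgrPdist_le: Ec => /(_ _ e20); apply: filterS => b.
  rewrite sub0r normrN => hb; have {}hb := le_trans (ler_norm _) hb.
  have [a0 a1 a2 da] := ex a; have [b0 b1 b2 db] := ex b.
  have [|+ _] := @gronwall R (fun x => z0 a x - z0 b x) (fun x => z1 a x - z1 b x)
    (fun x => z2 a x - z2 b x) (fun x => rhs n theta X x (z0 a x) - rhs n theta X x (z0 b x)) L s 1 s1 L0.
    move=> x /in2 x2; have [p0 p1 p2] := da x x2; have [q0 q1 q2] := db x x2.
    by split; [exact: der_add p0 (der_opp q0)|exact: der_add p1 (der_opp q1)|exact: der_add p2 (der_opp q2)|exact: hL].
  rewrite /= a0 a1 a2 b0 b1 b2 => /le_trans/(_ hb) hE.
  have : (z1 a 1 - z1 b 1) ^+ 2 <= e ^+ 2.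
    by apply: le_trans hE; rewrite -addrA addrCA lerDl addr_ge0// sqr_ge0.
  by rewrite -ler_sqrt ?exprn_ge0 ?(ltW e0)// !sqrtr_sqr (gtr0_norm e0).
have neg : z1 (- eps) 1 < 0.
  have [a0 a1 a2 da] := ex (- eps).
  apply: (lower_shot theta_gt0 (X := X) (n := n) (z0 := z0 (- eps)) (z2 := z2 (- eps)) qs').
  - by move=> x /in2/da[].
  - by move=> x /in2/da[].
  - by rewrite a1; case/andP: (u_bd (- eps)).
  - rewrite a2; apply: (le_lt_trans w_minus); rewrite ltrN2 ltr_pdivlMr// /cc.
    have := X_eps; rewrite -(ltr_pM2l theta_gt0); lra.
have pos : 0 <= z1 eps 1.
  have [a0 a1 a2 da] := ex eps.
  apply: (@le_trans _ _ (z1 eps s)); first by rewrite a1; case/andP: (u_bd eps).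
  have [n1|/ltW n1] := lerP n 1.
    apply: (upper_shot_sublinear n_gt0 theta_gt0 X_gt0 (z0 := z0 eps) (z2 := z2 eps) qs' s0) => //.
    - by move=> x /in2/da[].
    - by move=> x /in2/da[].
    - by move=> x /in2/da[].
    - by rewrite a0; exact: h_bd.
    - by rewrite a1; exact: u_bd.
    - rewrite a2; apply: le_trans w_plus; rewrite ler_pdivlMr// /cc.
      have := ltW X_eps; rewrite -(ler_pM2l theta_gt0); lra.
    - rewrite a2; apply: (le_trans (X_sublinear n1)).
      have p0 : 0 <= cc / X by rewrite divr_ge0 ?ltW.
      have wp := w_plus; apply: ge0_ler_powR; rewrite ?nnegrE ?(ltW n_gt0)//.
      exact: le_trans p0 wp.
  apply: (@upper_shot_superlinear R n theta X theta_gt0 s (z0 eps) (z1 eps) (z2 eps) qs' s0 _ _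
    (Num.min beta 2^-1)) => //.
  - by move=> x /in2/da[].
  - by move=> x /in2/da[].
  - by rewrite lt_min beta_gt0 invr_gt0 ltr0n ge_min lexx orbT.
  - by rewrite ge_min lexx.
  - rewrite a2; apply: le_trans w_plus; rewrite ler_pdivlMr//; apply: le_trans X_superlinear.
    set b := Num.min beta 2^-1.
    have b0 : 0 < b by rewrite lt_min beta_gt0 invr_gt0 ltr0n.
    have K0 : 0 <= (theta / 2) `^ (1 - n) by exact: powR_ge0.
    have e : s * s `^ (b - 1) = s `^ b by rewrite mulr_powRB1 ?(ltW s0).
    have -> : 2 * (theta / 2) `^ (1 - n) * s `^ (b - 1) * X =
      4 * (theta / 2) `^ (1 - n) * (s * s `^ (b - 1)) by field.
    rewrite e; apply: ler_wpM2l; first by rewrite mulr_ge0.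
    apply: ge0_ler_powR; rewrite ?nnegrE ?(ltW b0) ?(ltW s0) ?(ltW X_gt0)//.
    by case/andP: sX => _ /ltW.
have [|||a _ fa] := @IVT R (fun a => z1 a 1) (- eps) eps 0.
- by have := eps_gt0; lra.
- exact: continuous_subspaceT.
- by rewrite ge_min le_max (ltW neg) pos orbT.
by exists a, (z0 a), (z1 a), (z2 a); have [a0 a1 a2 da] := ex a.
Qed.

End Family.

Lemma shooting (n theta : R) : 0 < n -> n < 3 ->
  (forall m : nat, (0 < m)%N -> n <> 3 - m%:R^-1) -> 0 < theta ->
  let beta := 3 - n in exists A X a g,
  [/\ [/\ 0 < X, 64 * X <= 1, 0 < A & forall N j k, (j < N)%N -> (k <= 3)%N ->
         mu beta N j ^+ k <= A * `|indicial beta N j|],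
      forall N, g N = gstep n beta (64 * (theta `^ (- n) * X `^ beta)) (64 * X) a N g,
      `|a| + 4 * (A * (64 * (theta `^ (- n) * X `^ beta))) <= Num.min 1 beta / 5
    & exists H u w, [/\ profile n theta H u w, is_derive_on `[0, 1] H 0 theta,
        is_derive_on `[0, 1] H 1 0 & forall x, x < X / 2 -> H x = hloc n beta theta X a g x]].
Proof.
move=> n0 n3 nr th0 beta.
have beta0 : 0 < beta by rewrite subr_gt0.
have nr' m : (0 < m)%N -> beta * m%:R <> 1.
  move=> m0 h; apply: (nr m m0).
  have m1 : m%:R != 0 :> R by rewrite pnatr_eq0 -lt0n.
  have -> : m%:R^-1 = beta by apply: (mulIf m1); rewrite mulVf// h.
  by rewrite /beta; ring.
have n_le : `|1 - n| <= 2 by rewrite ler_norml; apply/andP; split; lra.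
have [A A0 hA] := indicial_lower_bound beta0 nr'.
pose c0 := Num.min 1 beta; have c00 : 0 < c0 by rewrite lt_min ltr01.
have c01 : c0 <= 1 by rewrite ge_min lexx.
(* Half of the allowance c0/5 goes to |a|. The other half easily covers 4 A kappa, since 2048 A
   kappa <= eps. *)
pose eps := c0 / 10; have eps0 : 0 < eps by rewrite divr_gt0.
pose T := theta `^ (- n); have T0 : 0 < T by rewrite powR_gt0.
pose K := (theta / 2) `^ (1 - n); have K0 : 0 <= K by exact: powR_ge0.
pose cc := theta * eps / 64; have cc0 : 0 < cc by rewrite divr_gt0// mulr_gt0.
pose b := Num.min beta 2^-1; have b0 : 0 < b by rewrite lt_min beta0 invr_gt0 ltr0n.
(* The three entries serve 64 X <= 1, the strict inequality 256 X < eps, and 2 <= (cc/X)^n. Below,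
   [e2] bounds X^beta so that 2048 A kappa <= eps, and [e3] bounds X^b for the superlinear shot. *)
pose e1 := Num.min (64^-1) (Num.min (eps / 512) (cc / 2 `^ n^-1)).
have e10 : 0 < e1.
  rewrite !lt_min; apply/and3P; split; first by rewrite invr_gt0 ltr0n.
    by apply: (divr_gt0 eps0); rewrite ltr0n.
  by apply: (divr_gt0 cc0); rewrite powR_gt0.
pose S := 2048 * (A * (64 * T)).
have S0 : 0 < S.
  apply: mulr_gt0; first by rewrite ltr0n.
  by apply: (mulr_gt0 A0); apply: mulr_gt0 T0; rewrite ltr0n.
pose e2 := eps / S.
have e20 : 0 < e2 by exact: divr_gt0 eps0 S0.
pose e3 := cc / (4 * K + 1).
have K1 : 0 < 4 * K + 1 by rewrite ltr_wpDl// mulr_ge0.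
have e30 : 0 < e3 by rewrite divr_gt0.
have [X [X0 X1 X2 X3]] := exists_small_scale beta0 b0 e10 e20 e30.
move: X1; rewrite !le_min => /and3P[X1 X1' X1''].
pose kappa := 64 * (theta `^ (- n) * X `^ beta).
have ks : 2048 * (A * kappa) <= eps.
  rewrite (_ : _ * _ = X `^ beta * S); last by rewrite /kappa -/T /S; ring.
  by rewrite -ler_pdivlMr.
have ka0 : 0 <= A * kappa by rewrite mulr_ge0 ?(ltW A0)// mulr_ge0// mulr_ge0// powR_ge0.
have [g0 hg0] := gstep_exists n beta kappa (64 * X).
pose cl := clamp (- eps) eps; pose g a := g0 (cl a).
have X64 : 64 * X <= 1 by rewrite mulrC -ler_pdivlMr// mul1r.
have small a : `|cl a| + 4 * (A * kappa) <= Num.min 1 beta / 5.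
  have ee : - eps <= eps by lra.
  have /andP[l1 l2] := clamp_itv a ee.
  have : `|cl a| <= eps by rewrite ler_norml l1 l2.
  by rewrite -/c0 /eps; move: ks; rewrite /eps; lra.
have [|||a [z0 [z1 [z2 [i0 i1 i2 zt dz]]]]] := @shooting_parameter n theta A X eps g n0 n3 th0 X0 X64
  A0 hA (fun a N => hg0 (cl a) N) eps0 small ks _ _ _.
- by lra.
- move=> n1; rewrite -/cc.
  have -> : (2 : R) = (2 `^ n^-1) `^ n by rewrite -powRrM mulVf ?gt_eqF// powRr1.
  apply: ge0_ler_powR; rewrite ?nnegrE ?powR_ge0 ?(ltW n0)//.
    by rewrite divr_ge0 ?ltW.
  by rewrite ler_pdivlMr// mulrC -ler_pdivlMr// powR_gt0.
- rewrite -/cc -/K -/b mulrC; apply: (@le_trans _ _ (X `^ b * (4 * K + 1))).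
    by apply: ler_wpM2l; [exact: powR_ge0|rewrite lerDl].
  by rewrite -ler_pdivlMr.
exists A, X, (cl a), (g a); split => //; first by move=> N; exact: hg0.
have gE := hg0 (cl a).
apply: (@glue R n theta X c0 (hloc n beta theta X (cl a) (g a)) (uloc n beta theta X (cl a) (g a))
  (wloc n beta theta X (cl a) (g a)) z0 z1 z2 n0 th0 X0 X64 c00 _ _ _ _ _ _ _ dz i0 i1 i2 zt).
- by move=> x; exact: (hloc_derive n3 (erefl beta) X0 n_le X64 A0 hA gE (small a)).
- by move=> x; exact: (uloc_derive n3 (erefl beta) X0 n_le X64 A0 hA gE (small a)).
- by move=> x; exact: (wloc_derive n3 (erefl beta) th0 X0 n_le X64 A0 hA gE (small a)).
- by move=> x /(hloc_bounds n3 (erefl beta) th0 X0 n_le X64 A0 hA gE (small a))/andP[].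
- by move=> x /(hloc_uloc_asymptotics n3 (erefl beta) th0 X0 n_le X64 A0 hA gE (small a))[].
- by move=> x /(hloc_uloc_asymptotics n3 (erefl beta) th0 X0 n_le X64 A0 hA gE (small a))[].
- by rewrite /hloc mulr0 mul0r.
Qed.

End Shooting.

(** * The expansion as an analytic function *)

Section DoublePowerSeries.
Context {R : realType}.

Lemma near00P (P : R * R -> Prop) : (\forall p \near ((0, 0) : R * R), P p) <->
  exists2 d : R, 0 < d & forall x y : R, `|x| < d -> `|y| < d -> P (x, y).
Proof.
split.
  move=> /nbhs_ballP[d /= d0 hd]; exists d => // x y xd yd; apply: hd.
  by split; rewrite /ball /= sub0r normrN.
move=> [d d0 hd]; apply/nbhs_ballP; exists d => // -[x y] [/= xd yd].
by apply: hd; [move: xd|move: yd]; rewrite /ball /= sub0r normrN.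
Qed.

Lemma esum_half_powers (C : R) : 0 <= C ->
  (\esum_(j in [set: nat]) (C / 2 ^+ j)%:E <= (2 * C)%:E)%E.
Proof.
move=> C0; have p0 j : 0 <= C / 2 ^+ j :> R by rewrite divr_ge0// exprn_ge0.
rewrite -nneseries_esumT; last by move=> j; rewrite lee_fin.
apply: lime_le; first by apply: is_cvg_nneseries => j _ _; rewrite lee_fin.
near=> m; rewrite sumEFin lee_fin.
have hd : dom (fun j => C / 2 ^+ j) C by move=> N; rewrite ger0_norm.
have s0 : series (fun j => C / 2 ^+ j) 0%N = 0 by rewrite /series /= big_geq.
have := dom_partial hd (leq0n m); rewrite s0 subr0 expr0 divr1 /series /=.
move=> h; apply: (le_trans (ler_norm _)); apply: (le_trans h).
by rewrite gerBl divr_ge0 ?exprn_ge0// mulr_ge0.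
Unshelve. all: by end_near. Qed.

Lemma summable_dominated (d : nat -> nat -> R) (C : R) :
  (forall j k, `|d j k| <= C / 2 ^+ j / 2 ^+ k) ->
  summable [set: nat * nat] (fun i => (d i.1 i.2)%:E).
Proof.
move=> hd.
have C0 : 0 <= C by apply: le_trans (normr_ge0 (d 0%N 0%N)) _;
  apply: le_trans (hd _ _) _; rewrite !expr0 !divr1.
have q0 j k : 0 <= C / 2 ^+ j / 2 ^+ k :> R by rewrite !divr_ge0// exprn_ge0.
rewrite /summable; apply: (@le_lt_trans _ _ (2 * (2 * C))%:E); last exact: ltry.
apply: (@le_trans _ _ (\esum_(i in [set: nat * nat]) (C / 2 ^+ i.1 / 2 ^+ i.2)%:E)).
  by apply: le_esum => i _ /=; rewrite lee_fin.
have -> : [set: nat * nat] = [set: nat] `*`` (fun=> [set: nat]) by apply/seteqP; split.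
rewrite -(@esum_esum R _ _ [set: nat] (fun=> [set: nat]) (fun j k => (C / 2 ^+ j / 2 ^+ k)%:E)).
  apply: (le_trans (le_esum (fun j _ => esum_half_powers (_ : 0 <= C / 2 ^+ j)))).
    by move=> j; rewrite divr_ge0// exprn_ge0.
  apply: le_trans (esum_half_powers (_ : 0 <= 2 * C)); last by rewrite mulr_ge0.
  by apply: le_esum => j _; rewrite lee_fin mulrA.
by move=> j k _ _; rewrite lee_fin.
Qed.

Definition recenter (a : nat -> R) (p : R) j : R :=
  ssum (fun J => a J * ('C(J, j)%:R * p ^+ (J - j))).

Section OneVariable.
Variables (a : nat -> R) (M rho p : R).
Hypothesis rho_gt0 : 0 < rho.
Hypothesis M_ge0 : 0 <= M.
Hypothesis a_le : forall J, `|a J| <= M * rho ^+ J.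
Hypothesis p_le : rho * `|p| <= 32^-1.

Let le16 (x : R) m : 0 <= x -> x <= 32^-1 -> 2 ^+ m * x ^+ m <= (16 ^+ m)^-1.
Proof.
move=> x0 xle; rewrite -exprMn -exprVn; apply: lerXn2r; rewrite ?nnegrE ?mulr_ge0 ?invr_ge0//.
by lra.
Qed.

Lemma bin_le_expn J j : ('C(J, j) <= 2 ^ J)%N.
Proof.
elim: J j => [|J IH] [|j]; rewrite ?bin0 ?bin0n ?expn_gt0//.
by rewrite binS expnS mul2n -addnn leq_add.
Qed.

(** Split the bound 2^J on the binomial coefficient as 2^j 2^(J - j). The second factor is beaten by
    (rho |p|)^(J - j) <= 32^(-(J - j)). The decay in the remaining j indices is bought with 16^j, so
    the radius shrinks from 1/rho to 1/(32 rho). *)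
Lemma recenter_dom j : dom (fun J => a J * ('C(J, j)%:R * p ^+ (J - j))) (M * (32 * rho) ^+ j).
Proof.
move=> J; have c0 : 0 <= M * (32 * rho) ^+ j / 2 ^+ J.
  by rewrite divr_ge0 ?exprn_ge0// mulr_ge0// exprn_ge0// mulr_ge0// ltW.
have [Jj|jJ] := ltnP J j; first by rewrite bin_small// mul0r mulr0 normr0.
rewrite normrM normrM normrX [`|_%:R|]ger0_norm//.
have hC : 'C(J, j)%:R <= 2 ^+ J :> R by rewrite -natrX ler_nat bin_le_expn.
apply: (@le_trans _ _ (M * rho ^+ J * (2 ^+ J * `|p| ^+ (J - j)))).
  apply: ler_pM; [exact: normr_ge0|by rewrite mulr_ge0// exprn_ge0|exact: a_le|].
  by apply: ler_wpM2r => //; exact: exprn_ge0.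
have -> : M * rho ^+ J * (2 ^+ J * `|p| ^+ (J - j)) =
    M * (2 * rho) ^+ j * (2 ^+ (J - j) * (rho * `|p|) ^+ (J - j)).
  rewrite !exprMn -{1 2}(subnKC jJ) !exprD; ring.
apply: (@le_trans _ _ (M * (2 * rho) ^+ j * (16 ^+ (J - j))^-1)).
  apply: ler_wpM2l; first by rewrite mulr_ge0// exprn_ge0// mulr_ge0// ltW.
  by apply: le16 => //; rewrite mulr_ge0// ltW.
have -> : M * (32 * rho) ^+ j / 2 ^+ J = M * (2 * rho) ^+ j * (16 ^+ j / 2 ^+ J).
  have -> : 32 * rho = 2 * rho * 16 by ring.
  by rewrite exprMn; ring.
apply: ler_wpM2l; first by rewrite mulr_ge0// exprn_ge0// mulr_ge0// ltW.
rewrite -{2}(subnKC jJ) exprD invfM mulrA -[leLHS]mul1r; apply: ler_pM => //.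
- by rewrite ler_pdivlMr ?exprn_gt0// mul1r lerXn2r ?nnegrE// ler_nat.
- by rewrite lef_pV2 ?posrE ?exprn_gt0// lerXn2r ?nnegrE// ler_nat.
Qed.

Lemma recenter_le j : `|recenter a p j| <= 2 * M * (32 * rho) ^+ j.
Proof. by rewrite -mulrA; exact: ssum_le (recenter_dom j). Qed.

Lemma recenterE h : rho * `|h| <= 32^-1 ->
  ssum (fun J => a J * (p + h) ^+ J) = ssum (fun j => recenter a p j * h ^+ j).
Proof.
move=> h_le.
pose d J j := a J * ('C(J, j)%:R * p ^+ (J - j)) * h ^+ j.
have hd J j : `|d J j| <= M / 2 ^+ J / 2 ^+ j.
  have c0 : 0 <= M / 2 ^+ J / 2 ^+ j by rewrite !divr_ge0// exprn_ge0.
  rewrite /d; have [Jj|jJ] := ltnP J j; first by rewrite bin_small// mul0r mulr0 mul0r normr0.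
  rewrite !normrM !normrX [`|_%:R|]ger0_norm//.
  have hC : 'C(J, j)%:R <= 2 ^+ J :> R by rewrite -natrX ler_nat bin_le_expn.
  apply: (@le_trans _ _ (M * rho ^+ J * (2 ^+ J * `|p| ^+ (J - j)) * `|h| ^+ j)).
    apply: ler_wpM2r; first exact: exprn_ge0.
    apply: ler_pM; [exact: normr_ge0|by rewrite mulr_ge0// exprn_ge0|exact: a_le|].
    by apply: ler_wpM2r => //; exact: exprn_ge0.
  have -> : M * rho ^+ J * (2 ^+ J * `|p| ^+ (J - j)) * `|h| ^+ j =
      M * (2 ^+ (J - j) * (rho * `|p|) ^+ (J - j)) * (2 ^+ j * (rho * `|h|) ^+ j).
    rewrite !exprMn -{1 2}(subnKC jJ) !exprD; ring.
  have -> : M / 2 ^+ J / 2 ^+ j = M * ((2 ^+ J)^-1 * (2 ^+ j)^-1) by ring.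
  rewrite -(mulrA M); apply: ler_wpM2l => //.
  apply: (@le_trans _ _ ((16 ^+ (J - j))^-1 * (16 ^+ j)^-1)).
    apply: ler_pM; rewrite ?le16 ?mulr_ge0 ?exprn_ge0 ?mulr_ge0 ?(ltW rho_gt0)//.
  rewrite -invfM -exprD subnK// -invfM lef_pV2 ?posrE ?mulr_gt0 ?exprn_gt0//.
  apply: (@le_trans _ _ (2 ^+ J * 2 ^+ J)).
    by apply: ler_wpM2l; [exact: exprn_ge0|rewrite ler_weXn2l ?ler1n].
  by rewrite -exprMn lerXn2r ?nnegrE//; lra.
transitivity (ssum (fun J => ssum (d J))).
  congr ssum; apply/funext => J; rewrite (@ssum_finite _ _ J.+1).
    rewrite exprDn mulr_sumr; apply: eq_bigr => j _.
    by rewrite /d -[_ *+ _]mulr_natl; ring.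
  by move=> j Jj; rewrite /d bin_small// mul0r mulr0 mul0r.
rewrite (ssum_swap hd); congr ssum; apply/funext => j.
by rewrite [RHS]mulrC -(ssumZ _ (recenter_dom j)); congr ssum; apply/funext => J; rewrite /d mulrC.
Qed.

End OneVariable.

Definition series2 (c : nat -> nat -> R) (x : R * R) : R :=
  ssum (fun J => ssum (fun K => c J K * x.2 ^+ K) * x.1 ^+ J).

(** The series is recentred in one variable at a time: in the second for each J, then in the first
    for each k. Each recentring costs a factor 32 in the growth rate, and the radius 1/(64 tau) then
    leaves the ratio 1/2. *)
Lemma series2_analytic (c : nat -> nat -> R) (M rho sigma : R) : 0 < rho -> 0 < sigma ->
  0 <= M -> (forall J K, `|c J K| <= M * rho ^+ J * sigma ^+ K) ->
  \forall p \near ((0, 0) : R * R), analytic2_at (series2 c) p.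
Proof.
move=> rho0 sigma0 M0 hc.
pose tau := Num.max rho sigma.
have tau0 : 0 < tau by rewrite lt_max rho0.
have ct J K : `|c J K| <= M * tau ^+ J * tau ^+ K.
  apply: (le_trans (hc J K)); rewrite -!mulrA; apply: ler_wpM2l => //.
  apply: ler_pM; rewrite ?exprn_ge0 ?(ltW rho0) ?(ltW sigma0)//.
    by rewrite lerXn2r ?nnegrE ?(ltW rho0) ?(ltW tau0)// le_max lexx.
  by rewrite lerXn2r ?nnegrE ?(ltW sigma0) ?(ltW tau0)// le_max lexx orbT.
have small (x : R) e : 0 < e -> `|x| < (e * tau)^-1 -> tau * `|x| <= e^-1.
  move=> e0 hx; apply: (@le_trans _ _ (tau * (e * tau)^-1)).
    by apply: ler_wpM2l; [exact: ltW|exact: ltW].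
  by rewrite invfM mulrCA divff ?mulr1// gt_eqF.
apply/near00P; exists (64 * tau)^-1; first by rewrite invr_gt0 mulr_gt0// ltr0n.
move=> p1 p2 /small hp1 /small hp2.
have {}hp1 : tau * `|p1| <= 64^-1 by apply: hp1; rewrite ltr0n.
have {}hp2 : tau * `|p2| <= 64^-1 by apply: hp2; rewrite ltr0n.
have le32 : 64^-1 <= 32^-1 :> R by rewrite lef_pV2 ?posrE ?ltr0n// ler_nat.
pose b J k := recenter (c J) p2 k.
have hb J k : `|b J k| <= 2 * M * tau ^+ J * (32 * tau) ^+ k.
  rewrite -(mulrA 2); apply: (recenter_le tau0 _ (ct J)); last exact: le_trans le32.
  by rewrite mulr_ge0// exprn_ge0// ltW.
have hb' k J : `|b J k| <= 2 * M * (32 * tau) ^+ k * tau ^+ J by rewrite mulrAC.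
pose a j k := recenter (fun J => b J k) p1 j.
have M2 k : 0 <= 2 * M * (32 * tau) ^+ k by rewrite !mulr_ge0// exprn_ge0// mulr_ge0// ltW.
have ha j k : `|a j k| <= 4 * M * (32 * tau) ^+ j * (32 * tau) ^+ k.
  have := recenter_le tau0 (M2 k) (hb' k) (le_trans hp1 le32) j.
  by congr (_ <= _); ring.
exists (fun i => a i.1 i.2); apply/near00P; exists (64 * tau)^-1.
  by rewrite invr_gt0 mulr_gt0// ltr0n.
move=> h1 h2 /small hh1 /small hh2.
have {}hh1 : tau * `|h1| <= 64^-1 by apply: hh1; rewrite ltr0n.
have {}hh2 : tau * `|h2| <= 64^-1 by apply: hh2; rewrite ltr0n.
have pw (x : R) m : tau * `|x| <= 64^-1 -> (32 * tau) ^+ m * `|x| ^+ m <= (2 ^+ m)^-1.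
  move=> hx; rewrite -exprMn -exprVn lerXn2r ?nnegrE ?mulr_ge0 ?invr_ge0 ?(ltW tau0)//.
  by rewrite -mulrA; lra.
have hd j k : `|a j k * h1 ^+ j * h2 ^+ k| <= 4 * M / 2 ^+ j / 2 ^+ k.
  rewrite !normrM !normrX.
  apply: (@le_trans _ _ (4 * M * (32 * tau) ^+ j * (32 * tau) ^+ k * `|h1| ^+ j * `|h2| ^+ k)).
    by do 2! (apply: ler_wpM2r; first exact: exprn_ge0); exact: ha.
  have -> : 4 * M * (32 * tau) ^+ j * (32 * tau) ^+ k * `|h1| ^+ j * `|h2| ^+ k =
    4 * M * (((32 * tau) ^+ j * `|h1| ^+ j) * ((32 * tau) ^+ k * `|h2| ^+ k)) by ring.
  have -> : 4 * M / 2 ^+ j / 2 ^+ k = 4 * M * ((2 ^+ j)^-1 * (2 ^+ k)^-1) by ring.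
  apply: ler_wpM2l; first by rewrite mulr_ge0.
  by apply: ler_pM; rewrite ?pw// mulr_ge0// exprn_ge0// mulr_ge0// ltW.
split; first exact: summable_dominated hd.
have [_ _ +] := ssum_square hd.
rewrite /=; congr (_ --> _).
transitivity (ssum (fun k => h2 ^+ k * ssum (fun j => a j k * h1 ^+ j))).
  congr ssum; apply/funext => k.
  have hk : dom (fun j => a j k * h1 ^+ j) (4 * M * (32 * tau) ^+ k).
    move=> j; rewrite normrM normrX.
    apply: (@le_trans _ _ (4 * M * (32 * tau) ^+ j * (32 * tau) ^+ k * `|h1| ^+ j)).
      by apply: ler_wpM2r; [exact: exprn_ge0|exact: ha].
    have -> : 4 * M * (32 * tau) ^+ j * (32 * tau) ^+ k * `|h1| ^+ j =
      4 * M * (32 * tau) ^+ k * ((32 * tau) ^+ j * `|h1| ^+ j) by ring.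
    apply: ler_wpM2l; last exact: pw.
    by rewrite !mulr_ge0// exprn_ge0// mulr_ge0// ltW.
  by rewrite -(ssumZ _ hk); congr ssum; apply/funext => j; rewrite mulrC.
pose d J k := b J k * h2 ^+ k * (p1 + h1) ^+ J.
have hp : tau * `|p1 + h1| <= 32^-1.
  apply: (@le_trans _ _ (tau * `|p1| + tau * `|h1|)).
    by rewrite -mulrDr; apply: ler_wpM2l; [exact: ltW|exact: ler_normD].
  by lra.
have hd' J k : `|d J k| <= 2 * M / 2 ^+ J / 2 ^+ k.
  rewrite /d !normrM !normrX.
  apply: (@le_trans _ _ (2 * M * tau ^+ J * (32 * tau) ^+ k * `|h2| ^+ k * `|p1 + h1| ^+ J)).
    by do 2! (apply: ler_wpM2r; first exact: exprn_ge0); exact: hb.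
  have -> : 2 * M * tau ^+ J * (32 * tau) ^+ k * `|h2| ^+ k * `|p1 + h1| ^+ J =
    2 * M * ((tau * `|p1 + h1|) ^+ J * ((32 * tau) ^+ k * `|h2| ^+ k)) by rewrite [(tau * `|p1 + h1|) ^+ J]exprMn; ring.
  have -> : 2 * M / 2 ^+ J / 2 ^+ k = 2 * M * ((2 ^+ J)^-1 * (2 ^+ k)^-1) by ring.
  apply: ler_wpM2l; first by rewrite mulr_ge0.
  apply: ler_pM; rewrite ?pw ?mulr_ge0 ?exprn_ge0 ?mulr_ge0 ?(ltW tau0)//.
  rewrite -exprVn lerXn2r ?nnegrE ?mulr_ge0 ?invr_ge0 ?(ltW tau0)//.
  by apply: (le_trans hp); rewrite lef_pV2 ?posrE ?ltr0n// ler_nat.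
transitivity (ssum (fun k => ssum (fun J => d J k))).
  congr ssum; apply/funext => k.
  rewrite -(recenterE tau0 (M2 k) (hb' k) (le_trans hp1 le32) (le_trans hh1 le32)).
  have hk : dom (fun J => b J k * (p1 + h1) ^+ J) (2 * M * (32 * tau) ^+ k).
    move=> J; rewrite normrM normrX.
    apply: (@le_trans _ _ (2 * M * (32 * tau) ^+ k * tau ^+ J * `|p1 + h1| ^+ J)).
      by apply: ler_wpM2r; [exact: exprn_ge0|exact: hb'].
    rewrite -mulrA -exprMn; apply: ler_wpM2l => //.
    rewrite -exprVn lerXn2r ?nnegrE ?mulr_ge0 ?invr_ge0 ?(ltW tau0)//.
    by apply: (le_trans hp); rewrite lef_pV2 ?posrE ?ltr0n// ler_nat.
  by rewrite -(ssumZ _ hk); congr ssum; apply/funext => J; rewrite /d; ring.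
rewrite -(ssum_swap hd') /series2 /=; congr ssum; apply/funext => J.
have MJ : 0 <= M * tau ^+ J by rewrite mulr_ge0// exprn_ge0// ltW.
rewrite (recenterE tau0 MJ (ct J) (le_trans hp2 le32) (le_trans hh2 le32)).
have hk : dom (fun k => b J k * h2 ^+ k) (2 * M * tau ^+ J).
  move=> k; rewrite normrM normrX.
  apply: (@le_trans _ _ (2 * M * tau ^+ J * (32 * tau) ^+ k * `|h2| ^+ k)).
    by apply: ler_wpM2r; [exact: exprn_ge0|exact: hb].
  rewrite -mulrA; apply: ler_wpM2l; last exact: pw.
  by rewrite !mulr_ge0// exprn_ge0// ltW.
by rewrite [RHS]mulrC -(ssumZ _ hk); congr ssum; apply/funext => k; rewrite /d; ring.
Qed.

End DoublePowerSeries.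

(** * Coefficients of the expansion and its dependence on both variables *)

Section Expansion.
Context {R : realType}.

(** After removal of the constant term, |a_1| x is at most a multiple of x^2; divide by a small x >
    0. *)
Lemma constant_series_coef1 (a : nat -> R) (M rho d l : R) : 0 < rho -> 0 <= M -> 0 < d ->
  (forall J, `|a J| <= M * rho ^+ J) ->
  (forall x, `|x| < d -> ssum (fun J => a J * x ^+ J) = l) -> a 1%N = 0.
Proof.
move=> rho0 M0 d0 ha hl.
have a0 : a 0%N = l.
  rewrite -(hl 0) ?normr0// (@ssum_finite _ _ 1) ?big_ord1 ?expr0 ?mulr1//.
  by case=> // J _; rewrite expr0n /= mulr0.
apply/eqP; rewrite -normr_le0; apply/ler_addgt0Pr => eps eps0; rewrite add0r.
pose K := 2 * M * rho ^+ 2 + 1.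
have K0 : 0 < K by rewrite ltr_wpDl// mulr_ge0 ?sqr_ge0// mulr_ge0.
pose x := Num.min (d / 2) (Num.min (2 * rho)^-1 (eps / K)).
have x0 : 0 < x by rewrite !lt_min !divr_gt0 ?invr_gt0 ?mulr_gt0.
have xd : x < d by rewrite (le_lt_trans (_ : _ <= d / 2))// ?ge_min ?lexx//; lra.
have xr : rho * x <= 2^-1.
  rewrite -ler_pdivlMl//; apply: (@le_trans _ _ (2 * rho)^-1).
    by rewrite !ge_min lexx orbT.
  by rewrite invfM mulrC.
have xe : x <= eps / K by rewrite !ge_min lexx !orbT.
have term J : `|a J * x ^+ J| <= M * (rho * x) ^+ J.
  rewrite normrM normrX (gtr0_norm x0) exprMn mulrA.
  by apply: ler_wpM2r; [rewrite exprn_ge0// ltW|exact: ha].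
have rx0 : 0 <= rho * x by rewrite mulr_ge0// ltW.
have hd : dom (fun J => a J * x ^+ J) M.
  move=> J; apply: (le_trans (term J)); apply: ler_wpM2l => //.
  by rewrite -exprVn lerXn2r ?nnegrE ?invr_ge0.
have := hl x; rewrite gtr0_norm// => /(_ xd).
rewrite (ssum_split 2 hd) big_ord_recl big_ord1 /= expr0 mulr1 a0 expr1.
set tl := ssum _ => E.
have ht : `|tl| <= 2 * (M * (rho * x) ^+ 2).
  apply: ssum_le => J; apply: (le_trans (term _)); rewrite exprD mulrA.
  apply: ler_wpM2l; first by rewrite mulr_ge0// exprn_ge0.
  by rewrite -exprVn lerXn2r ?nnegrE ?invr_ge0.
have E2 : a 1%N * x = - tl by move: E; rewrite /bump /=; lra.
have : `|a 1%N| * x <= 2 * M * rho ^+ 2 * x * x.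
  rewrite -[X in _ * X <= _](gtr0_norm x0) -normrM E2 normrN; apply: (le_trans ht).
  by rewrite exprMn le_eqVlt; apply/orP; left; apply/eqP; ring.
rewrite ler_pM2r// => h; apply: (le_trans h).
apply: (@le_trans _ _ (K * x)); first by apply: ler_wpM2r; [exact: ltW|rewrite lerDl].
by rewrite mulrC -ler_pdivlMr.
Qed.

Section Coefficients.
Variables (n theta A X a : R) (g : nat -> {poly R}).
Let beta := 3 - n.
Let kappa := 64 * (theta `^ (- n) * X `^ beta).
Let r := 64 * X.
Let q := 64 * X `^ beta.
Hypothesis n_gt0 : 0 < n.
Hypothesis n_lt3 : n < 3.
Hypothesis theta_gt0 : 0 < theta.
Hypothesis X_gt0 : 0 < X.
Hypothesis X_small : 64 * X <= 1.
Hypothesis A_gt0 : 0 < A.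
Hypothesis A_bound : forall N j k, (j < N)%N -> (k <= 3)%N ->
  mu beta N j ^+ k <= A * `|indicial beta N j|.
Hypothesis gE : forall N, g N = gstep n beta kappa r a N g.
Hypothesis small : `|a| + 4 * (A * kappa) <= Num.min 1 beta / 5.

Let beta_gt0 : 0 < beta. Proof. by rewrite subr_gt0. Qed.
Let n_le : `|1 - n| <= 2.
Proof. by have h0 := n_gt0; have h3 := n_lt3; rewrite ler_norml; apply/andP; split; lra. Qed.
Let kappa_gt0 : 0 < kappa. Proof. by rewrite mulr_gt0// mulr_gt0// powR_gt0. Qed.
Let r_gt0 : 0 < r. Proof. by rewrite mulr_gt0. Qed.
Let q_gt0 : 0 < q. Proof. by rewrite mulr_gt0// powR_gt0. Qed.
Let r_itv : 0 <= r <= 1. Proof. by rewrite X_small ltW. Qed.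
Local Notation V := (vcoef beta kappa r a g).

(** Division by the powers of [r] and [q] undoes the scaling y1 = x/(64 X), y2 = x^beta/(64
    X^beta). *)
Definition expansion_coef J K : R := (V (J + K)%N)`_J / r ^+ J / q ^+ K.
Definition expansion : R * R -> R := series2 expansion_coef.

Lemma coef_V_le N j : `|(V N)`_j| <= 1.
Proof.
apply: (le_trans (coef_le_pnorm _ _)).
apply: (le_trans (V_bound beta_gt0 n_le (ltW kappa_gt0) r_itv A_gt0 A_bound gE small N)).
by rewrite invf_le1// ler1n.
Qed.

Lemma expansion_coef_le J K : `|expansion_coef J K| <= 1 * (r^-1) ^+ J * (q^-1) ^+ K.
Proof.
rewrite /expansion_coef !exprVn !normrM !normfV !normrX (gtr0_norm r_gt0) (gtr0_norm q_gt0).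
apply: ler_wpM2r; first by rewrite invr_ge0 exprn_ge0// ltW.
apply: ler_wpM2r; first by rewrite invr_ge0 exprn_ge0// ltW.
exact: coef_V_le.
Qed.

Lemma expansion_analytic : \forall p \near ((0, 0) : R * R), analytic2_at expansion p.
Proof.
by apply: series2_analytic expansion_coef_le; rewrite ?invr_gt0.
Qed.

(** The local solution sums by total degree N, the expansion by rows J; [ssum_diag] identifies the
    two sums. *)
Lemma expansion_path x : 0 < x < X -> expansion (x, x `^ beta) = phi beta kappa r a g 0 (ln (x / X)).
Proof.
move=> /andP[x0 xX]; set t := ln (x / X).
have xX0 : 0 < x / X by rewrite divr_gt0.
have t0 : t <= 0 by rewrite ln_le0// ler_pdivrMr// mul1r ltW.
have [_ <-] := psum_vcoef beta_gt0 n_le (ltW kappa_gt0) r_itv A_gt0 A_bound gE small (leq0n 3) t0.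
have y1 : x / r = expR t / 64.
  by rewrite /t lnK ?posrE// /r; field; rewrite gt_eqF.
have y2 : x `^ beta / q = expR (beta * t) / 64.
  have -> : expR (beta * t) = (x / X) `^ beta by rewrite /powR gt_eqF.
  have -> : x `^ beta = (x / X) `^ beta * X `^ beta.
    by rewrite -powRM ?divfK ?gt_eqF// ltW.
  by rewrite /q; field; rewrite gt_eqF// powR_gt0.
pose f j k := (V (j + k)%N)`_j * (expR t / 64) ^+ j * (expR (beta * t) / 64) ^+ k.
have e1 : expR t <= 1 by rewrite expR_le1.
have e2 : expR (beta * t) <= 1 by rewrite expR_le1 mulr_ge0_le0// ltW.
have p4 (z : R) m : 0 <= z -> z <= 1 -> `|(z / 64) ^+ m| <= (4 ^+ m)^-1.
  move=> z0 z1; rewrite ger0_norm ?exprn_ge0 ?divr_ge0//.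
  by rewrite -exprVn lerXn2r ?nnegrE ?divr_ge0 ?invr_ge0//; lra.
have hf j k : `|f j k| <= 1 / 4 ^+ (j + k).
  rewrite /f 2!normrM exprD invfM -mulrA; apply: ler_pM => //; first exact: coef_V_le.
  by apply: ler_pM; rewrite ?p4 ?expR_ge0.
transitivity (ssum (fun j => ssum (f j))).
  rewrite /expansion /series2 /=; congr ssum; apply/funext => J.
  have hJ : dom (fun K => expansion_coef J K * (x `^ beta) ^+ K) ((r ^+ J)^-1).
    move=> K; rewrite normrM normrX [`|x `^ beta|]ger0_norm ?powR_ge0//.
    apply: (@le_trans _ _ (1 * (r^-1) ^+ J * (q^-1) ^+ K * (x `^ beta) ^+ K)).
      by apply: ler_wpM2r; [rewrite exprn_ge0// powR_ge0|exact: expansion_coef_le].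
    rewrite mul1r exprVn -mulrA -exprMn; apply: ler_wpM2l.
      by rewrite invr_ge0 exprn_ge0// ltW.
    rewrite mulrC y2 -exprVn lerXn2r ?nnegrE ?divr_ge0 ?expR_ge0 ?invr_ge0//; lra.
  rewrite [LHS]mulrC -(ssumZ _ hJ); congr ssum; apply/funext => K.
  rewrite /f -y1 -y2 /expansion_coef (exprMn J x r^-1) (exprMn K (x `^ beta) q^-1) !exprVn; ring.
rewrite -(ssum_diag hf) /psum; congr ssum; apply/funext => N.
rewrite /ev; apply: eq_bigr => j _; have jN : (j <= N)%N by rewrite -ltnS.
rewrite /f subnKC// coef_poly ltnS jN expr0 mul1r !exprMn !exprVn -!expRM_natr.
have -> : mu beta N j * t = t * j%:R + beta * t * (N - j)%:R.
  by rewrite muE//; ring.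
rewrite expRD.
have -> : (64 ^+ N)^-1 = (64 ^+ j)^-1 * (64 ^+ (N - j))^-1 :> R.
  by rewrite -invfM -exprD subnKC.
by ring.
Qed.

Lemma series2_axis (c : nat -> nat -> R) y : series2 c (0, y) = ssum (fun K => c 0%N K * y ^+ K).
Proof.
rewrite /series2 (@ssum_finite _ _ 1) ?big_ord1 ?expr0 ?mulr1//.
by case=> // J _; rewrite /= expr0n /= mulr0.
Qed.

Let V1_1 : (V 1%N)`_1 = a.
Proof.
rewrite /vcoef /= coefD coefZ coefX mulr1 coef_mult; last first.
  by rewrite (leq_trans (size_scale_leq _ _))// (leq_trans (size_g gE 0)).
by rewrite /invind ltnn mul0r addr0.
Qed.

Lemma expansion_coef10 : expansion_coef 1 0 = a / r.
Proof. by rewrite /expansion_coef addn0 V1_1 expr1 expr0 divr1. Qed.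

Lemma expansion_coef01_neq0 : expansion_coef 0 1 != 0.
Proof.
rewrite /expansion_coef add0n expr0 divr1 expr1; apply: mulf_neq0; last by rewrite invr_eq0 gt_eqF.
have := vcoef_indicial A_gt0 A_bound gE 1 0; rewrite (g_0 gE) coef1 mulr0 subr0 mulr1 => h.
apply/eqP => e; move: h; rewrite e mulr0 => /eqP; rewrite eq_sym oppr_eq0 => /eqP.
by have := kappa_gt0; lra.
Qed.

(** For a = 0 the series g has no term in y1, so the coefficient of y1 y2 is forced by the factor 1
    - x of the equation alone: it is kappa r divided by a nonzero indicial value. *)
Lemma expansion_coef11_neq0 : a = 0 -> expansion_coef 1 1 != 0.
Proof.
move=> a0; rewrite /expansion_coef addn1 !expr1.
apply: mulf_neq0; last by rewrite invr_eq0 gt_eqF.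
apply: mulf_neq0; last by rewrite invr_eq0 gt_eqF.
have g11 : (g 1%N)`_1 = 0.
  rewrite gE /gstep /= big_ord1 subn0 (g_0 gE) mul1r.
  have -> : mult (mu beta) 0 1 = 0 :> {poly R}.
    apply/polyP => j; rewrite coef_poly coef0; case: j => [|j] //=.
    by rewrite /mu !mulr0 addr0 mul0r.
  rewrite mulr0 subr0 coef_poly /= coefZ coef_mult; last exact: size_vcoef.
  by rewrite V1_1 a0 !mulr0.
have := vcoef_indicial A_gt0 A_bound gE 2 1; rewrite g11 (g_0 gE) mulr1 coefX mulr1 => h.
apply/eqP => e; move: h; rewrite e mulr0 sub0r mulrNN => /eqP.
by rewrite eq_sym mulf_eq0 !gt_eqF.
Qed.

Let slice (y : R) : `|y| < q / 2 ->
  forall J, dom (fun K => expansion_coef J K * y ^+ K) ((r^-1) ^+ J).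
Proof.
move=> hy J K; rewrite normrM normrX.
apply: (@le_trans _ _ (1 * (r^-1) ^+ J * (q^-1) ^+ K * `|y| ^+ K)).
  by apply: ler_wpM2r; [exact: exprn_ge0|exact: expansion_coef_le].
rewrite mul1r -mulrA -exprMn; apply: ler_wpM2l; first by rewrite exprn_ge0// invr_ge0 ltW.
rewrite -exprVn lerXn2r ?nnegrE ?mulr_ge0 ?invr_ge0 ?(ltW q_gt0)//.
by rewrite mulrC ler_pdivrMr// mulrC ltW.
Qed.

(** Shooting does not tell whether a = 0, so the coefficient of x alone does not decide. If v
    depended on x2 only, the coefficient of x1 would vanish as a power series in x2. Its constant
    term then gives a = 0, and its linear term contradicts [expansion_coef11_neq0]. *)
Lemma expansion_depends_on_fst : depends_on_fst expansion.
Proof.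
move=> [w /near00P[d d0 hw]].
have rV : 0 < r^-1 by rewrite invr_gt0.
have qV : 0 < q^-1 by rewrite invr_gt0.
pose d' := Num.min d (q / 2).
have d'0 : 0 < d' by rewrite lt_min d0 divr_gt0.
have G1 y : `|y| < d' -> ssum (fun K => expansion_coef 1 K * y ^+ K) = 0.
  rewrite lt_min => /andP[yd yq].
  apply: (@constant_series_coef1 (fun J => ssum (fun K => expansion_coef J K * y ^+ K)) 2 r^-1 d (w y)) => //.
    by move=> J; apply: ssum_le; exact: slice.
  by move=> x xd; exact: hw.
have a0 : a = 0.
  have := G1 0; rewrite normr0 => /(_ d'0); rewrite (@ssum_finite _ _ 1); last first.
    by case=> // K _; rewrite expr0n /= mulr0.
  rewrite big_ord1 expr0 mulr1 expansion_coef10 => /eqP.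
  by rewrite mulf_eq0 invr_eq0 (gt_eqF r_gt0) orbF => /eqP.
have /eqP : expansion_coef 1 1 != 0 by exact: expansion_coef11_neq0.
apply; apply: (@constant_series_coef1 (expansion_coef 1) r^-1 q^-1 d' 0) => //; first exact: ltW.
by move=> K; have := expansion_coef_le 1 K; rewrite mul1r expr1.
Qed.

(** On the axis x1 = 0 the expansion would be constant, but its coefficient of x2 is a nonzero
    multiple of [kappa], whatever [a] is. *)
Lemma expansion_depends_on_snd : depends_on_snd expansion.
Proof.
move=> [w /near00P[d d0 hw]].
have qV : 0 < q^-1 by rewrite invr_gt0.
have /eqP := expansion_coef01_neq0; apply.
apply: (@constant_series_coef1 (expansion_coef 0) 1 q^-1 d (w 0)) => //.
  by move=> K; have := expansion_coef_le 0 K; rewrite expr0 mulr1.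
by move=> y yd; rewrite -series2_axis; apply: hw => //; rewrite normr0.
Qed.

Lemma expansion00 : expansion (0, 0) = 0.
Proof.
rewrite /expansion series2_axis (@ssum_finite _ _ 1) ?big_ord1.
  by rewrite expr0 mulr1 /expansion_coef addn0 vcoef0 coef0 !mul0r.
by case=> // K _; rewrite expr0n /= mulr0.
Qed.

Lemma expansion_nonzero : nonzero_germ expansion.
Proof. by move=> h; apply: expansion_depends_on_fst; exists (fun=> 0). Qed.

End Coefficients.
End Expansion.

Unset Implicit Arguments.

Theorem theorem3p2 (R : realType) (n theta : R)
    (n_gt0 : 0 < n) (n_lt3 : n < 3)
    (n_nonres : forall m : nat, (0 < m)%N -> n <> 3 - m%:R^-1)
    (theta_gt0 : 0 < theta) :
  exists H : R -> R,
    [/\ is_solution n theta H,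
        forall K : R -> R, is_solution n theta K ->
          forall x : R, x \in `[0, 1] -> K x = H x
      & exists v : R * R -> R,
          [/\ \forall p \near ((0, 0) : R * R), analytic2_at v p,
              v (0, 0) = 0,
              nonzero_germ v,
              depends_on_fst v /\ depends_on_snd v
            & exists c : R, 0 < c /\ forall x : R, 0 <= x <= c ->
                H x = theta * x * (1 + v (x, x `^ (3 - n)))]].
Proof.
have [A [X [a [g [[X0 X1 A0 hA] gE small [H [u [w [P d0 d1 HE]]]]]]]]] :=
  shooting n_gt0 n_lt3 n_nonres theta_gt0.
exists H; split.
- exact: profile_is_solution P d0 d1.
- move=> K /is_solution_profile[u' [w' P']] x; rewrite in_itv /=.
  exact: (profile_unique n_gt0 n_lt3 theta_gt0 P' P).
exists (expansion n theta X a g); split.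
- exact: (expansion_analytic n_gt0 n_lt3 theta_gt0 X0 X1 A0 hA gE small).
- exact: expansion00.
- exact: (expansion_nonzero n_gt0 n_lt3 theta_gt0 X0 X1 A0 hA gE small).
- split.
    exact: (expansion_depends_on_fst n_gt0 n_lt3 theta_gt0 X0 X1 A0 hA gE small).
  exact: (expansion_depends_on_snd n_gt0 n_lt3 theta_gt0 X0 X1 A0 hA gE small).
(* H agrees with the series solution below X/2. At x = 0 the factor x settles the equality, since
   the expansion is matched with phi only for x > 0. *)
exists (X / 4); split; first by rewrite divr_gt0.
move=> x /andP[x0 xX].
have xX2 : x < X / 2 by lra.
rewrite (HE x xX2) /hloc; move: x0; rewrite le_eqVlt => /predU1P[<-|x0].
  by rewrite mulr0 !mul0r.
by rewrite (expansion_path n_gt0 n_lt3 theta_gt0 X0 X1 A0 hA gE small)// x0/=; lra.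
Qed.
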